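(* Let $M=\mathbb{C}^n/(\mathbb{Z}^n+\mathrm{i}\mathbb{Z}^n)$, and let $\mathbb{T}\cong\mathbb{R}^n/\mathbb{Z}^n$ act on $M$ by translations of the imaginary parts. Let $\omega$ be a $\mathbb{T}$-invariant K\''ahler form with symplectic potential $u$ and let $\alpha$ be a compatible $\mathbb{T}$-invariant first-order deformation of the complex structure, with all eigenvalues of $\alpha\bar\alpha$ less than $1$, represented in symplectic coordinates by the matrix-valued function $\xi$. Write $G=D^2u$, $(G^{ab})=G^{-1}$ and $\check\alpha=\psi(\xi\,G\,\bar\xi\,G)$. Then the HcscK equations $$\mathrm{div}(\partial^*\alpha)=0,\qquad 2S(\omega)-2\hat S+\mathrm{div}\,X(\alpha)=0$$ are equivalent, respectively, to the equations of the uncoupled system $$\begin{cases}\left(\xi^{ab}\right)_{,ab}=0\\[2pt] \left(-\frac{1}{2}G^{ab}+(\check{\alpha}\,\xi\, G\,\bar{\xi})^{ab}\right)_{,ab}=0,\end{cases}$$ corresponding to the vanishing of the complex and real moment map respectively.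
   Context: **Complex coordinates.** $\boldsymbol{z}=\boldsymbol{x}+\mathrm{i}\boldsymbol{w}$ are the coordinates induced from $\mathbb{C}^n$, $\boldsymbol t\in\mathbb{T}$ acts by $\boldsymbol x+\mathrm{i}\boldsymbol w\mapsto\boldsymbol x+\mathrm{i}(\boldsymbol w+\boldsymbol t)$, $\omega_0=\mathrm{i}\sum_a\mathrm{d}z^a\wedge\mathrm{d}\bar z^a$. The $\mathbb{T}$-invariant K\''ahler form $\omega\in[\omega_0]$ has the form $\omega=\mathrm{i}\partial\bar\partial f$ with local potential $f=|\boldsymbol z|^2+4h(\boldsymbol x)$, $h$ periodic. With $v(\boldsymbol x)=\frac12|\boldsymbol x|^2+h(\boldsymbol x)$, the metric is $g_{a\bar b}=v_{,ab}$ (derivatives in $\boldsymbol x$). **Symplectic coordinates.** $\boldsymbol y=\partial_{\boldsymbol x}v$, $\boldsymbol x=\partial_{\boldsymbol y}u$, $u(\boldsymbol y)+v(\boldsymbol x)=\boldsymbol x\cdot\boldsymbol y$; $u$ is the symplectic potential. $D^2u=\mathrm{Hess}_{\boldsymbol y}u$ is periodic and positive definite, and equals $(v_{,ab})^{-1}$. The deformation is $\alpha=q_{ac}(\boldsymbol x)v^{cb}(\boldsymbol x)\,\partial_{\bar z^b}\otimes\mathrm{d}z^a$ with $q$ symmetric complex matrix-valued and $\mathbb{T}$-invariant ($\alpha$ compatible means exactly that $q$ is symmetric), and $\xi^{ab}(\boldsymbol y):=q_{ab}(\boldsymbol x)$. Subscripts after a comma in the final system denote derivatives in $\boldsymbol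 y$; repeated indices are summed. **HcscK terms.** $S$ is normalised by $S\,\omega^n=n\,\mathrm{Ric}\wedge\omega^{n-1}$, $\mathrm{Ric}=-\mathrm{i}\partial\bar\partial\log\det(g_{a\bar b})$; its average $\hat S$ is $0$ here. $(\partial^*\alpha)^{\bar b}=-g^{a\bar c}\nabla_{\bar c}\alpha_a{}^{\bar b}$. The vector field is $$X(\alpha)=2\,\mathrm{Re}\big(g(\nabla^a\alpha,\bar\alpha\hat\alpha)\partial_{z^a}-g(\nabla^{\bar b}\alpha,\bar\alpha\hat\alpha)\partial_{\bar z^b}-2\nabla^*(\alpha\bar\alpha\hat\alpha)\big),$$ with $\hat\alpha=\psi(\alpha\bar\alpha)$, $\psi(x)=\frac12(1+\sqrt{1-x})^{-1}$ (functional calculus; eigenvalues of $\alpha\bar\alpha$, equal to those of $\xi G\bar\xi G$, are real and non-negative). Here $\alpha:T^{1,0}M\to T^{0,1}M$, $g$ is extended $\mathbb{C}$-bilinearly, $\nabla$ is Levi-Civita, $\nabla^a=g^{a\bar b}\nabla_{\bar b}$, $\nabla^{\bar b}=g^{a\bar b}\nabla_a$, $\nabla^*Q=-g^{ij}\nabla_iQ^k{}_j\partial_k$. *)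

(* Defs.v *)
From HB Require Import structures.
From mathcomp Require Import all_boot all_order all_algebra all_fingroup.
From mathcomp Require Import complex.
From mathcomp Require Import all_classical all_reals all_analysis.

Set Implicit Arguments.
Unset Strict Implicit.
Unset Printing Implicit Defensive.

Import Order.TTheory GRing.Theory Num.Theory.
Import numFieldNormedType.Exports.

Local Open Scope ring_scope.
Local Open Scope classical_set_scope.
Local Open Scope complex_scope.

Section calculus.
Context {R : realType}.

(* [R[i]] is not a normed module over [R]; a complex-valued function is
   differentiated through its real and imaginary parts. *)
Definition Cderive {V : normedModType R} (v : V) (F : V -> R[i]) (z : V) : R[i] :=
  'D_v (fun z => complex.Re (F z)) z +i* 'D_v (fun z => complex.Im (F z)) z.

Context {n : nat}.
Implicit Types (f : 'rV[R]_n -> R) (F : 'rV[R]_n -> R[i]).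

Definition pd (a : 'I_n) f : 'rV[R]_n -> R := fun x => 'D_(delta_mx 0 a) f x.

Definition Cpd (a : 'I_n) F : 'rV[R]_n -> R[i] := Cderive (delta_mx 0 a) F.

Definition grad f (x : 'rV[R]_n) : 'rV[R]_n := \row_a pd a f x.

Definition Hess f (x : 'rV[R]_n) : 'M[R]_n := \matrix_(a, b) pd a (pd b f) x.

(* C^infinity: every iterated partial derivative is Frechet differentiable. *)
Definition smooth f : Prop :=
  forall (s : seq 'I_n) x, differentiable (foldr pd f s) x.

Definition Csmooth F : Prop :=
  smooth (fun x => complex.Re (F x)) /\ smooth (fun x => complex.Im (F x)).

Definition Zperiodic {T : Type} (f : 'rV[R]_n -> T) : Prop :=
  forall x (k : 'rV[int]_n), f (x + map_mx intr k) = f x.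

(* (Z^{ab})_{,ab} *)
Definition ddiv (Z : 'rV[R]_n -> 'M[R[i]]_n) (y : 'rV[R]_n) : R[i] :=
  \sum_(a < n) \sum_(b < n) Cpd b (Cpd a (fun y => Z y a b)) y.

Definition complexmx {m p : nat} (A : 'M[R]_(m, p)) : 'M[R[i]]_(m, p) :=
  map_mx (fun r : R => r%:C) A.

Definition mxconj {m p : nat} (A : 'M[R[i]]_(m, p)) : 'M[R[i]]_(m, p) :=
  map_mx (@conjc R) A.

Definition posdefmx (H : 'M[R[i]]_n) : Prop :=
  forall c : 'rV[R[i]]_n, c != 0 -> 0 < (c *m H *m (mxconj c)^T) 0 0.

(* Functional calculus for a matrix that is diagonalizable with real
   eigenvalues; [B] does not depend on the diagonalization. *)
Definition is_funcalc (f : R -> R) (A B : 'M[R[i]]_n) : Prop :=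
  exists (P : 'M[R[i]]_n) (d : 'rV[R]_n),
    [/\ P \in unitmx,
        A = invmx P *m diag_mx (complexmx d) *m P &
        B = invmx P *m diag_mx (complexmx (map_mx f d)) *m P].

Definition funcalc (f : R -> R) (A : 'M[R[i]]_n) : 'M[R[i]]_n :=
  xget 0 [set B | is_funcalc f A B].

Definition psi (x : R) : R := 2^-1 * (1 + Num.sqrt (1 - x))^-1.

End calculus.

Section torus.
Context {R : realType}.

Fixpoint cube_int (m : nat) : ('rV[R]_m -> R) -> R :=
  match m with
  | 0%N => fun F => F 0
  | m'.+1 => fun F =>
      Rintegral lebesgue_measure `[0, 1]%classic
        (fun t => cube_int (fun x : 'rV[R]_m' => F (row_mx (const_mx t : 'rV_1) x)))
  end.

Context {n : nat}.

(* A point of C^n is the pair (x, w) of its real and imaginary parts; objects on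
   the torus C^n / (Z^n + iZ^n) are represented by their lifts to C^n. *)
Definition Cspace : Type := ('rV[R]_n * 'rV[R]_n)%type.

Definition torus_int (F : Cspace -> R[i]) : R[i] :=
  cube_int (fun x => cube_int (fun w => complex.Re (F (x, w))))
  +i* cube_int (fun x => cube_int (fun w => complex.Im (F (x, w)))).

Definition dx (a : 'I_n) (F : Cspace -> R[i]) : Cspace -> R[i] :=
  Cderive ((delta_mx 0 a, 0) : 'rV[R]_n * 'rV[R]_n) F.

Definition dw (a : 'I_n) (F : Cspace -> R[i]) : Cspace -> R[i] :=
  Cderive ((0, delta_mx 0 a) : 'rV[R]_n * 'rV[R]_n) F.

Definition dz (a : 'I_n) (F : Cspace -> R[i]) : Cspace -> R[i] :=
  fun z => 2^-1 * (dx a F z - (0 +i* 1) * dw a F z).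

Definition dzbar (a : 'I_n) (F : Cspace -> R[i]) : Cspace -> R[i] :=
  fun z => 2^-1 * (dx a F z + (0 +i* 1) * dw a F z).

(* The coefficient of i^n dz^1 /\ dzbar^1 /\ ... /\ dz^n /\ dzbar^n in the wedge
   product of the (1,1)-forms i (eta k)_{ab} dz^a /\ dzbar^b, k < n. *)
Definition wedge11 (eta : 'I_n -> 'M[R[i]]_n) : R[i] :=
  \sum_(s : 'S_n) \sum_(t : 'S_n)
    (-1) ^+ s * (-1) ^+ t * \prod_(k < n) eta k (s k) (t k).

Section kahler.
(* The matrix (g_{a bbar}) of the Kaehler metric. *)
Variable H : Cspace -> 'M[R[i]]_n.

Definition Ricci (z : Cspace) : 'M[R[i]]_n :=
  \matrix_(a, b) - dz a (dzbar b (fun z => (ln (complex.Re (\det (H z))))%:C)) z.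

Definition omega_top (z : Cspace) : R[i] := wedge11 (fun=> H z).

(* S omega^n = n Ric /\ omega^(n-1) *)
Definition scal (z : Cspace) : R[i] :=
  n%:R * wedge11 (fun k => if (k : nat) == 0%N then Ricci z else H z)
  / omega_top z.

Definition scal_avg : R[i] :=
  torus_int (fun z => scal z * omega_top z) / torus_int omega_top.

(* Tensor calculus on the complexified tangent bundle, in the frame d/dz^a
   (index [lshift n a]), d/dzbar^a (index [rshift n a]).  In the matrix of an
   endomorphism the row is the upper index and the column the lower index, so
   that composition is [*m]. *)

Definition bar (k : 'I_(n + n)) : 'I_(n + n) :=
  match fintype.split k with inl a => rshift n a | inr a => lshift n a end.

Definition pdframe (k : 'I_(n + n)) : (Cspace -> R[i]) -> Cspace -> R[i] :=
  match fintype.split k with inl a => dz a | inr a => dzbar a end.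

(* The C-bilinear extension of the metric, and its inverse (g^{ij}). *)
Definition gmx (z : Cspace) : 'M[R[i]]_(n + n) := block_mx 0 (H z) (H z)^T 0.

Definition ginv (z : Cspace) : 'M[R[i]]_(n + n) := invmx (gmx z).

(* The Levi-Civita connection: Gamma^k_{ij}. *)
Definition Gamma (k i j : 'I_(n + n)) (z : Cspace) : R[i] :=
  2^-1 * \sum_l ginv z k l *
    (pdframe i (fun z => gmx z j l) z + pdframe j (fun z => gmx z i l) z
     - pdframe l (fun z => gmx z i j) z).

Definition vfield : Type := Cspace -> 'cV[R[i]]_(n + n).
Definition endfield : Type := Cspace -> 'M[R[i]]_(n + n).

Definition div (V : vfield) (z : Cspace) : R[i] :=
  \sum_i (pdframe i (fun z => V z i 0) z + \sum_l Gamma i i l z * V z l 0).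

Definition nabla (i : 'I_(n + n)) (Q : endfield) : endfield := fun z =>
  \matrix_(k, j) (pdframe i (fun z => Q z k j) z
    + \sum_l Gamma k i l z * Q z l j - \sum_l Gamma l i j z * Q z k l).

(* nabla^k = g^{kl} nabla_l *)
Definition nabla_up (k : 'I_(n + n)) (Q : endfield) : endfield := fun z =>
  \sum_l ginv z k l *: nabla l Q z.

Definition nabla_star (Q : endfield) : vfield := fun z =>
  \col_k - \sum_i \sum_j ginv z i j * nabla i Q z k j.

Definition gpair (A B : endfield) (z : Cspace) : R[i] :=
  \sum_i \sum_j \sum_k \sum_l
    ginv z i j * gmx z k l * A z k i * B z l j.

(* 2 Re V = V + conj V *)
Definition twoRe (V : vfield) : vfield := fun z =>
  \col_k (V z k 0 + conjc (V z (bar k) 0)).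

(* The matrix of alpha : T^{1,0} -> T^{0,1}; the bundle maps between T^{1,0} and
   T^{0,1} are extended by 0 to the complexified tangent bundle. *)
Variable alpha : Cspace -> 'M[R[i]]_n.

Definition ext10_01 (A : Cspace -> 'M[R[i]]_n) : endfield :=
  fun z => block_mx 0 0 (A z) 0.
Definition ext01_10 (A : Cspace -> 'M[R[i]]_n) : endfield :=
  fun z => block_mx 0 (A z) 0 0.
Definition ext01_01 (A : Cspace -> 'M[R[i]]_n) : endfield :=
  fun z => block_mx 0 0 0 (A z).

(* alpha o conj alpha : T^{0,1} -> T^{0,1} *)
Definition aabar (z : Cspace) : 'M[R[i]]_n := alpha z *m mxconj (alpha z).

Definition ahat (z : Cspace) : 'M[R[i]]_n := funcalc psi (aabar z).

(* (d^* alpha)^{bbar} = - g^{a cbar} nabla_{cbar} alpha_a^{bbar} *)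
Definition dstar : vfield := fun z =>
  col_mx 0 (\col_(b < n) - \sum_(a < n) \sum_(c < n)
    ginv z (lshift n a) (rshift n c)
    * nabla (rshift n c) (ext10_01 alpha) z (rshift n b) (lshift n a)).

Definition Xfield : vfield :=
  let B := ext01_10 (fun z => mxconj (alpha z) *m ahat z) in
  let Q := ext01_01 (fun z => aabar z *m ahat z) in
  let p k z := gpair (nabla_up k (ext10_01 alpha)) B z in
  twoRe (fun z =>
    col_mx (\col_(a < n) p (lshift n a) z) (\col_(b < n) - p (rshift n b) z)
    - 2 *: nabla_star Q z).

End kahler.

(* omega = i d dbar f with f = |z|^2 + 4 h(x) *)
Definition kpot (h : 'rV[R]_n -> R) (z : Cspace) : R :=
  \sum_(a < n) (z.1 0 a ^+ 2 + z.2 0 a ^+ 2) + 4 * h z.1.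

Definition kmetric (h : 'rV[R]_n -> R) (z : Cspace) : 'M[R[i]]_n :=
  \matrix_(a, b) dz a (dzbar b (fun z => (kpot h z)%:C)) z.

Definition vpot (h : 'rV[R]_n -> R) (x : 'rV[R]_n) : R :=
  2^-1 * \sum_(a < n) x 0 a ^+ 2 + h x.

(* The Kaehler forms omega = i d dbar (|z|^2 + 4 h(x)) on the torus. *)
Definition invariant_kahler (h : 'rV[R]_n -> R) : Prop :=
  [/\ smooth h, Zperiodic h & forall z, posdefmx (kmetric h z)].

(* y = dv/dx, x = du/dy, u(y) + v(x) = x . y *)
Definition symplectic_potential (v u : 'rV[R]_n -> R) : Prop :=
  smooth u /\
  forall x, let y := grad v x in
    grad u y = x /\ u y + v x = \sum_(a < n) x 0 a * y 0 a.

(* alpha = q_{ac} v^{cb} d/dzbar^b (x) dz^a; the row index is b. *)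
Definition deformation (v : 'rV[R]_n -> R) (q : 'rV[R]_n -> 'M[R[i]]_n)
    (z : Cspace) : 'M[R[i]]_n :=
  \matrix_(b, a) (q z.1 *m complexmx (invmx (Hess v z.1))) a b.

(* A T-invariant alpha is compatible exactly when q is symmetric. *)
Definition invariant_compatible (q : 'rV[R]_n -> 'M[R[i]]_n) : Prop :=
  [/\ forall a b, Csmooth (fun x => q x a b), Zperiodic q
    & forall x, (q x)^T = q x].

End torus.
Arguments Cspace : clear implicits.

(* Main.v *)
(* With V = Hess v and G = V^-1, everything depends on x only, so dz^a and dzbar^a
   act as half of d/dx^a, and by Legendre duality G^{ab} d/dx^b becomes d/dy^a at
   y = grad v (x).  The symmetry of V_{ab,c} gives D_a V_{ab} = d_b (log det V), so that
   2 S = (-1/2 G^{ab})_{,ab}, while div (d^* alpha) = -1/4 (xi^{ab})_{,ab}.  For the field X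
   the gradient terms enter the two components as rho and -rho and their divergences
   cancel, which leaves div X = (N^{ab})_{,ab} with N = acheck xi G xibar.  The average of S
   vanishes since S omega^n is the divergence of a periodic field.  Finally grad v is
   surjective, because h is bounded.

   These computations require N to be smooth, which the functional calculus does not show
   by itself.  But K = V - 2 N is the positive solution of K G K = V - q G qbar, and
   increments of K satisfy Sylvester equations K' G D + D G K = E; a uniform bound for
   these makes K continuous, and inverting them makes K smooth. *)

Require Import Defs.
From HB Require Import structures.
From mathcomp Require Import all_boot all_order all_algebra all_fingroup.
From mathcomp Require Import complex.
From mathcomp Require Import all_classical all_reals all_analysis.
From mathcomp Require Import ring lra.

Set Implicit Arguments.
Unset Strict Implicit.
Unset Printing Implicit Defensive.

Import Order.TTheory GRing.Theory Num.Theory.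
Import numFieldNormedType.Exports.

Local Open Scope ring_scope.
Local Open Scope classical_set_scope.
Local Open Scope complex_scope.

(** * Smooth real, complex and matrix-valued functions *)

Section Smooth.
Context {R : realType} {n : nat}.
Implicit Types (f g : 'rV[R]_n -> R) (a b : 'I_n) (k : nat).

Fixpoint smoothn k f : Prop :=
  match k with
  | 0%N => continuous f
  | k'.+1 => (forall x, differentiable f x) /\ forall a, smoothn k' (pd a f)
  end.

Lemma smoothn_continuous k f : smoothn k f -> continuous f.
Proof. by case: k => [//|k] [df _] x; exact: differentiable_continuous. Qed.

Lemma smoothnW k f : smoothn k.+1 f -> smoothn k f.
Proof.
elim: k f => [|k IH] f; first exact: smoothn_continuous.
by move=> [df sf]; split=> // a; apply: IH.
Qed.

Lemma smoothP f : smooth f <-> forall k, smoothn k f.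
Proof.
have smooth_pd a g : smooth g -> smooth (pd a g).
  by move=> sg s x; have := sg (rcons s a) x; rewrite foldr_rcons.
split=> [sf k|sf s].
  elim: k f sf => [|k IH] f sf /=.
    by move=> x; apply: differentiable_continuous; apply: (sf [::]).
  by split=> [x|a]; [exact: (sf [::])|apply: IH; exact: smooth_pd].
elim/last_ind: s f sf => [|s a IH] f sf x; first by have [] := sf 1%N.
rewrite foldr_rcons; apply: IH => k.
by have [_] := sf k.+1; apply.
Qed.

Lemma pd_diff a f x : differentiable f x -> pd a f x = 'd f x (delta_mx 0 a).
Proof. by move=> df; rewrite /pd deriveE. Qed.

Lemma pd_cst a (c : R) : pd a (fun=> c) = fun=> 0.
Proof. by apply/funext => x; rewrite /pd derive_cst. Qed.

Lemma pdD a f g x : differentiable f x -> differentiable g x ->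
  pd a (fun x => f x + g x) x = pd a f x + pd a g x.
Proof. by move=> df dg; apply: deriveD; exact: diff_derivable. Qed.

Lemma pdN a f x : differentiable f x -> pd a (fun x => - f x) x = - pd a f x.
Proof. by move=> df; apply: deriveN; exact: diff_derivable. Qed.

Lemma pdM a f g x : differentiable f x -> differentiable g x ->
  pd a (fun x => f x * g x) x = pd a f x * g x + f x * pd a g x.
Proof.
move=> df dg; rewrite /pd [LHS](deriveM (f := f) (g := g)); first last.
- exact: diff_derivable.
- exact: diff_derivable.
by rewrite addrC; congr (_ + _); rewrite /GRing.scale /= mulrC.
Qed.

Lemma pdV a f x : differentiable f x -> f x != 0 ->
  pd a (fun x => (f x)^-1) x = - (f x ^- 2) * pd a f x.
Proof. by move=> df f0; apply: deriveV => //; exact: diff_derivable. Qed.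

Lemma smoothn_cst k (c : R) : smoothn k (fun=> c).
Proof.
elim: k c => [|k IH] c /=; first by move=> x; exact: cst_continuous.
by split=> [x|a]; [exact: differentiable_cst|rewrite pd_cst].
Qed.

Lemma smoothnD k f g : smoothn k f -> smoothn k g -> smoothn k (fun x => f x + g x).
Proof.
elim: k f g => [|k IH] f g.
  by move=> cf cg x; apply: continuousD; [exact: cf|exact: cg].
move=> [df sf] [dg sg]; split=> [x|a].
  exact: differentiableD.
rewrite (_ : pd a _ = fun x => pd a f x + pd a g x); first by apply: IH; [exact: sf|exact: sg].
by apply/funext => x; exact: pdD.
Qed.

Lemma smoothnN k f : smoothn k f -> smoothn k (fun x => - f x).
Proof.
elim: k f => [|k IH] f.
  by move=> cf x; apply: continuousN; exact: cf.
move=> [df sf]; split=> [x|a]; first exact: differentiableN.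
rewrite (_ : pd a _ = fun x => - pd a f x); first by apply: IH; exact: sf.
by apply/funext => x; exact: pdN.
Qed.

Lemma smoothnM k f g : smoothn k f -> smoothn k g -> smoothn k (fun x => f x * g x).
Proof.
elim: k f g => [|k IH] f g.
  by move=> cf cg x; apply: continuousM; [exact: cf|exact: cg].
move=> sf sg; have [[df sdf] [dg sdg]] := (sf, sg); split=> [x|a].
  exact: differentiableM.
rewrite (_ : pd a _ = fun x => pd a f x * g x + f x * pd a g x).
  by apply: smoothnD; apply: IH; [exact: sdf|exact: smoothnW|exact: smoothnW|exact: sdg].
by apply/funext => x; exact: pdM.
Qed.

Lemma smoothnV k f : (forall x, f x != 0) -> smoothn k f ->
  smoothn k (fun x => (f x)^-1).
Proof.
move=> f0; elim: k => [|k IH].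
  by move=> cf x; apply: continuousV; [exact: f0|exact: cf].
move=> sf; have [df sdf] := sf; split=> [x|a].
  exact: differentiableV.
rewrite (_ : pd a _ = fun x => - ((f x)^-1 * (f x)^-1) * pd a f x).
  by apply: smoothnM (sdf a); apply: smoothnN; apply: smoothnM; apply: IH; exact: smoothnW.
by apply/funext => x; rewrite pdV// -exprVn expr2.
Qed.

Lemma smoothn_pd k a f : smoothn k.+1 f -> smoothn k (pd a f).
Proof. by case=> _; apply. Qed.

Lemma differentiable_ln f x : differentiable f x -> 0 < f x ->
  differentiable (fun x => ln (f x)) x.
Proof.
move=> df f0; apply: (differentiable_comp df).
by apply/derivable1_diffP; have [] := is_derive1_ln f0.
Qed.

Lemma pd_ln a f x : differentiable f x -> 0 < f x ->
  pd a (fun x => ln (f x)) x = (f x)^-1 * pd a f x.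
Proof.
move=> df f0.
have dl : differentiable (@ln R) (f x).
  by apply/derivable1_diffP; have [] := is_derive1_ln f0.
rewrite (pd_diff _ (differentiable_ln df f0)) (diff_comp df dl) /= -pd_diff//.
rewrite diff1E//= derive1E (@derive_val _ _ _ _ _ _ _ (is_derive1_ln f0)).
by rewrite /GRing.scale /= mulrC.
Qed.

Lemma smoothn_ln k f : (forall x, 0 < f x) -> smoothn k f ->
  smoothn k (fun x => ln (f x)).
Proof.
move=> f0; case: k => [|k] sf.
  by move=> x; apply: continuous_comp (sf x) _; exact: continuous_ln.
have [df sdf] := sf.
split=> [x|a]; first exact: differentiable_ln.
rewrite (_ : pd a _ = fun x => (f x)^-1 * pd a f x).
  apply: smoothnM (sdf a); apply: smoothnV; last exact: smoothnW.
  by move=> x; rewrite gt_eqF.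
by apply/funext => x; exact: pd_ln.
Qed.

End Smooth.

Section Clairaut.
Context {R : realType} {n : nat}.
Implicit Types (f g : 'rV[R]_n -> R) (a b : 'I_n) (k : nat).

Lemma derive_translate (V : normedModType R) (g : V -> R) (v w y : V) :
  'D_v (fun z => g (z + w)) y = 'D_v g (y + w).
Proof.
rewrite /derive.
suff -> : (fun h : R => h^-1 *: (((fun z => g (z + w)) \o shift y) (h *: v) - g (y + w)))
        = (fun h : R => h^-1 *: ((g \o shift (y + w)) (h *: v) - g (y + w))) by [].
by apply/funext => h /=; rewrite addrA.
Qed.

Lemma is_derive_line (V : normedModType R) (g : V -> R) (y v : V) (s : R) :
  derivable g (y + s *: v) v ->
  is_derive s 1 (fun t : R => g (y + t *: v)) ('D_v g (y + s *: v)).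
Proof.
move=> dg.
have E : (fun h : R => h^-1 *: (((fun t : R => g (y + t *: v)) \o shift s) (h *: 1)
            - g (y + s *: v))) =
         (fun h : R => h^-1 *: ((g \o shift (y + s *: v)) (h *: v) - g (y + s *: v))).
  apply/funext => h /=; congr (_ *: (g _ - _)).
  by rewrite scalerDl addrCA /GRing.scale /= mulr1.
by split; rewrite /derivable /derive E.
Qed.

Lemma MVT_line (V : normedModType R) (g : V -> R) (y v : V) (t : R) :
  (forall z, derivable g z v) -> 0 < t ->
  exists2 s, 0 < s < t & g (y + t *: v) - g y = t * 'D_v g (y + s *: v).
Proof.
move=> dg t0.
have [||s] := @MVT R (fun s => g (y + s *: v)) (fun s => 'D_v g (y + s *: v)) 0 t t0.
- by move=> s _; exact: is_derive_line.
- apply: continuous_subspaceT => s; apply: differentiable_continuous.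
  by apply/derivable1_diffP; have [] := is_derive_line (dg (y + s *: v)).
by rewrite in_itv /= => st; rewrite scale0r addr0 subr0 mulrC; exists s.
Qed.

Lemma mixed_difference f a b x (t : R) : smoothn 2 f -> 0 < t ->
  exists s1 s2, [/\ 0 < s1 < t, 0 < s2 < t &
    f (x + t *: delta_mx 0 a + t *: delta_mx 0 b) - f (x + t *: delta_mx 0 a)
      - f (x + t *: delta_mx 0 b) + f x
    = t * t * pd b (pd a f) (x + s1 *: delta_mx 0 a + s2 *: delta_mx 0 b)].
Proof.
move=> [df sf] t0.
pose w := t *: delta_mx 0 b : 'rV[R]_n.
pose g (y : 'rV[R]_n) := f (y + w) - f y.
have dw (y : 'rV[R]_n) : differentiable (fun z => f (z + w)) y.
  apply: (@differentiable_comp _ _ _ _ (fun z => z + w)) => //.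
have dg y : differentiable g y := differentiableB (dw y) (df y).
have [s1 s1t E1] := MVT_line (v := delta_mx 0 a) x (fun z => diff_derivable (dg z)) t0.
have [s2 s2t E2] := MVT_line (v := delta_mx 0 b) (x + s1 *: delta_mx 0 a)
  (fun z => diff_derivable ((sf a).1 z)) t0.
exists s1, s2; split=> //.
rewrite -[RHS]mulrA -[X in _ * X]E2 -/w.
have <- : 'D_(delta_mx 0 a) g (x + s1 *: delta_mx 0 a)
   = pd a f (x + s1 *: delta_mx 0 a + w) - pd a f (x + s1 *: delta_mx 0 a).
  rewrite [LHS]deriveB; [|exact: diff_derivable|exact: diff_derivable].
  exact: (congr1 (fun u => u - _) (derive_translate f _ w _)).
rewrite -E1 /g; ring.
Qed.

Lemma pdC f a b x : smoothn 2 f -> pd a (pd b f) x = pd b (pd a f) x.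
Proof.
move=> sf.
have cont c d : {for x, continuous (pd c (pd d f))}.
  by have [_ /(_ d) [_ /(_ c)]] := sf; apply.
apply/eqP; rewrite -subr_eq0 -normr_eq0; apply/negPn/negP => ne0.
pose e := `|pd a (pd b f) x - pd b (pd a f) x|.
have e0 : 0 < e / 2 by rewrite divr_gt0// lt_neqAle eq_sym [e == 0](negPf ne0) normr_ge0.
have near_pd c d : exists2 r : R, 0 < r & forall y, `|x - y| < r ->
    `|pd c (pd d f) x - pd c (pd d f) y| < e / 2.
  have /cvgrPdist_lt/(_ _ e0) := cont c d.
  by move=> /nbhs_normP[r /= r0 H]; exists r => // y; exact: H.
have [r1 r10 H1] := near_pd a b; have [r2 r20 H2] := near_pd b a.
pose r := Num.min r1 r2.
have r0 : 0 < r by rewrite lt_min r10.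
pose M := `|delta_mx 0 a : 'rV[R]_n| + `|delta_mx 0 b : 'rV[R]_n| + 1.
have M0 : 0 < M by rewrite ltr_wpDl.
pose t := r / M.
have t0 : 0 < t by rewrite divr_gt0.
have close (u w : 'rV[R]_n) s1 s2 : 0 < s1 < t -> 0 < s2 < t ->
    `|u| + `|w| + 1 = M -> `|x - (x + s1 *: u + s2 *: w)| < r.
  move=> /andP[s10 s1t] /andP[s20 s2t] uw.
  rewrite -addrA opprD addrA subrr sub0r normrN.
  rewrite (le_lt_trans (ler_normD _ _))// !normrZ !gtr0_norm//.
  rewrite (@le_lt_trans _ _ (t * (`|u| + `|w|)))//.
    by rewrite mulrDr lerD// ler_wpM2r// ltW.
  by rewrite /t -mulrA -[ltRHS]mulr1 ltr_pM2l// mulrC ltr_pdivrMr// mul1r -uw ltrDl.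
have [s1 [s2 [s1t s2t E1]]] := mixed_difference b a x sf t0.
have [s3 [s4 [s3t s4t E2]]] := mixed_difference a b x sf t0.
have : t * t * pd a (pd b f) (x + s1 *: delta_mx 0 b + s2 *: delta_mx 0 a)
     = t * t * pd b (pd a f) (x + s3 *: delta_mx 0 a + s4 *: delta_mx 0 b).
  apply: etrans (esym E1) _; apply: etrans E2.
  by rewrite (addrAC x (t *: delta_mx 0 b)) (addrAC (f _)).
move=> /(mulfI (mulf_neq0 (lt0r_neq0 t0) (lt0r_neq0 t0))) E.
have rr1 : r <= r1 by rewrite ge_min lexx.
have rr2 : r <= r2 by rewrite ge_min lexx orbT.
have eM : `|delta_mx 0 b : 'rV[R]_n| + `|delta_mx 0 a : 'rV[R]_n| + 1 = M.
  by rewrite /M (addrC `|delta_mx 0 b : 'rV[R]_n|).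
have h1 := H1 _ (lt_le_trans (close _ _ _ _ s1t s2t eM) rr1).
have h2 := H2 _ (lt_le_trans (close _ _ _ _ s3t s4t erefl) rr2).
move: h1 h2; rewrite E; move: (pd b (pd a f) _) => u h1 h2.
have := ltrD h1 h2; rewrite -splitr ltNge [X in _ + X]distrC.
by rewrite (ler_distD u).
Qed.

End Clairaut.

Section ComplexSmooth.
Context {R : realType} {n : nat}.
Implicit Types (f g : 'rV[R]_n -> R) (F G : 'rV[R]_n -> R[i]).
Implicit Types (a b : 'I_n) (k : nat).

Definition csmoothn k F : Prop :=
  smoothn k (fun x => complex.Re (F x)) /\ smoothn k (fun x => complex.Im (F x)).

Lemma CsmoothP F : Csmooth F <-> forall k, csmoothn k F.
Proof.
split=> [[/smoothP rF /smoothP iF] k|sF]; first by split.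
by split; apply/smoothP => k; have [] := sF k.
Qed.

Lemma csmoothnW k F : csmoothn k.+1 F -> csmoothn k F.
Proof. by case=> /smoothnW ? /smoothnW. Qed.

Lemma csmoothn_Cpd k a F : csmoothn k.+1 F -> csmoothn k (Cpd a F).
Proof. by case=> rF iF; split; apply: smoothn_pd. Qed.

Definition cdifferentiable F : Prop :=
  (forall x, differentiable (fun x => complex.Re (F x)) x) /\
  (forall x, differentiable (fun x => complex.Im (F x)) x).

Lemma csmoothnS k F : cdifferentiable F ->
  (forall a, csmoothn k (Cpd a F)) -> csmoothn k.+1 F.
Proof. by move=> [rF iF] sF; split; split=> // a; have [] := sF a. Qed.

Lemma csmoothn_diff k F : csmoothn k.+1 F -> cdifferentiable F.
Proof. by case=> [[rF _] [iF _]]. Qed.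

Lemma csmoothn_cst k (c : R[i]) : csmoothn k (fun=> c).
Proof. by split; exact: smoothn_cst. Qed.

Lemma csmoothn_real k f : smoothn k f -> csmoothn k (fun x => (f x)%:C).
Proof. by move=> sf; split=> //=; exact: smoothn_cst. Qed.

Lemma eq_derive (V : normedModType R) (f g : V -> R) (v x : V) :
  f =1 g -> 'D_v f x = 'D_v g x.
Proof. by move=> /funext ->. Qed.

Lemma cReD (x y : R[i]) : complex.Re (x + y) = complex.Re x + complex.Re y.
Proof. by case: x y => [? ?] []. Qed.
Lemma cImD (x y : R[i]) : complex.Im (x + y) = complex.Im x + complex.Im y.
Proof. by case: x y => [? ?] []. Qed.
Lemma cReN (x : R[i]) : complex.Re (- x) = - complex.Re x.
Proof. by case: x. Qed.
Lemma cImN (x : R[i]) : complex.Im (- x) = - complex.Im x.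
Proof. by case: x. Qed.
Lemma cReM (x y : R[i]) :
  complex.Re (x * y) = complex.Re x * complex.Re y - complex.Im x * complex.Im y.
Proof. by case: x y => [? ?] []. Qed.
Lemma cImM (x y : R[i]) :
  complex.Im (x * y) = complex.Re x * complex.Im y + complex.Im x * complex.Re y.
Proof. by case: x y => [? ?] []. Qed.
Lemma cRe_conj (x : R[i]) : complex.Re (conjc x) = complex.Re x.
Proof. by case: x. Qed.
Lemma cIm_conj (x : R[i]) : complex.Im (conjc x) = - complex.Im x.
Proof. by case: x. Qed.

Let RI := (cReD, cImD, cReN, cImN, cReM, cImM, cRe_conj, cIm_conj).

Lemma csmoothnD k F G : csmoothn k F -> csmoothn k G -> csmoothn k (fun x => F x + G x).
Proof.
move=> [rF iF] [rG iG]; split; under eq_fun do rewrite RI; exact: smoothnD.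
Qed.

Lemma csmoothnN k F : csmoothn k F -> csmoothn k (fun x => - F x).
Proof. by move=> [rF iF]; split; under eq_fun do rewrite RI; exact: smoothnN. Qed.

Lemma csmoothnM k F G : csmoothn k F -> csmoothn k G -> csmoothn k (fun x => F x * G x).
Proof.
move=> [rF iF] [rG iG]; split; under eq_fun do rewrite RI.
  by apply: smoothnD; [|apply: smoothnN]; exact: smoothnM.
by apply: smoothnD; exact: smoothnM.
Qed.

Lemma csmoothn_conj k F : csmoothn k F -> csmoothn k (fun x => conjc (F x)).
Proof.
by move=> [rF iF]; split; under eq_fun do rewrite RI; [|exact: smoothnN].
Qed.

Lemma csmoothn_sum k (I : Type) (r : seq I) (P : pred I) (F : I -> 'rV[R]_n -> R[i]) :
  (forall i, csmoothn k (F i)) -> csmoothn k (fun x => \sum_(i <- r | P i) F i x).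
Proof.
move=> sF; elim: r => [|i r IH].
  by under eq_fun do rewrite big_nil; exact: csmoothn_cst.
under eq_fun do rewrite big_cons; case: (P i) => //; exact: csmoothnD.
Qed.

Lemma csmoothn_prod k (I : Type) (r : seq I) (P : pred I) (F : I -> 'rV[R]_n -> R[i]) :
  (forall i, csmoothn k (F i)) -> csmoothn k (fun x => \prod_(i <- r | P i) F i x).
Proof.
move=> sF; elim: r => [|i r IH].
  by under eq_fun do rewrite big_nil; exact: csmoothn_cst.
under eq_fun do rewrite big_cons; case: (P i) => //; exact: csmoothnM.
Qed.

Lemma csmoothnV k F : (forall x, F x != 0) -> csmoothn k F ->
  csmoothn k (fun x => (F x)^-1).
Proof.
move=> F0 [rF iF].
pose N x := complex.Re (F x) * complex.Re (F x) + complex.Im (F x) * complex.Im (F x).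
have sN : smoothn k (fun x => (N x)^-1).
  apply: smoothnV => [x|]; last by apply: smoothnD; exact: smoothnM.
  have := F0 x; rewrite /N; case: (F x) => p q /=.
  rewrite eq_complex /= -!expr2 paddr_eq0 ?sqr_ge0// !sqrf_eq0.
  by [].
split.
  rewrite (_ : (fun x => _) = fun x => complex.Re (F x) * (N x)^-1); first exact: smoothnM.
  by apply/funext => x; rewrite /N; case: (F x) => p q /=; rewrite -!expr2.
rewrite (_ : (fun x => _) = fun x => - (complex.Im (F x) * (N x)^-1)).
  by apply: smoothnN; exact: smoothnM.
by apply/funext => x; rewrite /N; case: (F x) => p q /=; rewrite -!expr2.
Qed.

Lemma eq_Cpd a F G x : F =1 G -> Cpd a F x = Cpd a G x.
Proof. by move=> /funext ->. Qed.

Lemma Cpd_cst a (c : R[i]) : Cpd a (fun=> c) = fun=> 0.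
Proof.
by apply/funext => x; rewrite /Cpd /Cderive !derive_cst.
Qed.

Lemma Cpd_real a f x : Cpd a (fun x => (f x)%:C) x = (pd a f x)%:C.
Proof. by rewrite /Cpd /Cderive /= derive_cst. Qed.

Lemma Cpd_conj a F x : cdifferentiable F ->
  Cpd a (fun x => conjc (F x)) x = conjc (Cpd a F x).
Proof.
move=> [rF iF]; apply/eqP; rewrite eq_complex /=; apply/andP; split; apply/eqP.
  by apply: eq_derive => y; rewrite RI.
by apply: etrans (pdN a (iF x)); apply: eq_derive => y; rewrite RI.
Qed.

Lemma CpdD a F G x : cdifferentiable F -> cdifferentiable G ->
  Cpd a (fun x => F x + G x) x = Cpd a F x + Cpd a G x.
Proof.
move=> [rF iF] [rG iG].
apply/eqP; rewrite eq_complex cReD cImD; apply/andP; split; apply/eqP.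
  by apply: etrans (pdD a (rF x) (rG x)); apply: eq_derive => y; rewrite RI.
by apply: etrans (pdD a (iF x) (iG x)); apply: eq_derive => y; rewrite RI.
Qed.

Lemma cdifferentiableM F G : cdifferentiable F -> cdifferentiable G ->
  cdifferentiable (fun x => F x * G x).
Proof.
move=> [rF iF] [rG iG].
have dM (f g : 'rV[R]_n -> R) x : (forall x, differentiable f x) ->
  (forall x, differentiable g x) -> differentiable (fun x => f x * g x) x.
  by move=> df dg; exact: differentiableM.
split=> x; under eq_fun do rewrite RI.
  by apply: differentiableB; apply: dM.
by apply: differentiableD; apply: dM.
Qed.

Lemma cdifferentiable_sum (I : Type) (r : seq I) (P : pred I) (F : I -> 'rV[R]_n -> R[i]) :
  (forall i, cdifferentiable (F i)) -> cdifferentiable (fun x => \sum_(i <- r | P i) F i x).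
Proof.
move=> dF; elim: r => [|i r IH].
  under eq_fun do rewrite big_nil; exact: (csmoothn_diff (csmoothn_cst 1 0)).
under eq_fun do rewrite big_cons; case: (P i) => //.
have [[rF iF] [rG iG]] := (dF i, IH).
by split=> x; under eq_fun do rewrite RI; apply: differentiableD.
Qed.

Lemma CpdM a F G x : cdifferentiable F -> cdifferentiable G ->
  Cpd a (fun x => F x * G x) x = Cpd a F x * G x + F x * Cpd a G x.
Proof.
move=> [rF iF] [rG iG].
have dM (f g : 'rV[R]_n -> R) : (forall x, differentiable f x) ->
  (forall x, differentiable g x) -> differentiable (fun x => f x * g x) x.
  by move=> df dg; exact: differentiableM.
apply/eqP; rewrite eq_complex cReD cImD !cReM !cImM; apply/andP; split; apply/eqP.
  transitivity (pd a (fun x => complex.Re (F x) * complex.Re (G x)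
                             + - (complex.Im (F x) * complex.Im (G x))) x).
    by apply: eq_derive => y; rewrite RI.
  rewrite pdD ?pdN ?pdM//; [|exact: dM|exact: dM|exact: differentiableN (dM _ _ _ _)].
  by rewrite /Cpd /Cderive /= /pd; ring.
transitivity (pd a (fun x => complex.Re (F x) * complex.Im (G x)
                             + complex.Im (F x) * complex.Re (G x)) x).
  by apply: eq_derive => y; rewrite RI.
rewrite pdD ?pdM//; [|exact: dM|exact: dM].
by rewrite /Cpd /Cderive /= /pd; ring.
Qed.

Lemma Cpd_sum a (I : Type) (r : seq I) (P : pred I) (F : I -> 'rV[R]_n -> R[i]) x :
  (forall i, cdifferentiable (F i)) ->
  Cpd a (fun x => \sum_(i <- r | P i) F i x) x = \sum_(i <- r | P i) Cpd a (F i) x.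
Proof.
move=> sF; elim: r => [|i r IH].
  by under eq_fun do rewrite big_nil; rewrite Cpd_cst big_nil.
under eq_fun do rewrite big_cons; rewrite big_cons; case: (P i) => //.
by rewrite CpdD ?IH//; exact: cdifferentiable_sum.
Qed.

Lemma CpdC a b F x : csmoothn 2 F -> Cpd a (Cpd b F) x = Cpd b (Cpd a F) x.
Proof.
move=> [rF iF]; apply/eqP; rewrite eq_complex; apply/andP; split; apply/eqP.
  exact: pdC rF.
exact: pdC iF.
Qed.

End ComplexSmooth.
Opaque pd Cpd.

Section MatrixSmooth.
Context {R : realType} {n : nat}.
Implicit Types (a b : 'I_n) (k : nat).

Definition mxsmoothn {m p} k (Z : 'rV[R]_n -> 'M[R[i]]_(m, p)) : Prop :=
  forall i j, csmoothn k (fun x => Z x i j).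

Definition mxpd {m p} a (Z : 'rV[R]_n -> 'M[R[i]]_(m, p)) (x : 'rV[R]_n) :
  'M[R[i]]_(m, p) := \matrix_(i, j) Cpd a (fun x => Z x i j) x.

Lemma mxpdE {m p} a (Z : 'rV[R]_n -> 'M[R[i]]_(m, p)) x i j :
  mxpd a Z x i j = Cpd a (fun x => Z x i j) x.
Proof. by rewrite mxE. Qed.

Definition mxdiff {m p} (Z : 'rV[R]_n -> 'M[R[i]]_(m, p)) : Prop :=
  forall i j, cdifferentiable (fun x => Z x i j).

Lemma mxsmoothn_diff {m p} k (Z : 'rV[R]_n -> 'M[R[i]]_(m, p)) :
  mxsmoothn k.+1 Z -> mxdiff Z.
Proof. by move=> sZ i j; exact: csmoothn_diff (sZ i j). Qed.

Lemma mxdiffM {m p q} (Z : 'rV[R]_n -> 'M[R[i]]_(m, p))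
    (W : 'rV[R]_n -> 'M[R[i]]_(p, q)) :
  mxdiff Z -> mxdiff W -> mxdiff (fun x => Z x *m W x).
Proof.
move=> dZ dW i j; under eq_fun do rewrite mxE.
by apply: cdifferentiable_sum => l; exact: cdifferentiableM.
Qed.

Lemma mxsmoothnS {m p} k (Z : 'rV[R]_n -> 'M[R[i]]_(m, p)) : mxdiff Z ->
  (forall a, mxsmoothn k (mxpd a Z)) -> mxsmoothn k.+1 Z.
Proof.
move=> dZ sZ i j; apply: csmoothnS => // a.
by have := sZ a i j; under eq_fun do rewrite mxpdE.
Qed.

Lemma mxsmoothnW {m p} k (Z : 'rV[R]_n -> 'M[R[i]]_(m, p)) :
  mxsmoothn k.+1 Z -> mxsmoothn k Z.
Proof. by move=> sZ i j; exact: csmoothnW. Qed.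

Lemma mxsmoothn_pd {m p} k a (Z : 'rV[R]_n -> 'M[R[i]]_(m, p)) :
  mxsmoothn k.+1 Z -> mxsmoothn k (mxpd a Z).
Proof. by move=> sZ i j; under eq_fun do rewrite mxE; exact: csmoothn_Cpd. Qed.

Lemma mxsmoothn_cst {m p} k (C : 'M[R[i]]_(m, p)) : mxsmoothn k (fun=> C).
Proof. by move=> i j; exact: csmoothn_cst. Qed.

Lemma mxsmoothnD {m p} k (Z W : 'rV[R]_n -> 'M[R[i]]_(m, p)) :
  mxsmoothn k Z -> mxsmoothn k W -> mxsmoothn k (fun x => Z x + W x).
Proof. by move=> sZ sW i j; under eq_fun do rewrite mxE; exact: csmoothnD. Qed.

Lemma mxsmoothnN {m p} k (Z : 'rV[R]_n -> 'M[R[i]]_(m, p)) :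
  mxsmoothn k Z -> mxsmoothn k (fun x => - Z x).
Proof. by move=> sZ i j; under eq_fun do rewrite mxE; exact: csmoothnN. Qed.

Lemma mxsmoothnZ {m p} k F (Z : 'rV[R]_n -> 'M[R[i]]_(m, p)) :
  csmoothn k F -> mxsmoothn k Z -> mxsmoothn k (fun x => F x *: Z x).
Proof. by move=> sF sZ i j; under eq_fun do rewrite mxE; exact: csmoothnM. Qed.

Lemma mxsmoothnM {m p q} k (Z : 'rV[R]_n -> 'M[R[i]]_(m, p))
    (W : 'rV[R]_n -> 'M[R[i]]_(p, q)) :
  mxsmoothn k Z -> mxsmoothn k W -> mxsmoothn k (fun x => Z x *m W x).
Proof.
move=> sZ sW i j; under eq_fun do rewrite mxE.
by apply: csmoothn_sum => l; exact: csmoothnM.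
Qed.

Lemma mxsmoothn_tr {m p} k (Z : 'rV[R]_n -> 'M[R[i]]_(m, p)) :
  mxsmoothn k Z -> mxsmoothn k (fun x => (Z x)^T).
Proof. by move=> sZ i j; under eq_fun do rewrite mxE. Qed.

Lemma mxsmoothn_conj {m p} k (Z : 'rV[R]_n -> 'M[R[i]]_(m, p)) :
  mxsmoothn k Z -> mxsmoothn k (fun x => mxconj (Z x)).
Proof. by move=> sZ i j; under eq_fun do rewrite mxE; exact: csmoothn_conj. Qed.

Lemma csmoothn_det {m} k (Z : 'rV[R]_n -> 'M[R[i]]_m) :
  mxsmoothn k Z -> csmoothn k (fun x => \det (Z x)).
Proof.
move=> sZ; apply: csmoothn_sum => s; apply: csmoothnM; first exact: csmoothn_cst.
by apply: csmoothn_prod => i; exact: sZ.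
Qed.

Lemma mxsmoothn_adj {m} k (Z : 'rV[R]_n -> 'M[R[i]]_m) :
  mxsmoothn k Z -> mxsmoothn k (fun x => \adj (Z x)).
Proof.
move=> sZ i j; under eq_fun do rewrite mxE /cofactor.
apply: csmoothnM; first exact: csmoothn_cst.
by apply: csmoothn_det => p q; under eq_fun do rewrite !mxE.
Qed.

Lemma mxsmoothn_inv {m} k (Z : 'rV[R]_n -> 'M[R[i]]_m) :
  (forall x, Z x \in unitmx) -> mxsmoothn k Z -> mxsmoothn k (fun x => invmx (Z x)).
Proof.
move=> uZ sZ.
rewrite (_ : (fun x => _) = fun x => (\det (Z x))^-1 *: \adj (Z x)); last first.
  by apply/funext => x; rewrite /invmx uZ.
apply: mxsmoothnZ; last exact: mxsmoothn_adj.
apply: csmoothnV; last exact: csmoothn_det.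
by move=> x; have := uZ x; rewrite unitmxE unitfE.
Qed.

Lemma csmoothn_trace {m} k (Z : 'rV[R]_n -> 'M[R[i]]_m) :
  mxsmoothn k Z -> csmoothn k (fun x => \tr (Z x)).
Proof. by move=> sZ; apply: csmoothn_sum => i; exact: sZ. Qed.

Lemma mxpd_cst {m p} a (C : 'M[R[i]]_(m, p)) x : mxpd a (fun=> C) x = 0.
Proof. by apply/matrixP => i j; rewrite !mxE Cpd_cst. Qed.

Lemma mxpdD {m p} a (Z W : 'rV[R]_n -> 'M[R[i]]_(m, p)) x :
  mxdiff Z -> mxdiff W ->
  mxpd a (fun x => Z x + W x) x = mxpd a Z x + mxpd a W x.
Proof.
move=> sZ sW; apply/matrixP => i j; rewrite !mxE; under eq_fun do rewrite mxE.
exact: CpdD.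
Qed.

Lemma mxpdM {m p q} a (Z : 'rV[R]_n -> 'M[R[i]]_(m, p))
    (W : 'rV[R]_n -> 'M[R[i]]_(p, q)) x :
  mxdiff Z -> mxdiff W ->
  mxpd a (fun x => Z x *m W x) x = mxpd a Z x *m W x + Z x *m mxpd a W x.
Proof.
move=> sZ sW; apply/matrixP => i j; rewrite !mxE; under eq_fun do rewrite mxE.
rewrite Cpd_sum; last by move=> l; exact: cdifferentiableM.
by rewrite -big_split; apply: eq_bigr => l _; rewrite CpdM// !mxE.
Qed.

End MatrixSmooth.
Transparent pd Cpd.

(** * Simultaneous diagonalization and functional calculus *)

Section InvMx.
Context {F : fieldType} {n : nat}.
Implicit Types A B : 'M[F]_n.

Lemma mulmx1_inv A B : A *m B = 1%:M -> invmx A = B.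
Proof. by move=> AB; have [uA _] := mulmx1_unit AB; rewrite -[RHS](mulKmx uA) AB mulmx1. Qed.

End InvMx.

Section ConjTranspose.
Context {R : realType}.

Definition ctr {m p} (A : 'M[R[i]]_(m, p)) : 'M[R[i]]_(p, m) := (mxconj A)^T.

Lemma mxconjM m p q (A : 'M[R[i]]_(m, p)) (B : 'M[R[i]]_(p, q)) :
  mxconj (A *m B) = mxconj A *m mxconj B.
Proof. exact: map_mxM. Qed.

Lemma mxconjK m p : involutive (@mxconj R m p).
Proof. by move=> A; apply/matrixP => i j; rewrite !mxE conjcK. Qed.

Lemma mxconj_complex m p (A : 'M[R]_(m, p)) : mxconj (complexmx A) = complexmx A.
Proof. by apply/matrixP => i j; rewrite !mxE conjc_real. Qed.

Lemma ctrM m p q (A : 'M[R[i]]_(m, p)) (B : 'M[R[i]]_(p, q)) :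
  ctr (A *m B) = ctr B *m ctr A.
Proof. by rewrite /ctr mxconjM trmx_mul. Qed.

Lemma ctrK m p (A : 'M[R[i]]_(m, p)) : ctr (ctr A) = A.
Proof. by apply/matrixP => i j; rewrite !mxE conjcK. Qed.

Lemma ctr1 n : ctr (1%:M : 'M[R[i]]_n) = 1%:M.
Proof. by rewrite /ctr /mxconj map_mx1 trmx1. Qed.

Lemma ctrD m p (A B : 'M[R[i]]_(m, p)) : ctr (A + B) = ctr A + ctr B.
Proof. by apply/matrixP => i j; rewrite !mxE rmorphD. Qed.

Lemma ctr_diag n (d : 'rV[R]_n) :
  ctr (diag_mx (complexmx d)) = diag_mx (complexmx d).
Proof.
apply/matrixP => i j; rewrite !mxE eq_sym; case: eqVneq => [->|_].
  by rewrite mulr1n conjc_real.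
by rewrite mulr0n conjc0.
Qed.

Lemma diag_mxM n (d e : 'rV[R]_n) :
  diag_mx (complexmx d) *m diag_mx (complexmx e) =
  diag_mx (complexmx (\row_i (d 0 i * e 0 i))).
Proof.
rewrite mulmx_diag; congr diag_mx; apply/rowP => i.
by rewrite !mxE rmorphM.
Qed.

Lemma hermitian_diag n (A : 'M[R[i]]_n) : ctr A = A ->
  exists (U : 'M[R[i]]_n) (d : 'rV[R]_n),
    [/\ ctr U *m U = 1%:M, U *m ctr U = 1%:M &
        A = ctr U *m diag_mx (complexmx d) *m U].
Proof.
move=> hA.
have hermA : A \is hermsymmx.
  apply/is_hermitianmxP; rewrite expr0 scale1r -{1}hA.
  by apply/matrixP => i j; rewrite !mxE.
have /orthomx_spectralP := hermitian_normalmx hermA.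
set U := spectralmx A => EA.
have UU : U *m ctr U = 1%:M.
  have /unitarymxP := spectral_unitarymx A; rewrite -/U => <-.
  by congr (_ *m _); apply/matrixP => i j; rewrite !mxE.
have uU := spectral_unit A; rewrite -/U in uU.
have iU : invmx U = ctr U by rewrite -[RHS](mulKmx uU) UU mulmx1.
exists U, (map_mx (@complex.Re R) (spectral_diag A)); split.
- by rewrite -iU; apply: mulVmx.
- exact: UU.
- have /mxOverP dR := hermitian_spectral_diag_real hermA.
  have Ed : spectral_diag A = complexmx (map_mx (@complex.Re R) (spectral_diag A)).
    by apply/matrixP => i j; rewrite !mxE RRe_real.
  rewrite iU [in X in diag_mx X]Ed in EA; exact: EA.
Qed.

Lemma mulmx_row_diag n m (U : 'M[R[i]]_(n, m)) (A : 'M[R[i]]_m) i :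
  (row i U *m A *m ctr (row i U)) 0 0 = (U *m A *m ctr U) i i.
Proof.
rewrite -row_mul !mxE; apply: eq_bigr => j _; by rewrite !mxE.
Qed.

Lemma gram_ge0 n m (B : 'M[R[i]]_(n, m)) i : 0 <= (B *m ctr B) i i.
Proof.
by rewrite mxE; apply: sumr_ge0 => j _; rewrite !mxE mulcJ_ge0.
Qed.

Lemma posdef_gram n (V : 'M[R[i]]_n) : ctr V = V -> posdefmx V ->
  exists P W : 'M[R[i]]_n, [/\ P *m W = 1%:M, W *m P = 1%:M & V = ctr P *m P].
Proof.
move=> hV pV; have [U [d [UU UUc EV]]] := hermitian_diag hV.
have d0 i : 0 < d 0 i.
  rewrite -ltcR.
  have Ui0 : row i U != 0.
    apply/eqP => U0; have : row i (U *m ctr U) = 0 by rewrite row_mul U0 mul0mx.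
    move=> /matrixP/(_ 0 i); rewrite UUc !mxE eqxx => /eqP.
    by rewrite oner_eq0.
  have := pV _ Ui0; rewrite -/(ctr _) mulmx_row_diag EV.
  rewrite -!mulmxA UUc mulmx1 mulmxA UUc mul1mx.
  by rewrite !mxE eqxx mulr1n.
pose e : 'rV[R]_n := \row_i Num.sqrt (d 0 i).
pose e' : 'rV[R]_n := \row_i (Num.sqrt (d 0 i))^-1.
have ee : diag_mx (complexmx e) *m diag_mx (complexmx e') = 1%:M.
  rewrite diag_mxM -diag_const_mx; congr diag_mx; apply/rowP => i.
  by rewrite !mxE mulfV// gt_eqF// sqrtr_gt0.
have e'e : diag_mx (complexmx e') *m diag_mx (complexmx e) = 1%:M.
  by rewrite diag_mxC.
exists (diag_mx (complexmx e) *m U), (ctr U *m diag_mx (complexmx e')); split.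
- by rewrite mulmxA -(mulmxA _ U) UUc mulmx1.
- by rewrite mulmxA -(mulmxA (ctr U)) e'e mulmx1.
- rewrite ctrM ctr_diag -!mulmxA (mulmxA (diag_mx _) (diag_mx _)) diag_mxM {1}EV.
  rewrite -mulmxA; do 2 congr mulmx; congr diag_mx.
  by apply/rowP => i; rewrite !mxE -expr2 sqr_sqrtr ?ltW.
Qed.

(* Diagonalize [B B^*], where [B = Q^-* q Q^-1] and [V = Q^* Q]. *)
Lemma simult_diag n (V G q : 'M[R[i]]_n) :
  ctr V = V -> posdefmx V -> V *m G = 1%:M -> q^T = q ->
  exists (P W : 'M[R[i]]_n) (d : 'rV[R]_n), [/\ P *m W = 1%:M, W *m P = 1%:M,
    V = ctr P *m P, G = W *m ctr W &
    G *m q *m G *m mxconj q = W *m diag_mx (complexmx d) *m P /\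
    forall i, 0 <= d 0 i].
Proof.
move=> hV pV VG sq; have [Q [W [QW WQ EV]]] := posdef_gram hV pV.
have EG : G = W *m ctr W.
  have VW : V *m (W *m ctr W) = 1%:M.
    by rewrite EV mulmxA -(mulmxA _ Q) QW mulmx1 -ctrM WQ ctr1.
  have GV : G *m V = 1%:M by apply: mulmx1C.
  by rewrite -[RHS]mul1mx -GV -mulmxA VW mulmx1.
pose B := ctr W *m q *m W.
have cq : ctr q = mxconj q.
  by rewrite -[in LHS]sq; apply/matrixP => i j; rewrite !mxE.
have cB : ctr B = ctr W *m mxconj q *m W by rewrite /B !ctrM ctrK cq mulmxA.
have EM : G *m q *m G *m mxconj q = W *m (B *m ctr B) *m Q.
  by rewrite cB EG /B !mulmxA -[in RHS]mulmxA WQ mulmx1.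
clearbody B; clear cB.
have [|U [d [UU UUc EB]]] := @hermitian_diag _ (B *m ctr B); first by rewrite ctrM ctrK.
exists (U *m Q), (W *m ctr U), d; split.
- by rewrite mulmxA -(mulmxA U) QW mulmx1.
- by rewrite mulmxA -(mulmxA W) UU mulmx1.
- by rewrite ctrM -mulmxA (mulmxA (ctr U)) UU mul1mx.
- by rewrite ctrM ctrK -mulmxA (mulmxA (ctr U)) UU mul1mx; exact: EG.
- split; first by rewrite EM EB !mulmxA.
  move=> i; have := gram_ge0 (U *m B) i.
  have -> : U *m B *m ctr (U *m B) = diag_mx (complexmx d).
    rewrite ctrM mulmxA -(mulmxA U) EB !mulmxA UUc mul1mx.
    by rewrite -mulmxA UUc mulmx1.
  by rewrite !mxE eqxx mulr1n ler0c.
Qed.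

Lemma diag_intertwine n (f : R -> R) (P W P' W' A A' B B' X : 'M[R[i]]_n) (d d' : 'rV[R]_n) :
  P *m W = 1%:M -> W *m P = 1%:M -> P' *m W' = 1%:M -> W' *m P' = 1%:M ->
  A = W *m diag_mx (complexmx d) *m P -> A' = W' *m diag_mx (complexmx d') *m P' ->
  B = W *m diag_mx (complexmx (map_mx f d)) *m P ->
  B' = W' *m diag_mx (complexmx (map_mx f d')) *m P' ->
  A *m X = X *m A' -> B *m X = X *m B'.
Proof.
move=> PW WP PW' WP' -> -> -> -> AX.
have [Y EY] : exists Y, Y = P *m X *m W' by exists (P *m X *m W').
have comm : diag_mx (complexmx d) *m Y = Y *m diag_mx (complexmx d').
  have := congr1 (fun Z => P *m Z *m W') AX.
  rewrite /= !mulmxA PW mul1mx => E.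
  by rewrite EY !mulmxA E -mulmxA PW' mulmx1.
have fcomm : diag_mx (complexmx (map_mx f d)) *m Y = Y *m diag_mx (complexmx (map_mx f d')).
  apply/matrixP => i j; have /matrixP/(_ i j) := comm.
  rewrite !mul_diag_mx !mul_mx_diag !mxE.
  have [->|Y0] := eqVneq (Y i j) 0; first by rewrite !mulr0 !mul0r.
  by rewrite mulrC => /(mulfI Y0)/complexI ->; rewrite mulrC.
have EX : X = W *m Y *m P' by rewrite EY !mulmxA WP mul1mx -mulmxA WP' mulmx1.
rewrite EX !mulmxA -(mulmxA _ P W) PW mulmx1 -(mulmxA _ P' W') PW' mulmx1.
by rewrite -(mulmxA W) fcomm !mulmxA.
Qed.

Lemma invmxE n (P W : 'M[R[i]]_n) : P *m W = 1%:M -> invmx P = W.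
Proof. by move=> PW; apply: mulmx1_inv. Qed.

Lemma is_funcalcP n (f : R -> R) (A B : 'M[R[i]]_n) : is_funcalc f A B ->
  exists (P W : 'M[R[i]]_n) (d : 'rV[R]_n), [/\ P *m W = 1%:M, W *m P = 1%:M,
    A = W *m diag_mx (complexmx d) *m P &
    B = W *m diag_mx (complexmx (map_mx f d)) *m P].
Proof.
move=> [P [d [uP EA EB]]]; exists P, (invmx P), d.
by split; [exact: mulmxV|exact: mulVmx|exact: EA|exact: EB].
Qed.

Lemma is_funcalcI n (f : R -> R) (P W : 'M[R[i]]_n) (d : 'rV[R]_n) : P *m W = 1%:M ->
  is_funcalc f (W *m diag_mx (complexmx d) *m P)
               (W *m diag_mx (complexmx (map_mx f d)) *m P).
Proof.
move=> PW; exists P, d; rewrite (invmxE PW); split=> //.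
by have [] := mulmx1_unit PW.
Qed.

Lemma funcalcE n (f : R -> R) (A B : 'M[R[i]]_n) : is_funcalc f A B -> funcalc f A = B.
Proof.
move=> AB; rewrite /funcalc; case: xgetP => [C -> /= AC|/(_ B)//].
have [P [W [d [PW WP EA EC]]]] := is_funcalcP AC.
have [Q [Y [e [QY YQ FA FB]]]] := is_funcalcP AB.
have := diag_intertwine (X := 1%:M) PW WP QY YQ EA FA EC FB.
by rewrite !mulmx1 !mul1mx; apply.
Qed.

Lemma funcalcI n (f : R -> R) (P W A : 'M[R[i]]_n) (d : 'rV[R]_n) : P *m W = 1%:M ->
  A = W *m diag_mx (complexmx d) *m P ->
  funcalc f A = W *m diag_mx (complexmx (map_mx f d)) *m P.
Proof. by move=> PW ->; apply: funcalcE; exact: is_funcalcI. Qed.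

Lemma eigenvalue_diag n (P W A : 'M[R[i]]_n) (d : 'rV[R]_n) i : P *m W = 1%:M ->
  A = W *m diag_mx (complexmx d) *m P -> eigenvalue A (d 0 i)%:C.
Proof.
move=> PW ->; apply/eigenvalueP; exists (row i P).
  rewrite -row_mul !mulmxA PW mul1mx row_mul row_diag_mx -scalemxAl -rowE.
  by rewrite !mxE.
apply/eqP => P0; have : row i (P *m W) = 0 by rewrite row_mul P0 mul0mx.
by move=> /matrixP/(_ 0 i); rewrite PW !mxE eqxx => /eqP; rewrite oner_eq0.
Qed.

Lemma psi_sqr (r : R) : 0 < r ->
  psi (1 - r ^+ 2) = 2^-1 * (1 + r)^-1.
Proof. by move=> r0; rewrite /psi subKr sqrtr_sqr gtr0_norm. Qed.

(* [K] is the geometric mean of [V] and [V - q G qbar]; every functional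
   calculus expression of the problem is rational in [V] and [K]. *)
Lemma psi_diag n (V G q : 'M[R[i]]_n) :
  ctr V = V -> posdefmx V -> V *m G = 1%:M -> q^T = q ->
  (forall lam, eigenvalue (G *m q *m G *m mxconj q) lam -> lam < 1) ->
  exists (P W : 'M[R[i]]_n) (r : 'rV[R]_n),
    [/\ P *m W = 1%:M, W *m P = 1%:M, V = ctr P *m P, G = W *m ctr W &
        forall i, 0 < r 0 i <= 1] /\
    let K := ctr P *m diag_mx (complexmx r) *m P in
    [/\ K *m G *m K = V - q *m G *m mxconj q,
        (V + K) *m funcalc psi (G *m q *m G *m mxconj q) = 2^-1 *: V,
        G *m q *m G *m mxconj q *m funcalc psi (G *m q *m G *m mxconj q)
          = G *m (2^-1 *: (V - K)) &
        funcalc psi (q *m G *m mxconj q *m G) *m (q *m G *m mxconj q)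
          = 2^-1 *: (V - K)].
Proof.
move=> hV pV VG sq ev.
have [P [W [d [PW WP EV EG [EM d0]]]]] := simult_diag hV pV VG sq.
have d1 i : d 0 i < 1 by rewrite -ltcR; apply: ev; exact: eigenvalue_diag EM.
pose r : 'rV[R]_n := \row_i Num.sqrt (1 - d 0 i).
have r0 i : 0 < r 0 i by rewrite mxE sqrtr_gt0 subr_gt0.
have r2 i : r 0 i ^+ 2 = 1 - d 0 i by rewrite mxE sqr_sqrtr// subr_ge0 ltW.
have dE i : d 0 i = 1 - r 0 i ^+ 2 by rewrite r2 subKr.
have psiE i : psi (d 0 i) = 2^-1 * (1 + r 0 i)^-1 by rewrite dE psi_sqr.
have r1 i : r 0 i <= 1.
  by rewrite mxE -[leRHS]sqrtr1 ler_wsqrtr// gerBl.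
clearbody r.
exists P, W, r; split; first by split=> // i; rewrite r0 r1.
move=> K; have GV : G *m V = 1%:M by apply: mulmx1C.
pose D e := diag_mx (complexmx e) : 'M[R[i]]_n.
have WPc : ctr W *m ctr P = 1%:M by rewrite -ctrM PW ctr1.
have PWc : ctr P *m ctr W = 1%:M by rewrite -ctrM WP ctr1.
have EqGq : q *m G *m mxconj q = ctr P *m D d *m P.
  rewrite -[LHS]mul1mx -VG -mulmxA (_ : G *m _ = G *m q *m G *m mxconj q).
    by rewrite EM EV -!mulmxA (mulmxA P) PW mul1mx.
  by rewrite !mulmxA.
have PGP : P *m G *m ctr P = 1%:M by rewrite EG mulmxA PW mul1mx WPc.
have EF : funcalc psi (G *m q *m G *m mxconj q) = W *m D (map_mx psi d) *m P.
  exact: (funcalcI _ PW EM).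
have EF' : funcalc psi (q *m G *m mxconj q *m G) = ctr P *m D (map_mx psi d) *m ctr W.
  apply: (funcalcI _ WPc).
  by rewrite EqGq EG -!mulmxA (mulmxA P) PW mul1mx.
have DD e f : D e *m D f = D (\row_i (e 0 i * f 0 i)) by exact: diag_mxM.
have eqD (e f : 'rV[R]_n) : (forall i, e 0 i = f 0 i) -> D e = D f.
  by move=> ef; congr diag_mx; apply/rowP => i; rewrite !mxE ef.
have D1 : D (const_mx 1) = 1%:M.
  by rewrite -diag_const_mx; congr diag_mx; apply/rowP => i; rewrite !mxE.
have DB (e : 'rV[R]_n) : 1%:M - D e = D (\row_i (1 - e 0 i)).
  apply/matrixP => i j; rewrite !mxE; case: eqVneq => _.
    by rewrite !mulr1n -rmorphB.
  by rewrite !mulr0n subr0.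
have DA (e : 'rV[R]_n) : 1%:M + D e = D (\row_i (1 + e 0 i)).
  apply/matrixP => i j; rewrite !mxE; case: eqVneq => _.
    by rewrite !mulr1n rmorphD.
  by rewrite !mulr0n addr0.
have DZ (e : 'rV[R]_n) : 2^-1 *: D e = D (\row_i (2^-1 * e 0 i)).
  apply/matrixP => i j; rewrite !mxE; case: eqVneq => _.
    by rewrite !mulr1n rmorphM fmorphV rmorph_nat.
  by rewrite !mulr0n mulr0.
have EVK : V - K = ctr P *m D (\row_i (1 - r 0 i)) *m P.
  by rewrite -DB mulmxBr mulmx1 mulmxBl -EV.
have EVK' : V + K = ctr P *m D (\row_i (1 + r 0 i)) *m P.
  by rewrite -DA mulmxDr mulmx1 mulmxDl -EV.
have key i : d 0 i * psi (d 0 i) = 2^-1 * (1 - r 0 i).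
  rewrite psiE dE (_ : 1 - _ = (1 - r 0 i) * (1 + r 0 i)); last by ring.
  rewrite mulrCA -mulrA mulfV ?mulr1// gt_eqF// ltr_wpDr// ?ltW//.
split.
- rewrite /K EqGq -!mulmxA (mulmxA P) (mulmxA _ (ctr P)) PGP mul1mx (mulmxA (D r)) DD.
  rewrite {1}EV -[X in ctr P *m X - _]mul1mx -mulmxBr -mulmxBl; congr (_ *m (_ *m _)).
  by rewrite DB; apply: eqD => i; rewrite !mxE -expr2 r2.
- rewrite EVK' EF -!mulmxA (mulmxA P) PW mul1mx (mulmxA (D _)) DD.
  rewrite EV scalemxAr -[X in _ *: X]mul1mx scalemxAl; congr (_ *m (_ *m _)).
  rewrite -D1 DZ; apply: eqD => i; rewrite !mxE psiE mulrCA mulfV// gt_eqF//.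
  by rewrite ltr_wpDr// ltW.
- rewrite EF EM EVK EG -!mulmxA (mulmxA P) PW mul1mx (mulmxA (D _)) DD.
  rewrite -scalemxAr (mulmxA (ctr W)) WPc mul1mx scalemxAl DZ.
  by congr (_ *m (_ *m _)); apply: eqD => i; rewrite !mxE key.
- rewrite EF' EqGq EVK -!mulmxA (mulmxA (ctr W)) WPc mul1mx (mulmxA (D _)) DD.
  rewrite scalemxAr scalemxAl DZ.
  by congr (_ *m (_ *m _)); apply: eqD => i; rewrite !mxE mulrC key.
Qed.

End ConjTranspose.

(** * Integrals of periodic derivatives *)

Section CubeIntegral.
Context {R : realType}.
Local Notation mu := (@lebesgue_measure R).
Local Notation I01 := (`[0, 1]%classic : set R).

Lemma integrable01 (f : R -> R) : continuous f -> mu.-integrable I01 (EFin \o f).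
Proof.
move=> cf; apply: continuous_compact_integrable; first exact: segment_compact.
exact: continuous_subspaceT.
Qed.

Lemma Rintegral01_cst (r : R) : Rintegral mu I01 (fun=> r) = r.
Proof.
have E : mu I01 = 1%:E by rewrite lebesgue_measure_itv /= lte_fin ltr01 oppr0 adde0.
rewrite Rintegral_cst; last exact: measurable_itv.
by rewrite [X in fine X]E mulr1.
Qed.

Lemma Rintegral01_bound (f : R -> R) M : continuous f -> (forall t, `|f t| <= M) ->
  `|Rintegral mu I01 f| <= M.
Proof.
move=> cf fM; rewrite (le_trans (le_normr_Rintegral _ (integrable01 cf)))//.
rewrite -[leRHS]Rintegral01_cst; apply: le_Rintegral => //.
- apply: integrable01 => x; apply: continuous_comp (cf x) _; exact: norm_continuous.
- exact: integrable01 (@cst_continuous _ _ _).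
Qed.

Lemma Rintegral01_derive (f g : R -> R) : continuous g -> continuous f ->
  (forall t : R, is_derive t 1 f (g t)) -> Rintegral mu I01 g = f 1 - f 0.
Proof.
move=> cg cf fg; rewrite /Rintegral (@continuous_FTC2 _ g f 0 1)//.
- exact: continuous_subspaceT.
- split; first by move=> t _; have [] := fg t.
    by apply: cvg_at_right_filter; exact: cf.
  by apply: cvg_at_left_filter; exact: cf.
- by move=> t _; rewrite derive1E; have [_ ->] := fg t.
Qed.

Definition dist1 m (x y : 'rV[R]_m) : R := \sum_i `|x 0 i - y 0 i|.

(* Unlike mere integrability, Lipschitz continuity passes to slices and to partial
   integrals, so it makes the iterated integral [cube_int] additive. *)
Definition lip m (F : 'rV[R]_m -> R) : Prop :=
  exists M : R, forall x y, `|F x - F y| <= M * dist1 x y.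

Definition slice m (F : 'rV[R]_m.+1 -> R) (t : R) : 'rV[R]_m -> R :=
  fun x => F (row_mx (const_mx t : 'rV_1) x).

Lemma dist1_slice m t s (x y : 'rV[R]_m) :
  dist1 (row_mx (const_mx t : 'rV_1) x) (row_mx (const_mx s : 'rV_1) y)
  = `|t - s| + dist1 x y.
Proof.
rewrite /dist1 big_split_ord /= big_ord1 !row_mxEl !mxE; congr (_ + _).
by apply: eq_bigr => i _; rewrite !row_mxEr.
Qed.

Lemma dist1xx m (x : 'rV[R]_m) : dist1 x x = 0.
Proof. by apply: big1 => i _; rewrite subrr normr0. Qed.

Lemma lip_slice m (F : 'rV[R]_m.+1 -> R) t : lip F -> lip (slice F t).
Proof.
move=> [M FM]; exists M => x y; have := FM (row_mx (const_mx t : 'rV_1) x)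
  (row_mx (const_mx t : 'rV_1) y).
by rewrite dist1_slice subrr normr0 add0r.
Qed.

Lemma lip_slice_sub m (F : 'rV[R]_m.+1 -> R) : lip F ->
  exists M : R, forall t s x, `|slice F t x - slice F s x| <= M * `|t - s|.
Proof.
move=> [M FM]; exists M => t s x; have := FM (row_mx (const_mx t : 'rV_1) x)
  (row_mx (const_mx s : 'rV_1) x).
by rewrite dist1_slice dist1xx addr0.
Qed.

Lemma lipD m (F G : 'rV[R]_m -> R) : lip F -> lip G -> lip (fun x => F x + G x).
Proof.
move=> [M FM] [N GN]; exists (M + N) => x y; rewrite opprD addrACA mulrDl.
by rewrite (le_trans (ler_normD _ _))// lerD.
Qed.

Lemma lipZ m c (F : 'rV[R]_m -> R) : lip F -> lip (fun x => c * F x).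
Proof.
move=> [M FM]; exists (`|c| * M) => x y; rewrite -mulrBr normrM -mulrA.
by rewrite ler_wpM2l.
Qed.

Lemma lip_continuous (f : R -> R) M : (forall t s, `|f t - f s| <= M * `|t - s|) ->
  continuous f.
Proof.
move=> fM t; apply/cvgrPdist_lt => e e0.
have M0 : 0 < `|M| + 1 by rewrite ltr_wpDl.
near=> s; apply: (le_lt_trans (fM t s)).
apply: (@le_lt_trans _ _ ((`|M| + 1) * `|t - s|)).
  by rewrite ler_wpM2r// (le_trans (ler_norm M))// lerDl.
rewrite -ltr_pdivlMl// mulrC.
by near: s; apply: cvgr_dist_lt; rewrite ?divr_gt0.
Unshelve. all: by end_near. Qed.

Lemma is_derive_quadratic (f : R -> R) (t d M : R) :
  (forall s, `|f (t + s) - f t - s * d| <= M * s ^+ 2) -> is_derive t 1 f d.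
Proof.
move=> fM.
have C : h^-1 *: ((f \o shift t) (h *: 1) - f t) @[h --> (0 : R)^'] --> d.
  apply/cvgrPdist_le => e e0.
  have M0 : 0 < `|M| + 1 by rewrite ltr_wpDl.
  near=> h.
  have h0 : h != 0 by near: h; exact: nbhs_dnbhs_neq.
  have -> : d - h^-1 *: ((f \o shift t) (h *: 1) - f t)
          = - (h^-1 * (f (t + h) - f t - h * d)).
    rewrite /= [h *: 1]mulr1 (addrC h) [in RHS]mulrBr (mulrA h^-1 h d) mulVf// mul1r.
    by rewrite opprB.
  rewrite normrN normrM normfV ler_pdivrMl ?normr_gt0//.
  rewrite (le_trans (fM h))// -real_normK ?num_real// expr2 mulrCA ler_wpM2l//.
  apply: (@le_trans _ _ ((`|M| + 1) * `|h|)).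
    by rewrite ler_wpM2r// (le_trans (ler_norm M))// lerDl.
  rewrite mulrC -ler_pdivlMr// ltW//.
  by near: h; apply: dnbhs0_lt; rewrite divr_gt0.
apply: DeriveDef; first by apply/cvg_ex; exists d; exact: C.
exact: cvg_lim C.
Unshelve. all: by end_near. Qed.

Lemma cube_intE m (F : 'rV[R]_m.+1 -> R) :
  cube_int F = Rintegral mu I01 (fun t => cube_int (slice F t)).
Proof. by []. Qed.

Lemma cube_int_linear m (F G : 'rV[R]_m -> R) : lip F -> lip G ->
  [/\ cube_int (fun x => F x + G x) = cube_int F + cube_int G,
      forall c, cube_int (fun x => c * F x) = c * cube_int F,
      forall M, (forall x, `|F x| <= M) -> `|cube_int F| <= M &
      match m return ('rV[R]_m -> R) -> Prop with
      | 0%N => fun=> True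
      | m'.+1 => fun F => continuous (fun t => cube_int (slice F t))
      end F].
Proof.
elim: m F G => [|m IH] F G lF lG; first by split=> // M FM; exact: FM.
have cont (H : 'rV[R]_m.+1 -> R) : lip H -> continuous (fun t => cube_int (slice H t)).
  move=> lH; have [M HM] := lip_slice_sub lH; apply: (@lip_continuous _ M) => t s.
  have lN : lip (fun x => -1 * slice H s x) by apply: lipZ; exact: lip_slice.
  have [+ _ _ _] := IH _ _ (lip_slice t lH) lN.
  have [_ -> _ _] := IH _ _ (lip_slice s lH) lN; rewrite mulN1r => <-.
  have [_ _ + _] := IH _ _ (lipD (lip_slice t lH) lN) lN.
  by apply => x; rewrite mulN1r.
split.
- rewrite !cube_intE -RintegralD//; [|exact: integrable01 (cont _ lF)|exact: integrable01 (cont _ lG)].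
  apply: eq_Rintegral => t _.
  by have [+ _ _ _] := IH _ _ (lip_slice t lF) (lip_slice t lG).
- move=> c; rewrite !cube_intE -RintegralZl//; last exact: integrable01 (cont _ lF).
  apply: eq_Rintegral => t _.
  by have [_ + _ _] := IH _ _ (lip_slice t lF) (lip_slice t lG); apply.
- move=> M FM; rewrite cube_intE; apply: Rintegral01_bound; first exact: cont.
  move=> t; have [_ _ + _] := IH _ _ (lip_slice t lF) (lip_slice t lG).
  by apply => x; exact: FM.
- exact: cont.
Qed.

Lemma cube_intD m (F G : 'rV[R]_m -> R) : lip F -> lip G ->
  cube_int (fun x => F x + G x) = cube_int F + cube_int G.
Proof. by move=> lF lG; have [] := cube_int_linear lF lG. Qed.

Lemma cube_intZ m c (F : 'rV[R]_m -> R) : lip F ->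
  cube_int (fun x => c * F x) = c * cube_int F.
Proof. by move=> lF; have [] := cube_int_linear lF lF. Qed.

Lemma cube_int_bound m (F : 'rV[R]_m -> R) M : lip F -> (forall x, `|F x| <= M) ->
  `|cube_int F| <= M.
Proof. by move=> lF; have [_ _ + _] := cube_int_linear lF lF; apply. Qed.

Lemma cube_int_cst m (c : R) : cube_int (fun _ : 'rV[R]_m => c) = c.
Proof.
elim: m => [//|m IH]; rewrite cube_intE.
under eq_Rintegral => t _ do rewrite IH.
exact: Rintegral01_cst.
Qed.

Lemma lip_cst m (c : R) : lip (fun _ : 'rV[R]_m => c).
Proof. by exists 0 => x y; rewrite subrr normr0 mul0r. Qed.

Lemma lip_sum m (I : Type) (r : seq I) (F : I -> 'rV[R]_m -> R) :
  (forall i, lip (F i)) -> lip (fun x => \sum_(i <- r) F i x).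
Proof.
move=> lF; elim: r => [|i r IH].
  by under eq_fun do rewrite big_nil; exact: lip_cst.
by under eq_fun do rewrite big_cons; exact: lipD.
Qed.

Lemma cube_int_sum m (I : Type) (r : seq I) (F : I -> 'rV[R]_m -> R) :
  (forall i, lip (F i)) ->
  cube_int (fun x => \sum_(i <- r) F i x) = \sum_(i <- r) cube_int (F i).
Proof.
move=> lF; elim: r => [|i r IH].
  by under eq_fun do rewrite big_nil; rewrite cube_int_cst big_nil.
by under eq_fun do rewrite big_cons; rewrite cube_intD ?IH ?big_cons//; exact: lip_sum.
Qed.

Definition lip1 m (F : 'rV[R]_m -> R) : Prop :=
  [/\ Zperiodic F, lip F & forall a, (forall x, derivable F x (delta_mx 0 a)) /\ lip (pd a F)].

Lemma quotient_slice m (F : 'rV[R]_m.+1 -> R) t (a : 'I_m) (x : 'rV[R]_m) :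
  (fun h : R => h^-1 *: ((slice F t \o shift x) (h *: delta_mx 0 a) - slice F t x)) =
  (fun h : R => h^-1 *: ((F \o shift (row_mx (const_mx t : 'rV_1) x))
     (h *: delta_mx 0 (rshift 1 a)) - F (row_mx (const_mx t : 'rV_1) x))).
Proof.
apply/funext => h /=; congr (_ *: (_ - _)); rewrite /slice; congr F.
apply/rowP => j; case: (@split_ordP 1 m j) => k ->.
  by rewrite (@row_mxEl _ 1 1 m) [RHS]mxE (@row_mxEl _ 1 1 m) !mxE eq_lrshift andbF mulr0 add0r.
by rewrite (@row_mxEr _ 1 1 m) [RHS]mxE (@row_mxEr _ 1 1 m) !mxE (inj_eq (@rshift_inj _ _)).
Qed.

Lemma lip1_slice m (F : 'rV[R]_m.+1 -> R) t : lip1 F ->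
  lip1 (slice F t) /\ forall a, pd a (slice F t) = slice (pd (rshift 1 a) F) t.
Proof.
move=> [pF lF dF].
have E a : pd a (slice F t) = slice (pd (rshift 1 a) F) t.
  by apply/funext => x; rewrite /pd /derive quotient_slice.
split=> //; split; [|exact: lip_slice|].
- move=> x k; apply: etrans (pF (row_mx (const_mx t : 'rV_1) x) (row_mx (0 : 'rV_1) k)).
  congr F.
  apply/rowP => j; case: (@split_ordP 1 m j) => i ->.
    rewrite (@row_mxEl _ 1 1 m) [RHS]mxE (@row_mxEl _ 1 1 m) [X in _ = _ + X]mxE.
    by rewrite (@row_mxEl _ 1 1 m) !mxE addr0.
  rewrite (@row_mxEr _ 1 1 m) [RHS]mxE (@row_mxEr _ 1 1 m) [X in _ = _ + X]mxE.
  by rewrite (@row_mxEr _ 1 1 m) !mxE.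
- move=> a; have [da la] := dF (rshift 1 a); split; last by rewrite E; exact: lip_slice.
  by move=> x; have := da (row_mx (const_mx t : 'rV_1) x); rewrite /derivable -quotient_slice.
Qed.

Lemma row_mx_shift m t s (x : 'rV[R]_m) :
  row_mx (const_mx (t + s) : 'rV_1) x =
  row_mx (const_mx t : 'rV_1) x + s *: delta_mx 0 (lshift m (ord0 : 'I_1)).
Proof.
apply/rowP => j; case: (@split_ordP 1 m j) => k ->.
  by rewrite (@row_mxEl _ 1 1 m) [RHS]mxE (@row_mxEl _ 1 1 m) !mxE (ord1 k) !eqxx mulr1.
by rewrite (@row_mxEr _ 1 1 m) [RHS]mxE (@row_mxEr _ 1 1 m) !mxE eq_rlshift andbF mulr0 addr0.
Qed.

Lemma slice_taylor m (F : 'rV[R]_m.+1 -> R) : lip1 F ->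
  exists M : R, forall t s x,
  `|slice F (t + s) x - slice F t x - s * slice (pd (lshift m (ord0 : 'I_1)) F) t x|
  <= M * s ^+ 2.
Proof.
move=> [_ _ dF]; set e := lshift m (ord0 : 'I_1).
have [de le] := dF e; have [M HM] := lip_slice_sub le.
have M0 : 0 <= M.
  have := HM 1 0 0; rewrite subr0 normr1 mulr1; exact: le_trans.
exists M => t s x.
suff [c [cs E]] : exists c, `|c| <= `|s| /\
    slice F (t + s) x - slice F t x = s * slice (pd e F) (t + c) x.
  rewrite E -mulrBr normrM.
  have := HM (t + c) t x; rewrite addrAC subrr add0r => h.
  rewrite (le_trans (ler_wpM2l (normr_ge0 s) h))// -real_normK ?num_real// expr2.
  by rewrite mulrCA ler_wpM2l// ler_wpM2l.
have [s0|s0|->] := ltgtP s 0.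
- have [c /andP[c0 cs] E] := MVT_line (row_mx (const_mx (t + s) : 'rV_1) x) de
    (etrans (oppr_gt0 s) s0).
  exists (s + c); split.
    rewrite ler_norml ltr0_norm// opprK lerDl ltW//=.
    by rewrite (le_trans (y := 0))// ?oppr_ge0 ?ltW// -ltrBrDl sub0r.
  move: E; rewrite -!row_mx_shift addrK => /eqP; rewrite mulNr -eqr_oppLR opprB => /eqP E.
  by rewrite /slice E /pd addrA.
- have [c /andP[c0 cs] E] := MVT_line (row_mx (const_mx t : 'rV_1) x) de s0.
  exists c; split; first by rewrite !gtr0_norm// ltW.
  by rewrite /slice !row_mx_shift E.
- by exists 0; rewrite addr0 subrr mul0r.
Qed.

Lemma cube_int_pd m (F : 'rV[R]_m -> R) a : lip1 F -> cube_int (pd a F) = 0.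
Proof.
elim: m F a => [|m IH] F a lF; first by case: a.
have [pF lipF dF] := lF.
rewrite cube_intE; move: a; rewrite -[m.+1]/(1 + m)%N => a.
case: (@split_ordP 1 m a) => b ->; last first.
  under eq_Rintegral => t _.
    have [lt E] := lip1_slice t lF; rewrite -E IH//.
    over.
  exact: Rintegral01_cst.
rewrite (ord1 b) {b}; set e := lshift m _.
have [M HM] := slice_taylor lF; have [_ le] := dF e.
pose f t := cube_int (slice F t); pose g t := cube_int (slice (pd e F) t).
have cf : continuous f by have [] := cube_int_linear lipF lipF.
have cg : continuous g by have [] := cube_int_linear le le.
have fg t s : `|f (t + s) - f t - s * g t| <= M * s ^+ 2.
  have l1 := lip_slice (t + s) lipF; have l2 := lip_slice t lipF; have l3 := lip_slice t le.
  have -> : f (t + s) - f t - s * g t = cube_int (fun x =>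
      (slice F (t + s) x + -1 * slice F t x) + (- s) * slice (pd e F) t x).
    rewrite cube_intD ?cube_intD ?cube_intZ//; try (by apply: lipZ);
      last by apply: lipD => //; exact: lipZ.
    by rewrite mulN1r mulNr.
  apply: cube_int_bound; first by apply: lipD; [apply: lipD => //|]; exact: lipZ.
  by move=> x; rewrite mulN1r mulNr.
have fg' (t : R) : is_derive t 1 f (g t).
  exact: is_derive_quadratic (fg t).
rewrite (Rintegral01_derive cg cf fg') /f.
apply/eqP; rewrite subr_eq0; apply/eqP; congr cube_int; apply/funext => x.
rewrite /slice -[1]add0r row_mx_shift -[RHS](pF _ (delta_mx 0 (lshift m (ord0 : 'I_1)))).
congr F; congr (_ + _); rewrite scale1r; apply/rowP => j; rewrite !mxE.
by case: (_ && _).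
Qed.

End CubeIntegral.

(** * Mixed discriminants and Jacobi's formula *)

Section DetRow.
Context {F : comNzRingType} {n : nat}.
Implicit Types A B : 'M[F]_n.

Definition rowrepl A B (i : 'I_n) : 'M[F]_n :=
  \matrix_(k, l) (if k == i then B k l else A k l).

Lemma sum_det_rowrepl A B : \sum_i \det (rowrepl A B i) = \tr (B *m \adj A).
Proof.
apply: eq_bigr => i _; rewrite (expand_det_row _ i) mxE.
apply: eq_bigr => j _; rewrite !mxE eqxx; congr (_ * _).
rewrite /cofactor; congr (_ * \det _); apply/matrixP => k l.
by rewrite !mxE eq_sym (negPf (neq_lift _ _)).
Qed.

(* The coefficient [wedge11], over an arbitrary commutative ring. *)
Definition mixed_det (eta : 'I_n -> 'M[F]_n) : F :=
  \sum_(s : 'S_n) \sum_(t : 'S_n)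
    (-1) ^+ s * (-1) ^+ t * \prod_(k < n) eta k (s k) (t k).

Lemma mixed_det_inner (eta : 'I_n -> 'M[F]_n) :
  mixed_det eta = \sum_(s : 'S_n) \det (\matrix_(i, j) eta (s^-1%g i) i j).
Proof.
apply: eq_bigr => s _; rewrite (reindex_inj (mulgI s)) /=.
apply: eq_bigr => t _; rewrite odd_permM (signr_addb _ s t) [X in X * _]mulrA -signr_addb addbb expr0 mul1r.
congr (_ * _); rewrite (reindex_inj (@perm_inj _ s^-1%g)) /=.
by apply: eq_bigr => i _; rewrite permM permKV mxE.
Qed.

Lemma mixed_det_perm (eta : 'I_n -> 'M[F]_n) (p : 'S_n) :
  mixed_det (fun k => eta (p k)) = mixed_det eta.
Proof.
rewrite /mixed_det (reindex_inj (mulgI p)) /=; apply: eq_bigr => s _.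
rewrite (reindex_inj (mulgI p)) /=; apply: eq_bigr => t _.
rewrite !odd_permM (signr_addb _ p s) (signr_addb _ p t) [X in X * _ = _]mulrACA -(signr_addb _ p p) addbb expr0 mul1r; congr (_ * _).
rewrite [RHS](reindex_inj (@perm_inj _ p)) /=.
by apply: eq_bigr => k _; rewrite !permM.
Qed.

Lemma mixed_det_cst A : mixed_det (fun=> A) = n`!%:R * \det A.
Proof.
rewrite mixed_det_inner; under eq_bigr => s _.
  rewrite (_ : \matrix_(i, j) _ = A); last by apply/matrixP => i j; rewrite mxE.
  over.
by rewrite sumr_const card_Sn mulr_natl.
Qed.

Lemma mixed_det_first A B :
  n%:R * mixed_det (fun k => if (k : nat) == 0%N then B else A)
  = n`!%:R * \tr (B *m \adj A).
Proof.
pose w k0 := mixed_det (fun k => if k == k0 then B else A).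
have -> : n%:R * mixed_det (fun k => if (k : nat) == 0%N then B else A)
   = \sum_k0 w k0.
  transitivity (\sum_(k0 < n) mixed_det (fun k => if (k : nat) == 0%N then B else A)).
    by rewrite sumr_const card_ord mulr_natl.
  apply: eq_bigr => k0 _.
  have z0 : (0 < n)%N by apply: leq_ltn_trans (ltn_ord k0).
  pose z := Ordinal z0.
  rewrite /w -(mixed_det_perm _ (tperm z k0)); congr mixed_det; apply/funext => k.
  rewrite -[_ == 0%N]/(tperm z k0 k == z); case: tpermP => [->|->|/eqP kz /eqP kk].
  - by rewrite eq_sym.
  - by rewrite !eqxx.
  - by rewrite (negPf kz) (negPf kk).
under eq_bigr => k0 _ do rewrite /w mixed_det_inner.
rewrite exchange_big /=.
under eq_bigr => s _.
  rewrite (_ : \sum_i _ = \tr (B *m \adj A)); last first.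
    rewrite -sum_det_rowrepl [RHS](reindex_inj (@perm_inj _ s)) /=.
    apply: eq_bigr => k _; congr (\det _); apply/matrixP => i j.
    rewrite !mxE -(can_eq (permK s)) permKV; by case: ifP.
  over.
by rewrite sumr_const card_Sn mulr_natl.
Qed.

End DetRow.

Section Jacobi.
Context {R : realType} {n : nat}.

Lemma Cpd_prod (a : 'I_n) (I : eqType) (r : seq I) (F : I -> 'rV[R]_n -> R[i]) x :
  uniq r -> (forall i, csmoothn 1 (F i)) ->
  Cpd a (fun x => \prod_(i <- r) F i x) x =
  \sum_(i <- r) \prod_(j <- r) (if j == i then Cpd a (F j) x else F j x).
Proof.
move=> + sF; elim: r => [_|i r IH /= /andP[ir ur]].
  by under eq_fun do rewrite big_nil; rewrite Cpd_cst big_nil.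
under eq_fun do rewrite big_cons.
rewrite CpdM//; [|exact: csmoothn_diff (sF i)|exact: csmoothn_diff (csmoothn_prod _ _ sF)].
rewrite IH// !big_cons eqxx mulr_sumr; congr (_ * _ + _).
  by apply: eq_big_seq => j jr; case: eqP => // ji; rewrite -ji jr in ir.
apply: eq_big_seq => j jr; rewrite big_cons; case: eqP => // ij.
by rewrite ij jr in ir.
Qed.

Lemma Cpd_det (a : 'I_n) m (Z : 'rV[R]_n -> 'M[R[i]]_m) x : mxsmoothn 1 Z ->
  Cpd a (fun x => \det (Z x)) x = \tr (mxpd a Z x *m \adj (Z x)).
Proof.
move=> sZ; rewrite -sum_det_rowrepl /determinant.
rewrite Cpd_sum; last first.
  move=> s; apply: (csmoothn_diff (k := 0)); apply: csmoothnM; first exact: csmoothn_cst.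
  by apply: csmoothn_prod => i; exact: sZ.
rewrite exchange_big /=; apply: eq_bigr => s _.
rewrite CpdM; [|exact: csmoothn_diff (csmoothn_cst 1 _)|]; last first.
  by apply: (csmoothn_diff (k := 0)); apply: csmoothn_prod => i; exact: sZ.
rewrite Cpd_cst mul0r add0r -mulr_sumr; congr (_ * _).
rewrite (Cpd_prod a x (index_enum_uniq _)); last by move=> i; exact: sZ.
by apply: eq_bigr => i _; apply: eq_bigr => j _; rewrite !mxE.
Qed.

End Jacobi.

(** * Smoothness of the geometric mean *)

Lemma mxtrace_mulDZ (F : comPzRingType) n (c : F) (A A' B B' : 'M[F]_n) :
  \tr ((c *: A' + B') *m (c *: A + B)) = c ^+ 2 * \tr (A' *m A)
    + (c * (\tr (A' *m B) + \tr (B' *m A)) + \tr (B' *m B)).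
Proof.
rewrite mulmxDl !mulmxDr !mxtraceD -!scalemxAl -!scalemxAr !mxtraceZ; ring.
Qed.

Section MatrixNorm.
Context {R : realType}.
Implicit Types z w : R[i].

Definition abs1 z : R := `|complex.Re z| + `|complex.Im z|.

Lemma abs1_ge0 z : 0 <= abs1 z. Proof. by rewrite addr_ge0. Qed.

Lemma abs1_0 : abs1 0 = 0. Proof. by rewrite /abs1 normr0 addr0. Qed.

Lemma abs1D z w : abs1 (z + w) <= abs1 z + abs1 w.
Proof. by rewrite /abs1 cReD cImD addrACA lerD// ler_normD. Qed.

Lemma abs1N z : abs1 (- z) = abs1 z.
Proof. by rewrite /abs1 cReN cImN !normrN. Qed.

Lemma abs1M z w : abs1 (z * w) <= abs1 z * abs1 w.
Proof.
rewrite /abs1 cReM cImM mulrDl !mulrDr -!normrM.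
rewrite (le_trans (lerD (ler_normB _ _) (ler_normD _ _)))//.
by rewrite le_eqVlt; apply/orP; left; apply/eqP; ring.
Qed.

Lemma abs1_conj z : abs1 (conjc z) = abs1 z.
Proof. by rewrite /abs1 cRe_conj cIm_conj normrN. Qed.

Lemma abs1_sum (I : Type) (r : seq I) (P : pred I) (F : I -> R[i]) :
  abs1 (\sum_(i <- r | P i) F i) <= \sum_(i <- r | P i) abs1 (F i).
Proof.
elim/big_rec2: _ => [|i x y _ h]; first by rewrite abs1_0.
by rewrite (le_trans (abs1D _ _))// lerD2l.
Qed.

Definition sqr_abs z : R := complex.Re z ^+ 2 + complex.Im z ^+ 2.

Lemma sqr_absE z : conjc z * z = (sqr_abs z)%:C.
Proof.
case: z => a b; apply/eqP; rewrite eq_complex /sqr_abs /=.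
by apply/andP; split; apply/eqP; ring.
Qed.

Lemma sqr_abs_ge0 z : 0 <= sqr_abs z.
Proof. by rewrite addr_ge0// sqr_ge0. Qed.

Lemma sqr_abs_le z : sqr_abs z <= abs1 z ^+ 2.
Proof.
rewrite /sqr_abs /abs1; set a := complex.Re z; set b := complex.Im z.
rewrite -(real_normK (num_real a)) -(real_normK (num_real b)).
have := mulr_ge0 (normr_ge0 a) (normr_ge0 b); nra.
Qed.

Lemma abs1_sqr_le z : abs1 z ^+ 2 <= 2 * sqr_abs z.
Proof.
rewrite /sqr_abs /abs1; set a := complex.Re z; set b := complex.Im z.
rewrite -(real_normK (num_real a)) -(real_normK (num_real b)).
have := sqr_ge0 (`|a| - `|b|); nra.
Qed.

Definition mxabs1 {m p} (A : 'M[R[i]]_(m, p)) : R := \sum_i \sum_j abs1 (A i j).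

Lemma mxabs1_ge0 m p (A : 'M[R[i]]_(m, p)) : 0 <= mxabs1 A.
Proof. by do 2 apply: sumr_ge0 => ? _; exact: abs1_ge0. Qed.

Lemma abs1_le_mxabs1 m p (A : 'M[R[i]]_(m, p)) i j : abs1 (A i j) <= mxabs1 A.
Proof.
rewrite /mxabs1 (bigD1 i)//= (bigD1 j)//= -addrA lerDl addr_ge0//.
  by apply: sumr_ge0 => ? _; exact: abs1_ge0.
by do 2 apply: sumr_ge0 => ? _; exact: abs1_ge0.
Qed.

Lemma mxabs1D m p (A B : 'M[R[i]]_(m, p)) : mxabs1 (A + B) <= mxabs1 A + mxabs1 B.
Proof.
rewrite /mxabs1 -big_split/=; apply: ler_sum => i _.
by rewrite -big_split/=; apply: ler_sum => j _; rewrite mxE abs1D.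
Qed.

Lemma mxabs1N m p (A : 'M[R[i]]_(m, p)) : mxabs1 (- A) = mxabs1 A.
Proof. by do 2 apply: eq_bigr => ? _; rewrite mxE abs1N. Qed.

Lemma mxabs1M m p q (A : 'M[R[i]]_(m, p)) (B : 'M[R[i]]_(p, q)) :
  mxabs1 (A *m B) <= mxabs1 A * mxabs1 B.
Proof.
apply: (@le_trans _ _ (\sum_i \sum_j \sum_k abs1 (A i k) * abs1 (B k j))).
  apply: ler_sum => i _; apply: ler_sum => j _; rewrite mxE.
  by rewrite (le_trans (abs1_sum _ _ _))//; apply: ler_sum => k _; exact: abs1M.
rewrite /mxabs1 mulr_suml; apply: ler_sum => i _.
rewrite exchange_big /= mulr_suml; apply: ler_sum => k _.
rewrite -mulr_sumr ler_wpM2l ?abs1_ge0// [leRHS](bigD1 k)//= lerDl.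
by do 2 apply: sumr_ge0 => ? _; exact: abs1_ge0.
Qed.

Definition frob {m p} (A : 'M[R[i]]_(m, p)) : R := \sum_i \sum_j sqr_abs (A i j).

Lemma frob_ge0 m p (A : 'M[R[i]]_(m, p)) : 0 <= frob A.
Proof. by do 2 apply: sumr_ge0 => ? _; exact: sqr_abs_ge0. Qed.

Lemma frobE m p (A : 'M[R[i]]_(m, p)) : \tr (ctr A *m A) = (frob A)%:C.
Proof.
rewrite /frob exchange_big /= rmorph_sum; apply: eq_bigr => j _.
rewrite mxE rmorph_sum; apply: eq_bigr => i _.
by rewrite !mxE sqr_absE.
Qed.

Lemma sqr_abs_le_frob m p (A : 'M[R[i]]_(m, p)) i j : sqr_abs (A i j) <= frob A.
Proof.
rewrite /frob (bigD1 i)//= (bigD1 j)//= -addrA lerDl addr_ge0//.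
  by apply: sumr_ge0 => ? _; exact: sqr_abs_ge0.
by do 2 apply: sumr_ge0 => ? _; exact: sqr_abs_ge0.
Qed.

Lemma frob_le m p (A : 'M[R[i]]_(m, p)) : frob A <= mxabs1 A ^+ 2.
Proof.
have sum_sqr (I : finType) (t : I -> R) : (forall i, 0 <= t i) ->
    \sum_i t i ^+ 2 <= (\sum_i t i) ^+ 2.
  move=> t0; rewrite [leRHS]expr2 mulr_suml; apply: ler_sum => i _.
  rewrite expr2 ler_wpM2l// [leRHS](bigD1 i)//= lerDl.
  by apply: sumr_ge0 => ? _; exact: t0.
rewrite /frob /mxabs1.
apply: (@le_trans _ _ (\sum_i (\sum_j abs1 (A i j)) ^+ 2)); last first.
  by apply: sum_sqr => i; apply: sumr_ge0 => j _; exact: abs1_ge0.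
apply: ler_sum => i _; apply: (le_trans _ (sum_sqr _ _ _)).
  by apply: ler_sum => j _; exact: sqr_abs_le.
by move=> j; exact: abs1_ge0.
Qed.

Lemma psd_trace_ge0 m p (B : 'M[R[i]]_(m, p)) (d : 'rV[R]_m) :
  (forall i, 0 <= d 0 i) -> 0 <= \tr (ctr B *m diag_mx (complexmx d) *m B).
Proof.
move=> d0; apply: sumr_ge0 => j _; rewrite mul_mx_diag mxE.
apply: sumr_ge0 => i _; rewrite !mxE mulrAC sqr_absE -rmorphM ler0c.
by rewrite mulr_ge0// sqr_abs_ge0.
Qed.

Lemma tr_ctr n (A : 'M[R[i]]_n) : \tr (ctr A) = conjc (\tr A).
Proof. by rewrite rmorph_sum; apply: eq_bigr => i _; rewrite !mxE. Qed.

Lemma sylvester_bound n (Z Y : 'M[R[i]]_n) (d r : 'rV[R]_n) (c : R) :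
  0 <= c -> (forall i, 0 <= d 0 i) -> (forall i, c <= r 0 i) ->
  c ^+ 2 * frob Y <=
  frob (ctr Z *m diag_mx (complexmx d) *m Z *m Y + Y *m diag_mx (complexmx r)).
Proof.
move=> c0 d0 cr.
have lhs : (c ^+ 2 * frob Y)%:C = c%:C ^+ 2 * \tr (ctr Y *m Y).
  by rewrite frobE -rmorphXn -rmorphM.
rewrite -lecR lhs; clear lhs.
pose s : 'rV[R]_n := \row_i (r 0 i - c).
set e := (X in frob X); rewrite -frobE.
pose f := ctr Z *m diag_mx (complexmx d) *m Z *m Y + Y *m diag_mx (complexmx s).
have Ee : e = c%:C *: Y + f.
  rewrite /e /f addrCA; congr (_ + _).
  rewrite !mul_mx_diag; apply/matrixP => i j; rewrite !mxE.
  by rewrite [c%:C * _]mulrC -mulrDr -rmorphD addrC subrK.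
have tYf : 0 <= \tr (ctr Y *m f).
  rewrite /f mulmxDr mxtraceD addr_ge0//.
    by rewrite !mulmxA -(mulmxA _ Z) -ctrM; exact: psd_trace_ge0.
  rewrite mxtrace_mulC -{1}(ctrK Y).
  apply: psd_trace_ge0 => i; by rewrite mxE subr_ge0.
have tfY : \tr (ctr f *m Y) = conjc (\tr (ctr Y *m f)).
  by rewrite -[RHS]tr_ctr ctrM ctrK.
have cZ : ctr (c%:C *: Y) = c%:C *: ctr Y.
  by apply/matrixP => i j; rewrite !mxE rmorphM; congr (_ * _); exact: conjc_real.
rewrite Ee ctrD cZ mxtrace_mulDZ tfY.
rewrite lerDl addr_ge0//.
  by rewrite mulr_ge0 ?ler0c// addr_ge0// conj_ge0.
by rewrite frobE ler0c frob_ge0.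
Qed.

End MatrixNorm.

Section DifferentialBounds.
Context {R : realType} {V W : normedModType R}.
Implicit Types f : V -> W.

Lemma diff_flat f x :
  (forall e : R, 0 < e -> \forall h \near (0 : V), `|f (h + x) - f x| <= e * `|h|) ->
  differentiable f x.
Proof.
move=> fx; have [c0 E] : continuous (0 : V -> W) /\
    f \o shift x = cst (f x) + \0 +o_ 0 id.
  split; first exact: cst_continuous.
  apply/eqaddoP => e e0; have := fx _ e0; apply: filterS => h.
  by rewrite !fctE /= addr0.
by apply/diff_locallyP; rewrite (diff_unique c0 E).
Qed.

Lemma diff_lipschitz f x : differentiable f x ->
  exists2 M : R, 0 < M & \forall h \near (0 : V), `|f (h + x) - f x| <= M * `|h|.
Proof.
move=> df; have [k k0 Hk] := linear_lipschitz (diff_continuous df).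
exists (k + 1); first by rewrite addr_gt0.
have /eqaddoP/(_ 1 ltr01) := diff_locally df; apply: filterS => h.
rewrite !fctE /= mul1r => Hh.
rewrite (_ : f (h + x) - f x = (f (h + x) - (f x + 'd f x h)) + 'd f x h); last first.
  by rewrite opprD addrA subrK.
by rewrite (le_trans (ler_normD _ _))// mulrDl mul1r addrC lerD.
Qed.

End DifferentialBounds.

Lemma differentiableM_vanish {R : realType} {V : normedModType R} (f g : V -> R) x :
  {for x, continuous f} -> differentiable g x -> g x = 0 -> differentiable (fun y => f y * g y) x.
Proof.
move=> cf dg g0.
have -> : (fun y => f y * g y) = (fun y => f x * g y + (f y - f x) * g y).
  by apply/funext => y; rewrite -mulrDl addrC subrK.
apply: differentiableD; first by apply: differentiableM => //; exact: differentiable_cst.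
apply: diff_flat => e e0; have [M M0 HM] := diff_lipschitz dg.
have eM : 0 < e / M by rewrite divr_gt0.
have /cvgrPdist_lt/(_ _ eM)/nbhs_normP[r /= r0 Hr] := cf.
near=> h; rewrite g0 mulr0 subr0 normrM.
have h1 : `|g (h + x) - g x| <= M * `|h| by near: h.
have h2 : `|f (h + x) - f x| <= e / M.
  rewrite distrC ltW//; apply: Hr; rewrite /ball_ /= distrC addrK.
  by near: h; exact: nbhs0_lt.
rewrite g0 subr0 in h1.
by rewrite (le_trans (ler_pM _ _ h2 h1))// mulrA divfK// gt_eqF.
Unshelve. all: by end_near. Qed.

Section Vanishing.
Context {R : realType} {n : nat}.
Implicit Types (f g : 'rV[R]_n -> R) (F H : 'rV[R]_n -> R[i]).

Definition cvanish (x : 'rV[R]_n) F : Prop := F x = 0 /\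
  (differentiable (fun y => complex.Re (F y)) x /\
   differentiable (fun y => complex.Im (F y)) x).

Lemma cvanishD x F H : cvanish x F -> cvanish x H -> cvanish x (fun y => F y + H y).
Proof.
move=> [F0 [rF iF]] [H0 [rH iH]]; split; first by rewrite F0 H0 addr0.
by split; under eq_fun do rewrite ?cReD ?cImD; apply: differentiableD.
Qed.

Lemma cvanish_sum x (I : Type) (r : seq I) (P : pred I) (F : I -> 'rV[R]_n -> R[i]) :
  (forall i, cvanish x (F i)) -> cvanish x (fun y => \sum_(i <- r | P i) F i y).
Proof.
move=> vF; elim: r => [|i r IH].
  under eq_fun do rewrite big_nil; split; first by [].
  by split; exact: (@differentiable_cst _ _ _ 0).
under eq_fun do rewrite big_cons; case: (P i) => //; exact: cvanishD.
Qed.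

Lemma cvanishM x F H : csmoothn 0 F -> cvanish x H -> cvanish x (fun y => F y * H y).
Proof.
move=> [rF iF] [H0 [rH iH]]; have [rH0 iH0] : complex.Re (H x) = 0 /\ complex.Im (H x) = 0.
  by rewrite H0.
split; first by rewrite H0 mulr0.
split; under eq_fun do rewrite ?cReM ?cImM.
  by apply: differentiableB; apply: differentiableM_vanish => //; [exact: rF|exact: iF].
by apply: differentiableD; apply: differentiableM_vanish => //; [exact: rF|exact: iF].
Qed.

Definition mxvanish {m p} (x : 'rV[R]_n) (Z : 'rV[R]_n -> 'M[R[i]]_(m, p)) : Prop :=
  forall i j, cvanish x (fun y => Z y i j).

Lemma mxvanishB {m p} x (Z W : 'rV[R]_n -> 'M[R[i]]_(m, p)) :
  mxvanish x Z -> mxvanish x W -> mxvanish x (fun y => Z y - W y).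
Proof.
move=> vZ vW i j; under eq_fun do rewrite !mxE.
apply: cvanishD => //; have [W0 [rW iW]] := vW i j; split; first by rewrite W0 oppr0.
by split; under eq_fun do rewrite ?cReN ?cImN; exact: differentiableN.
Qed.

Lemma mxvanishMl {m p q} x (Z : 'rV[R]_n -> 'M[R[i]]_(m, p))
    (W : 'rV[R]_n -> 'M[R[i]]_(p, q)) :
  mxsmoothn 0 Z -> mxvanish x W -> mxvanish x (fun y => Z y *m W y).
Proof.
move=> sZ vW i j; under eq_fun do rewrite mxE.
by apply: cvanish_sum => k; exact: cvanishM.
Qed.

Lemma mxvanishMr {m p q} x (Z : 'rV[R]_n -> 'M[R[i]]_(m, p))
    (W : 'rV[R]_n -> 'M[R[i]]_(p, q)) :
  mxvanish x Z -> mxsmoothn 0 W -> mxvanish x (fun y => Z y *m W y).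
Proof.
move=> vZ sW i j; under eq_fun do rewrite mxE.
apply: cvanish_sum => k; under eq_fun do rewrite mulrC; exact: cvanishM.
Qed.

Lemma mxvanish_sub {m p} x (Z : 'rV[R]_n -> 'M[R[i]]_(m, p)) :
  mxdiff Z -> mxvanish x (fun y => Z y - Z x).
Proof.
move=> dZ i j; have [rZ iZ] := dZ i j; under eq_fun do rewrite !mxE.
split; first by rewrite subrr.
split; under eq_fun do rewrite ?cReD ?cImD ?cReN ?cImN;
  by apply: differentiableB => //; exact: (@differentiable_cst _ _ _ _).
Qed.

Lemma vanish_mxdiff {m p} (Z : 'rV[R]_n -> 'M[R[i]]_(m, p)) :
  (forall x, mxvanish x (fun y => Z y - Z x)) -> mxdiff Z.
Proof.
move=> vZ i j; split=> x; have [_ [rZ iZ]] := vZ x i j.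
  rewrite (_ : (fun y => _) =
    fun y => complex.Re ((Z y - Z x) i j) + complex.Re (Z x i j)).
    by apply: differentiableD => //; exact: differentiable_cst.
  by apply/funext => y; rewrite -cReD !mxE subrK.
rewrite (_ : (fun y => _) =
    fun y => complex.Im ((Z y - Z x) i j) + complex.Im (Z x i j)).
  by apply: differentiableD => //; exact: differentiable_cst.
by apply/funext => y; rewrite -cImD !mxE subrK.
Qed.

Lemma continuous_sumr (I : Type) (r : seq I) (f : I -> 'rV[R]_n -> R) :
  (forall i, continuous (f i)) -> continuous (fun x => \sum_(i <- r) f i x).
Proof.
move=> cf; elim: r => [|i r IH] x.
  by under eq_fun do rewrite big_nil; exact: cst_continuous.
by under eq_fun do rewrite big_cons; exact: (continuousD (cf i x) (IH x)).
Qed.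

Lemma continuous_mxabs1 {m p} (Z : 'rV[R]_n -> 'M[R[i]]_(m, p)) :
  mxsmoothn 0 Z -> continuous (fun y => mxabs1 (Z y)).
Proof.
move=> sZ.
have cabs (f : 'rV[R]_n -> R) : continuous f -> continuous (fun y => `|f y|).
  by move=> cf x; apply: continuous_comp (cf x) _; exact: norm_continuous.
apply: continuous_sumr => i; apply: continuous_sumr => j x.
have [rZ iZ] := sZ i j.
exact: (continuousD (cabs _ rZ x) (cabs _ iZ x)).
Qed.

End Vanishing.

Section Sylvester.
Context {R : realType}.

Definition sylv n (A B : 'M[R[i]]_n) : 'M[R[i]]_(n * n) :=
  lin_mx (mulmx A) + lin_mx (mulmxr B).

Lemma mul_sylv n (A B X : 'M[R[i]]_n) :
  mxvec X *m sylv A B = mxvec (A *m X + X *m B).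
Proof. by rewrite mulmxDr !mul_vec_lin linearD. Qed.

Lemma sylv_unit n (A B : 'M[R[i]]_n) :
  (forall X, A *m X + X *m B = 0 -> X = 0) -> sylv A B \in unitmx.
Proof.
move=> inj; rewrite -row_free_unit; apply: inj_row_free => v.
rewrite -[v]vec_mxK mul_sylv => /(congr1 vec_mx); rewrite mxvecK linear0.
by move=> /inj ->; rewrite linear0.
Qed.

Lemma mxsmoothn_mxvec (m k n p : nat) (Z : 'rV[R]_m -> 'M[R[i]]_(n, p)) :
  mxsmoothn k Z -> mxsmoothn k (fun x => mxvec (Z x)).
Proof.
move=> sZ i j; rewrite (ord1 i); case/mxvec_indexP: j => i' j'.
by under eq_fun do rewrite mxvecE.
Qed.

Lemma mxsmoothn_vec_mx (m k n p : nat) (Z : 'rV[R]_m -> 'rV[R[i]]_(n * p)) :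
  mxsmoothn k Z -> mxsmoothn k (fun x => vec_mx (Z x)).
Proof. by move=> sZ i j; under eq_fun do rewrite mxE. Qed.

Lemma mxsmoothn_sylv (m k n : nat) (A B : 'rV[R]_m -> 'M[R[i]]_n) :
  mxsmoothn k A -> mxsmoothn k B -> mxsmoothn k (fun x => sylv (A x) (B x)).
Proof.
move=> sA sB i j.
rewrite (_ : (fun x => _) = fun x =>
  mxvec (A x *m vec_mx (delta_mx 0 i) + vec_mx (delta_mx 0 i) *m B x) 0 j).
  apply: mxsmoothn_mxvec; apply: mxsmoothnD; apply: mxsmoothnM => //;
    exact: mxsmoothn_cst.
by apply/funext => x; rewrite -mul_sylv vec_mxK -rowE [RHS]mxE.
Qed.

End Sylvester.

Lemma sylvester_identity (F : pzRingType) n (K K' G G' : 'M[F]_n) :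
  K' *m G *m (K' - K) + (K' - K) *m G *m K =
  K' *m G' *m K' - K *m G *m K - K' *m (G' - G) *m K'.
Proof.
rewrite !mulmxBr !mulmxBl addrA subrK opprB [RHS]addrC [RHS]addrA.
by rewrite subrK.
Qed.

Lemma continuous_squeeze {R : realType} (V : normedModType R) (f mu : V -> R) x0 :
  (forall x, `|f x0 - f x| <= mu x) -> mu x0 = 0 -> {for x0, continuous mu} ->
  {for x0, continuous f}.
Proof.
move=> hf mu0 cmu; apply/cvgrPdist_lt => e e0.
have /cvgrPdist_lt/(_ _ e0) := cmu; apply: filterS => x; rewrite mu0 sub0r normrN.
move=> h; apply: (le_lt_trans (hf x)); apply: le_lt_trans h; exact: ler_norm.
Qed.

Section GeometricMean.
Context {R : realType}.

(* A simultaneous diagonalization of [V] and [K], with [W] the inverse of [P]. *)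
Definition frame n (V G K P W : 'M[R[i]]_n) (r : 'rV[R]_n) : Prop :=
  [/\ P *m W = 1%:M, W *m P = 1%:M, V = ctr P *m P, G = W *m ctr W &
      (forall i, 0 < r 0 i <= 1) /\ K = ctr P *m diag_mx (complexmx r) *m P].

Lemma frame_abs1 n (V G K P W : 'M[R[i]]_n) (r : 'rV[R]_n) : frame V G K P W r ->
  mxabs1 K <= \sum_i \sum_j (complex.Re (V i i) + complex.Re (V j j)).
Proof.
move=> [_ _ -> _ [r01 ->]]; apply: ler_sum => i _; apply: ler_sum => j _.
have ReV k : complex.Re ((ctr P *m P) k k) = \sum_l sqr_abs (P l k).
  rewrite mxE; under eq_bigr => l _ do rewrite !mxE sqr_absE.
  by rewrite -rmorph_sum.
rewrite !ReV -big_split mul_mx_diag mxE.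
rewrite (le_trans (abs1_sum _ _ _))//; apply: ler_sum => l _.
rewrite !mxE (le_trans (abs1M _ _))// (le_trans (ler_wpM2r (abs1_ge0 _) (abs1M _ _)))//.
rewrite abs1_conj /=.
have -> : abs1 (r 0 l)%:C = r 0 l.
  by rewrite /abs1 /= normr0 addr0 ger0_norm// ltW//; case/andP: (r01 l).
have := abs1_sqr_le (P l i); have := abs1_sqr_le (P l j).
have := abs1_ge0 (P l i); have := abs1_ge0 (P l j); case/andP: (r01 l).
move: (abs1 _) (abs1 _) (sqr_abs _) (sqr_abs _) (r 0 l) => a b s t c c0 c1 a0 b0 ha hb.
have := sqr_ge0 (a - b); have : b * a * c <= b * a by rewrite ler_piMr// mulr_ge0.
nra.
Qed.

Lemma frame_sylvester n (V G K P W : 'M[R[i]]_n) (r : 'rV[R]_n) : frame V G K P W r ->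
  exists2 C : R, 0 <= C & forall (V' G' K' P' W' : 'M[R[i]]_n) (r' : 'rV[R]_n),
    frame V' G' K' P' W' r' -> forall X,
    mxabs1 X <= C * mxabs1 (K' *m G *m X + X *m G *m K).
Proof.
move=> [PW WP EV EG [r01 EK]].
have [c c0 cr] : exists2 c : R, 0 < c & forall i, c <= r 0 i.
  exists (\big[Order.min/1]_i r 0 i); last by move=> i; exact: bigmin_le.
  by apply/bigmin_gtP; split=> // i _; case/andP: (r01 i).
exists (mxabs1 (ctr P) * mxabs1 P * \sum_(i < n) \sum_(j < n)
          (2 / c * (mxabs1 (ctr W) * mxabs1 W))).
  apply: mulr_ge0; first by rewrite mulr_ge0// mxabs1_ge0.
  do 2 apply: sumr_ge0 => ? _.
  by rewrite mulr_ge0// ?divr_ge0// ?mulr_ge0// ?mxabs1_ge0// ltW.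
move=> V' G' K' P' W' r' [PW' WP' EV' EG' [r01' EK']] X.
pose E := K' *m G *m X + X *m G *m K; rewrite -/E.
pose Y := ctr W *m X *m W.
have WPc : ctr W *m ctr P = 1%:M by rewrite -ctrM PW ctr1.
have PWc : ctr P *m ctr W = 1%:M by rewrite -ctrM WP ctr1.
have EX : X = ctr P *m Y *m P.
  by rewrite /Y !mulmxA PWc mul1mx -mulmxA WP mulmx1.
have Ee : ctr W *m E *m W = ctr (P' *m W) *m diag_mx (complexmx r') *m (P' *m W) *m Y
    + Y *m diag_mx (complexmx r).
  rewrite /E mulmxDr mulmxDl EK' EK EG ctrM /Y; congr (_ + _); first by rewrite !mulmxA.
  rewrite !mulmxA -(mulmxA _ P W) PW mulmx1.
  by rewrite -(mulmxA _ (ctr W) (ctr P)) WPc mulmx1.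
have Yij i j : abs1 (Y i j) <= 2 / c * mxabs1 (ctr W *m E *m W).
  have h1 : c ^+ 2 * frob Y <= frob (ctr W *m E *m W).
    rewrite Ee; apply: sylvester_bound; [exact: ltW| |exact: cr].
    by move=> k; rewrite ltW//; case/andP: (r01' k).
  have h2 := frob_le (ctr W *m E *m W).
  have h3 := sqr_abs_le_frob Y i j; have h4 := abs1_sqr_le (Y i j).
  have m0 := mxabs1_ge0 (ctr W *m E *m W).
  rewrite mulrAC ler_pdivlMr//.
  rewrite -(@ler_pXn2r _ 2)// ?nnegrE ?mulr_ge0 ?abs1_ge0 ?(ltW c0)//.
  move: h1 h2 h3 h4 m0; move: (mxabs1 _) (frob _) (frob _) (sqr_abs _) (abs1 _).
  move=> m g f s y h1 h2 h3 h4 m0; rewrite !exprMn.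
  have c2 : 0 < c ^+ 2 by rewrite exprn_gt0.
  have h5 : y ^+ 2 * c ^+ 2 <= 2 * f * c ^+ 2 by rewrite ler_pM2r//; lra.
  have h6 : 2 * f * c ^+ 2 <= 2 * m ^+ 2.
    by rewrite -mulrA ler_pM2l// mulrC (le_trans h1 h2).
  apply: (le_trans h5); apply: (le_trans h6).
  by rewrite ler_wpM2r ?sqr_ge0// expr2 ler_peMr// ler1n.
have hY : mxabs1 Y <= (\sum_(i < n) \sum_(j < n)
    (2 / c * (mxabs1 (ctr W) * mxabs1 W))) * mxabs1 E.
  rewrite [leRHS]mulr_suml; apply: ler_sum => i _.
  rewrite [leRHS]mulr_suml; apply: ler_sum => j _; apply: (le_trans (Yij i j)).
  rewrite -[leRHS]mulrA ler_wpM2l ?divr_ge0 ?(ltW c0)// (le_trans (mxabs1M _ _))//.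
  by rewrite mulrAC ler_wpM2r ?mxabs1_ge0// mxabs1M.
rewrite [X in mxabs1 X <= _]EX.
rewrite (le_trans (mxabs1M _ _))// -[leRHS]mulrA [leRHS]mulrAC ler_wpM2r ?mxabs1_ge0//.
by rewrite (le_trans (mxabs1M _ _))// ler_wpM2l ?mxabs1_ge0.
Qed.

Lemma frame_sylv_unit n (V G K P W V' G' K' P' W' : 'M[R[i]]_n) (r r' : 'rV[R]_n) :
  frame V G K P W r -> frame V' G' K' P' W' r' ->
  sylv (K' *m G) (G *m K) \in unitmx.
Proof.
move=> fr fr'; apply: sylv_unit => X; rewrite mulmxA => X0.
have [C C0 /(_ _ _ _ _ _ _ fr' X)] := frame_sylvester fr.
rewrite X0 => H; apply/matrixP => i j; rewrite mxE.
have m0 : mxabs1 (0 : 'M[R[i]]_n) = 0.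
  by rewrite /mxabs1 big1// => k _; rewrite big1// => l _; rewrite mxE abs1_0.
rewrite m0 mulr0 in H.
have := le_trans (abs1_le_mxabs1 X i j) H; rewrite /abs1 => h.
apply/eqP; rewrite eq_complex -!normr_le0 /=.
by apply/andP; split; apply: le_trans h; rewrite ?lerDl ?lerDr.
Qed.

Context {m n : nat}.
Variables V G K S : 'rV[R]_m -> 'M[R[i]]_n.
Hypothesis sV : forall k, mxsmoothn k V.
Hypothesis sG : forall k, mxsmoothn k G.
Hypothesis sS : forall k, mxsmoothn k S.
Hypothesis fK : forall x, exists P W r, frame (V x) (G x) (K x) P W r.
Hypothesis KGK : forall x, K x *m G x *m K x = S x.

Let E x0 x := S x - S x0 - K x *m (G x - G x0) *m K x.

Lemma sylvester_increment x0 x :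
  K x *m G x0 *m (K x - K x0) + (K x - K x0) *m G x0 *m K x0 = E x0 x.
Proof.
by rewrite /E -!KGK; exact: sylvester_identity.
Qed.

Lemma geometric_mean_continuous : mxsmoothn 0 K.
Proof.
suff cK (x0 : 'rV[R]_m) i j :
  {for x0, continuous (fun x => complex.Re (K x i j))} /\
  {for x0, continuous (fun x => complex.Im (K x i j))}.
  by move=> i j; split=> x; have [] := cK x i j.
have [P [W [r fr]]] := fK x0; have [C C0 HC] := frame_sylvester fr.
pose kap x := \sum_i \sum_j (complex.Re (V x i i) + complex.Re (V x j j)).
have ckap : continuous kap.
  apply: continuous_sumr => k; apply: continuous_sumr => l x.
  by apply: continuousD; [have [h _] := sV 0 k k|have [h _] := sV 0 l l]; exact: h.
pose mu x := C * (mxabs1 (S x - S x0) + kap x * mxabs1 (G x - G x0) * kap x).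
have cmu : continuous mu.
  have cm (Z : 'rV[R]_m -> 'M[R[i]]_n) : (forall k, mxsmoothn k Z) -> continuous (fun x => mxabs1 (Z x - Z x0) : R).
    move=> sZ; apply: continuous_mxabs1; apply: mxsmoothnD; first exact: sZ.
    exact: mxsmoothn_cst.
  apply: (@smoothnM _ _ 0%N); first exact: (smoothn_cst 0%N C).
  apply: (@smoothnD _ _ 0%N); first exact: cm.
  exact: (@smoothnM _ _ 0%N _ _ (@smoothnM _ _ 0%N _ _ ckap (cm _ sG)) ckap).
have mx0 (A : 'M[R[i]]_n) : mxabs1 (A - A) = 0.
  by rewrite subrr /mxabs1 big1// => k _; rewrite big1// => l _; rewrite mxE abs1_0.
have mu0 : mu x0 = 0 by rewrite /mu !mx0 mulr0 mul0r addr0 mulr0.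
have bound x : mxabs1 (K x - K x0) <= mu x.
  have [P' [W' [r' fr']]] := fK x.
  apply: (le_trans (HC _ _ _ _ _ _ fr' _)); rewrite sylvester_increment.
  rewrite ler_wpM2l// /E (le_trans (mxabs1D _ _))// mxabs1N lerD2l.
  rewrite (le_trans (mxabs1M _ _))// ler_pM ?mxabs1_ge0//; last exact: frame_abs1 fr'.
  by rewrite (le_trans (mxabs1M _ _))// ler_wpM2r ?mxabs1_ge0//; exact: frame_abs1 fr'.
have squeeze (f : 'rV[R]_m -> R) : (forall x, `|f x0 - f x| <= mxabs1 (K x - K x0)) ->
    {for x0, continuous f}.
  move=> hf; apply: (continuous_squeeze _ mu0 (cmu x0)) => x.
  by apply: le_trans (hf x) (bound x).
split; apply: squeeze => x; apply: le_trans (abs1_le_mxabs1 _ i j);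
  rewrite !mxE distrC /abs1 ?cReD ?cImD ?cReN ?cImN; [by rewrite lerDl|by rewrite lerDr].
Qed.

(* [K - K x0] solves the linear equation of [sylvester_identity], whose right-hand
   side is differentiable and vanishes at [x0]. *)
Lemma geometric_mean_diff : mxdiff K.
Proof.
have cK := geometric_mean_continuous.
apply: vanish_mxdiff => x0.
have vE : mxvanish x0 (E x0).
  apply: mxvanishB; first exact: mxvanish_sub (mxsmoothn_diff (sS 1)).
  apply: mxvanishMr => //; apply: mxvanishMl => //.
  exact: mxvanish_sub (mxsmoothn_diff (sG 1)).
have [P [W [r fr]]] := fK x0.
pose L x := sylv (K x *m G x0) (G x0 *m K x0).
have uL x : L x \in unitmx.
  by have [P' [W' [r' fr']]] := fK x; exact: (frame_sylv_unit fr fr').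
have sL : mxsmoothn 0 (fun x => invmx (L x)).
  apply: mxsmoothn_inv => //; apply: mxsmoothn_sylv; last exact: mxsmoothn_cst.
  by apply: mxsmoothnM => //; exact: mxsmoothn_cst.
have EK : (fun x => K x - K x0) = fun x => vec_mx (mxvec (E x0 x) *m invmx (L x)).
  apply/funext => x; apply: (can_inj mxvecK); rewrite vec_mxK.
  by rewrite -sylvester_increment -(mulmxA (K x - K x0)) -mul_sylv mulmxK ?uL.
rewrite EK => i j.
have vZ : mxvanish x0 (fun x => mxvec (E x0 x) *m invmx (L x)).
  apply: mxvanishMr => // k l; rewrite (ord1 k); case/mxvec_indexP: l => k' l'.
  by under eq_fun do rewrite mxvecE; exact: vE.
by under eq_fun do rewrite mxE; exact: vZ.
Qed.

Lemma geometric_mean_smooth k : mxsmoothn k K.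
Proof.
have dK := geometric_mean_diff; have dG := mxsmoothn_diff (sG 1).
elim: k => [|k IH]; first exact: geometric_mean_continuous.
apply: mxsmoothnS => // a.
pose L x := sylv (K x *m G x) (G x *m K x).
have uL x : L x \in unitmx.
  by have [P [W [r fr]]] := fK x; exact: (frame_sylv_unit fr fr).
have EK : mxpd a K = fun x => vec_mx (mxvec (mxpd a S x - K x *m mxpd a G x *m K x)
    *m invmx (L x)).
  apply/funext => x; apply: (can_inj mxvecK); rewrite vec_mxK.
  have ES : mxpd a S x = (mxpd a K x *m G x + K x *m mxpd a G x) *m K x
      + K x *m G x *m mxpd a K x.
    rewrite -mxpdM// -mxpdM//; last exact: mxdiffM.
    by congr (mxpd a _ x); apply/funext => y; rewrite KGK.
  by rewrite ES mulmxDl addrAC addrK addrC -(mulmxA (mxpd a K x)) -mul_sylv mulmxK ?uL.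
rewrite EK; apply: mxsmoothn_vec_mx; apply: mxsmoothnM.
  apply: mxsmoothn_mxvec; apply: mxsmoothnD; first exact: mxsmoothn_pd (sS _).
  apply: mxsmoothnN; apply: mxsmoothnM => //; apply: mxsmoothnM => //.
  exact: mxsmoothn_pd (sG _).
by apply: mxsmoothn_inv => //; apply: mxsmoothn_sylv; apply: mxsmoothnM.
Qed.

End GeometricMean.

(** * Legendre duality *)

Section Coordinates.
Context {R : realType} {n : nat}.
Implicit Types (f h : 'rV[R]_n -> R) (a b : 'I_n).

Lemma diff_pd f x (v : 'rV[R]_n) : differentiable f x ->
  'd f x v = \sum_a v 0 a * pd a f x.
Proof.
move=> df; rewrite {1}(row_sum_delta v) linear_sum; apply: eq_bigr => a _.
by rewrite linearZ /= pd_diff.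
Qed.

Lemma is_derive_coord (a : 'I_n) (x v : 'rV[R]_n) :
  is_derive x v (fun y : 'rV[R]_n => y 0 a : R) (v 0 a).
Proof.
have C : h^-1 *: (((fun y : 'rV[R]_n => y 0 a : R) \o shift x) (h *: v) - x 0 a)
    @[h --> (0 : R)^'] --> v 0 a.
  apply/cvgrPdist_le => e e0; near=> h.
  have h0 : h != 0 by near: h; exact: nbhs_dnbhs_neq.
  rewrite /= !mxE addrK /GRing.scale /= mulrA mulVf// mul1r subrr normr0.
  exact: ltW.
apply: DeriveDef; first by apply/cvg_ex; exists (v 0 a); exact: C.
exact: cvg_lim C.
Unshelve. all: by end_near. Qed.

Lemma pd_coord b a : pd b (fun x : 'rV[R]_n => x 0 a) = fun=> (a == b)%:R.
Proof.
apply/funext => x; rewrite /pd (@derive_val _ _ _ _ _ _ _ (is_derive_coord _ _ _)).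
by rewrite mxE eqxx.
Qed.

Lemma smoothn_coord k a : smoothn k (fun x : 'rV[R]_n => x 0 a).
Proof.
case: k => [|k]; first by move=> x; exact: coord_continuous.
split=> [x|b]; first exact: differentiable_coord.
by rewrite pd_coord; exact: smoothn_cst.
Qed.

Lemma smoothn_sum k (I : Type) (r : seq I) (f : I -> 'rV[R]_n -> R) :
  (forall i, smoothn k (f i)) -> smoothn k (fun x => \sum_(i <- r) f i x).
Proof.
move=> sf; elim: r => [|i r IH].
  by under eq_fun do rewrite big_nil; exact: smoothn_cst.
by under eq_fun do rewrite big_cons; exact: smoothnD.
Qed.

Lemma pd_sum a (I : Type) (r : seq I) (f : I -> 'rV[R]_n -> R) x :
  (forall i, smoothn 1 (f i)) ->
  pd a (fun x => \sum_(i <- r) f i x) x = \sum_(i <- r) pd a (f i) x.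
Proof.
move=> sf; elim: r => [|i r IH].
  by under eq_fun do rewrite big_nil; rewrite pd_cst big_nil.
under eq_fun do rewrite big_cons; rewrite big_cons pdD ?IH//.
  exact: (sf i).1.
exact: (smoothn_sum r sf).1.
Qed.

Lemma pd_sqr_norm a (c : R) x :
  pd a (fun x : 'rV[R]_n => c * \sum_b x 0 b ^+ 2) x = 2 * c * x 0 a.
Proof.
have sc b : smoothn 1 (fun x : 'rV[R]_n => x 0 b * x 0 b).
  by apply: smoothnM; exact: smoothn_coord.
rewrite pdM; [|exact: differentiable_cst|]; last first.
  rewrite (_ : (fun x => _) = (fun x : 'rV[R]_n => \sum_b x 0 b * x 0 b)).
    exact: (smoothn_sum _ sc).1.
  by apply/funext => y; apply: eq_bigr => b _; rewrite expr2.
rewrite pd_cst mul0r add0r.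
rewrite (_ : (fun x => _) = (fun x : 'rV[R]_n => \sum_b x 0 b * x 0 b)); last first.
  by apply/funext => y; apply: eq_bigr => b _; rewrite expr2.
rewrite pd_sum// (bigD1 a)//= big1 => [|b ba].
  rewrite pdM; [|exact: differentiable_coord|exact: differentiable_coord].
  by rewrite pd_coord eqxx /=; ring.
rewrite pdM; [|exact: differentiable_coord|exact: differentiable_coord].
by rewrite pd_coord (negPf ba) /=; ring.
Qed.

Lemma smoothn_sqr_norm k (c : R) : smoothn k (fun x : 'rV[R]_n => c * \sum_b x 0 b ^+ 2).
Proof.
apply: smoothnM; first exact: smoothn_cst.
apply: smoothn_sum => b; under eq_fun do rewrite expr2.
by apply: smoothnM; exact: smoothn_coord.
Qed.

Lemma smoothn_vpot h k : smooth h -> smoothn k (vpot h).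
Proof. by move=> /smoothP sh; apply: smoothnD => //; exact: smoothn_sqr_norm. Qed.

Lemma pd_vpot h a : smooth h -> pd a (vpot h) = fun x => x 0 a + pd a h x.
Proof.
move=> /smoothP sh; apply/funext => x; rewrite pdD; last exact: (sh 1%N).1.
  by rewrite pd_sqr_norm mulfV// mul1r.
exact: (smoothn_sqr_norm 1 _).1.
Qed.

Lemma periodic_bounded f : continuous f -> Zperiodic f -> exists M : R, forall x, `|f x| <= M.
Proof.
move=> cf pf.
pose A := [set v : 'rV[R]_n | forall i, (`[0, 1]%classic : set R) (v ord0 i)].
have cA : compact A.
  apply: (@rV_compact _ _ (fun=> `[0, 1]%classic : set R)) => i.
  exact: segment_compact.
have A0 : A !=set0 by exists 0 => i /=; rewrite mxE in_itv /= lexx ler01.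
have cabs : {within A, continuous (fun x : 'rV[R]_n => `|f x| : R)}.
  have ca : continuous (fun x : 'rV[R]_n => `|f x| : R).
    by move=> x; apply: continuous_comp (cf x) _; exact: norm_continuous.
  exact: continuous_subspaceT ca.
have [c _ Hc] := EVT_max_rV A0 cA cabs.
exists `|f c| => x; pose k : 'rV[int]_n := \row_i (- Num.floor (x 0 i)).
rewrite -(pf x k); apply: Hc; rewrite inE => i /=; rewrite !mxE in_itv /=.
by rewrite rmorphN /= subr_ge0 floor_le lerBlDr ltW// (lt_le_trans (floorD1_gt _))// rmorphD addrC.
Qed.

Lemma Zperiodic_pd f a : Zperiodic f -> Zperiodic (pd a f).
Proof.
move=> pf x k; rewrite /pd -derive_translate; apply: eq_derive => y; exact: pf.
Qed.

Lemma smooth_lip f : smoothn 2 f -> Zperiodic f -> lip f.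
Proof.
move=> sf pf; have [df sdf] := sf.
have bd a : exists M : R, forall x, `|pd a f x| <= M.
  apply: periodic_bounded; last exact: Zperiodic_pd.
  exact: (@smoothn_continuous _ _ 1 _ (sdf a)).
have [M HM] := choice bd.
pose B := \sum_a `|M a|.
have MB a x : `|pd a f x| <= B.
  rewrite (le_trans (HM a x))// (le_trans (ler_norm _))// /B (bigD1 a)//= lerDl.
  by apply: sumr_ge0.
exists B => x y.
have [s _ E] := MVT_line (v := x - y) y (fun z => diff_derivable (df z)) ltr01.
rewrite scale1r [y + (x - y)]addrC subrK mul1r in E; rewrite E deriveE// diff_pd//.
rewrite (le_trans (ler_norm_sum _ _ _))// /dist1 mulr_sumr; apply: ler_sum => a _.
by rewrite normrM !mxE mulrC ler_wpM2r.
Qed.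

Lemma smooth_lip1 f : smoothn 3 f -> Zperiodic f -> lip1 f.
Proof.
move=> sf pf; have [df sdf] := sf; split=> //; first by apply: smooth_lip => //; exact: smoothnW.
move=> a; split=> [x|]; first exact: diff_derivable.
by apply: smooth_lip => //; exact: Zperiodic_pd.
Qed.

Lemma pd_comp_row a (f : 'rV[R]_n -> R) (phi : 'I_n -> 'rV[R]_n -> R) x :
  differentiable f (\row_b phi b x) -> (forall b, differentiable (phi b) x) ->
  pd a (fun x => f (\row_b phi b x)) x = \sum_b pd a (phi b) x * pd b f (\row_b phi b x).
Proof.
move=> df dphi.
have E : (fun x => \row_b phi b x) = \sum_b (fun x => phi b x *: delta_mx 0 b).
  apply/funext => y; rewrite fct_sumE (row_sum_delta (\row_b phi b y)).
  by apply: eq_bigr => b _; rewrite mxE.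
have drow : differentiable (fun x => \row_b phi b x) x.
  by rewrite E; apply: differentiable_sum => b; exact: differentiableZl.
rewrite pd_diff; last exact: differentiable_comp drow df.
rewrite (diff_comp drow df) /= diff_pd//; apply: eq_bigr => b _; congr (_ * _).
rewrite -deriveE// derive_mx; last exact: diff_derivable.
by rewrite mxE; apply: eq_derive => y; rewrite mxE.
Qed.

End Coordinates.

Section Legendre.
Context {R : realType} {n : nat}.
Variables h u : 'rV[R]_n -> R.
Hypothesis sh : smooth h.
Hypothesis ph : Zperiodic h.
Let v := vpot h.
Hypothesis uv : symplectic_potential v u.

Lemma pd_at_min (f : 'rV[R]_n -> R) c a : (forall x, differentiable f x) ->
  (forall x, f c <= f x) -> pd a f c = 0.
Proof.
move=> df fc; pose g (t : R) := f (c + t *: delta_mx 0 a).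
have dg (t : R) : is_derive t 1 g ('D_(delta_mx 0 a) f (c + t *: delta_mx 0 a)).
  by apply: is_derive_line; exact: diff_derivable.
have g0 : is_derive (0 : R) 1 g 0.
  apply: (@derive1_at_min _ g (-1) 1 0) => //.
  - by rewrite in_itv /= ltrN10 ltr01.
  - by move=> t _; rewrite /g scale0r addr0; exact: fc.
have [_ E] := dg 0; have [_ E0] := g0; move: E; rewrite E0 scale0r addr0.
exact: esym.
Qed.

(* [h] is bounded, so [v - <y, .>] is coercive; its gradient vanishes at a minimum. *)
Lemma grad_surjective y : exists x, grad v x = y.
Proof.
have [M HM] : exists M : R, forall x, `|h x| <= M.
  apply: periodic_bounded => //.
  by have /smoothP/(_ 0%N) := sh.
have M0 : 0 <= M := le_trans (normr_ge0 _) (HM 0).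
pose phi (x : 'rV[R]_n) := v x - \sum_a y 0 a * x 0 a.
have sphi : smoothn 1 phi.
  apply: smoothnD; first exact: smoothn_vpot.
  apply: smoothnN; apply: smoothn_sum => a; apply: smoothnM; first exact: smoothn_cst.
  exact: smoothn_coord.
pose Y := 2^-1 * \sum_a y 0 a ^+ 2.
have phiE x : phi x = 2^-1 * (\sum_a (x 0 a - y 0 a) ^+ 2) - Y + h x.
  rewrite /phi /v /vpot /Y addrAC; congr (_ + _).
  by rewrite !mulr_sumr -!sumrB; apply: eq_bigr => a _; field.
pose r := 2 * M + 1.
pose A := [set x : 'rV[R]_n | forall i,
  (`[y 0 i - r, y 0 i + r]%classic : set R) (x ord0 i)].
have cA : compact A.
  apply: (@rV_compact _ _ (fun i => `[y 0 i - r, y 0 i + r]%classic : set R)) => i.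
  exact: segment_compact.
have r0 : 0 <= r by rewrite addr_ge0// mulr_ge0.
have yA : A y by move=> i /=; rewrite in_itv /= lerBlDr !lerDl r0.
have [c _ Hc] := EVT_min_rV (ex_intro _ y yA) cA
  (continuous_subspaceT (@smoothn_continuous _ _ 1 _ sphi)).
have Hmin x : phi c <= phi x.
  have yA' : phi c <= phi y by apply: Hc; exact: mem_set.
  have [xA|xA] := pselect (A x); first by apply: Hc; exact: mem_set.
  have [i +] : exists i, ~ (`[y 0 i - r, y 0 i + r]%classic : set R) (x ord0 i).
    exact/existsNP.
  rewrite /= in_itv /= => /negP; rewrite -ler_distl -ltNge => xi.
  apply: (le_trans yA'); rewrite !phiE.
  have -> : \sum_a (y 0 a - y 0 a) ^+ 2 = 0.
    by apply: big1 => a _; rewrite subrr expr0n.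
  have h1 : r ^+ 2 <= \sum_a (x 0 a - y 0 a) ^+ 2.
    rewrite (bigD1 i)//= (le_trans (y := (x 0 i - y 0 i) ^+ 2))//.
      by rewrite -[leRHS]real_normK ?num_real// ler_pXn2r// ?nnegrE// ltW.
    by rewrite lerDl sumr_ge0// => a _; exact: sqr_ge0.
  have := HM x; have := HM y; rewrite !ler_norml => /andP[_ hy] /andP[hx _].
  move: h1; move: (\sum_a _) => s h1; rewrite mulr0.
  have : 4 * M <= r ^+ 2 by rewrite /r; nra.
  by move=> h2; lra.
exists c; apply/rowP => a; rewrite mxE.
have := pd_at_min a sphi.1 Hmin; rewrite pdD; first last.
- apply: (smoothnN _ : smoothn 1 _).1; apply: smoothn_sum => b.
  by apply: smoothnM; [exact: smoothn_cst|exact: smoothn_coord].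
- exact: (smoothn_vpot 1 sh).1.
rewrite pdN; last first.
  apply: (smoothn_sum _ _ : smoothn 1 _).1 => b.
  by apply: smoothnM; [exact: smoothn_cst|exact: smoothn_coord].
rewrite pd_sum; last by move=> b; apply: smoothnM; [exact: smoothn_cst|exact: smoothn_coord].
rewrite (bigD1 a)//= big1 ?addr0 => [|b ba].
  rewrite pdM; [|exact: differentiable_cst|exact: differentiable_coord].
  by rewrite pd_cst pd_coord eqxx /= mul0r add0r mulr1 => /eqP; rewrite subr_eq0 => /eqP.
rewrite pdM; [|exact: differentiable_cst|exact: differentiable_coord].
by rewrite pd_cst pd_coord (negPf ba) /= mul0r add0r mulr0.
Qed.

Lemma grad_gradu y : grad v (grad u y) = y.
Proof. by have [x <-] := grad_surjective y; have [_ /(_ x)[-> _]] := uv. Qed.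

Lemma Hess_legendre x : Hess v x *m Hess u (grad v x) = 1%:M.
Proof.
have [su uvx] := uv; have /smoothP {}su := su.
apply/matrixP => a c; rewrite mxE.
have dpv b : differentiable (pd b v) x by have [_ /(_ b)[]] := smoothn_vpot 2 sh.
have dpu : differentiable (pd c u) (grad v x) by have [_ /(_ c)[]] := su 2%N.
have := pd_comp_row a dpu dpv.
rewrite (_ : (fun x => _) = fun x : 'rV[R]_n => x 0 c); last first.
  by apply/funext => z; have [/rowP/(_ c)] := uvx z; rewrite mxE.
rewrite -[\row_b pd b v x]/(grad v x) pd_coord => E.
transitivity ((c == a)%:R : R); last by rewrite [RHS]mxE eq_sym.
have Hv b : Hess v x a b = pd a (pd b v) x by rewrite mxE.
have Hu b : Hess u (grad v x) b c = pd b (pd c u) (grad v x) by rewrite mxE.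
rewrite E; apply: eq_bigr => b _.
exact: (congr2 (fun s t : R => s * t) (Hv b) (Hu b)).
Qed.

Lemma pd_legendre (f fx : 'rV[R]_n -> R) c x : (forall x, f (grad v x) = fx x) ->
  differentiable fx x ->
  pd c f (grad v x) = \sum_d Hess u (grad v x) c d * pd d fx x.
Proof.
move=> ffx dfx; have [su uvx] := uv; have /smoothP {}su := su.
have Ef : f = fun y => fx (\row_b pd b u y).
  by apply/funext => y; rewrite -ffx -/(grad u y) grad_gradu.
have Ex : \row_b pd b u (grad v x) = x by have [] := uvx x.
rewrite {1}Ef pd_comp_row ?Ex//; last by move=> b; have [_ /(_ b)[]] := su 2%N.
by apply: eq_bigr => d _; rewrite mxE.
Qed.

Lemma Cpd_legendre (F Fx : 'rV[R]_n -> R[i]) c x : (forall x, F (grad v x) = Fx x) ->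
  cdifferentiable Fx ->
  Cpd c F (grad v x) = \sum_d (Hess u (grad v x) c d)%:C * Cpd d Fx x.
Proof.
move=> FFx [rF iF].
have cRe (I : Type) (r : seq I) (G : I -> R[i]) :
  complex.Re (\sum_(i <- r) G i) = \sum_(i <- r) complex.Re (G i).
  by elim/big_rec2: _ => // i a b _ <-; rewrite cReD.
have cIm (I : Type) (r : seq I) (G : I -> R[i]) :
  complex.Im (\sum_(i <- r) G i) = \sum_(i <- r) complex.Im (G i).
  by elim/big_rec2: _ => // i a b _ <-; rewrite cImD.
apply/eqP; rewrite eq_complex cRe cIm; apply/andP; split; apply/eqP.
  apply: etrans (pd_legendre c (fx := fun x => complex.Re (Fx x)) _ (rF x)) _.
    by move=> z; rewrite FFx.
  by apply: eq_bigr => d _; rewrite cReM /= mul0r subr0.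
apply: etrans (pd_legendre c (fx := fun x => complex.Im (Fx x)) _ (iF x)) _.
  by move=> z; rewrite FFx.
by apply: eq_bigr => d _; rewrite cImM /= mul0r addr0.
Qed.

End Legendre.

(** * Torus-invariant tensor calculus *)

Section InvariantCalculus.
Context {R : realType} {n : nat}.
Local Notation L := (lshift n).
Local Notation Rs := (rshift n).

Lemma split_l (a : 'I_n) : fintype.split (L a) = inl a.
Proof. exact: (unsplitK (inl a)). Qed.

Lemma split_r (a : 'I_n) : fintype.split (Rs a) = inr a.
Proof. exact: (unsplitK (inr a)). Qed.

Lemma derive_fst (F : Cspace R n -> R) (v : 'rV[R]_n) (z : Cspace R n) :
  'D_((v, 0) : 'rV[R]_n * 'rV[R]_n) F z = 'D_v (fun x => F (x, z.2)) z.1.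
Proof.
rewrite /derive.
suff -> : (fun h : R => h^-1 *: ((F \o shift z) (h *: ((v, 0) : 'rV[R]_n * 'rV[R]_n)) - F z))
  = (fun h : R => h^-1 *: (((fun x => F (x, z.2)) \o shift z.1) (h *: v) - F (z.1, z.2))).
  by [].
apply/funext => h /=; rewrite -surjective_pairing; congr (_ *: (F _ - _)).
by case: z => x w; congr pair; rewrite /= scaler0 add0r.
Qed.

Lemma derive_snd (F : Cspace R n -> R) (v : 'rV[R]_n) (z : Cspace R n) :
  'D_((0, v) : 'rV[R]_n * 'rV[R]_n) F z = 'D_v (fun w => F (z.1, w)) z.2.
Proof.
rewrite /derive.
suff -> : (fun h : R => h^-1 *: ((F \o shift z) (h *: ((0, v) : 'rV[R]_n * 'rV[R]_n)) - F z))
  = (fun h : R => h^-1 *: (((fun w => F (z.1, w)) \o shift z.2) (h *: v) - F (z.1, z.2))).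
  by [].
apply/funext => h /=; rewrite -surjective_pairing; congr (_ *: (F _ - _)).
by case: z => x w; congr pair; rewrite /= scaler0 add0r.
Qed.

Lemma dx_fst a (F : Cspace R n -> R[i]) z :
  dx a F z = Cpd a (fun x => F (x, z.2)) z.1.
Proof. by rewrite /dx /Cderive !derive_fst. Qed.

Lemma dw_snd a (F : Cspace R n -> R[i]) z :
  dw a F z = Cpd a (fun w => F (z.1, w)) z.2.
Proof. by rewrite /dw /Cderive !derive_snd. Qed.

Lemma dz_inv a (F : 'rV[R]_n -> R[i]) (z : Cspace R n) :
  dz a (fun z => F z.1) z = 2^-1 * Cpd a F z.1.
Proof. by rewrite /dz dx_fst dw_snd /= Cpd_cst mulr0 subr0. Qed.

Lemma dzbar_inv a (F : 'rV[R]_n -> R[i]) (z : Cspace R n) :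
  dzbar a (fun z => F z.1) z = 2^-1 * Cpd a F z.1.
Proof. by rewrite /dzbar dx_fst dw_snd /= Cpd_cst mulr0 addr0. Qed.

Definition base (k : 'I_(n + n)) : 'I_n :=
  match fintype.split k with inl a => a | inr a => a end.

Lemma base_l a : base (L a) = a. Proof. by rewrite /base split_l. Qed.
Lemma base_r a : base (Rs a) = a. Proof. by rewrite /base split_r. Qed.

Lemma pdframe_inv k (F : 'rV[R]_n -> R[i]) (z : Cspace R n) :
  pdframe k (fun z => F z.1) z = 2^-1 * Cpd (base k) F z.1.
Proof.
by rewrite /pdframe /base; case: fintype.split => a; [exact: dz_inv|exact: dzbar_inv].
Qed.

Opaque pd Cpd.

Variables V G : 'rV[R]_n -> 'M[R[i]]_n.
Hypothesis sV : forall k, mxsmoothn k V.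
Hypothesis sG : forall k, mxsmoothn k G.
Hypothesis VG : forall x, V x *m G x = 1%:M.
Hypothesis symV : forall x, (V x)^T = V x.
Hypothesis symV3 : forall a b c x, mxpd a V x b c = mxpd b V x a c.
Hypothesis realV : forall x, mxconj (V x) = V x.

Let H (z : Cspace R n) : 'M[R[i]]_n := V z.1.

Lemma GV x : G x *m V x = 1%:M. Proof. exact: mulmx1C (VG x). Qed.

Lemma symG x : (G x)^T = G x.
Proof.
have E : (G x)^T *m V x = 1%:M by rewrite -[V x]symV -trmx_mul VG trmx1.
by rewrite -[LHS]mulmx1 -(VG x) mulmxA E mul1mx.
Qed.

Lemma realG x : mxconj (G x) = G x.
Proof.
have E : V x *m mxconj (G x) = 1%:M.
  by rewrite -[V x]realV -mxconjM VG /mxconj map_mx1.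
by rewrite -[LHS]mul1mx -(GV x) -mulmxA E mulmx1.
Qed.

Lemma mxpd_G a x : mxpd a G x = - (G x *m mxpd a V x *m G x).
Proof.
have := mxpdM a x (mxsmoothn_diff (sG 1)) (mxsmoothn_diff (sV 1)).
rewrite (_ : (fun x => _ *m _) = fun=> 1%:M); last by apply/funext => y; exact: GV.
rewrite mxpd_cst => /esym/eqP; rewrite addr_eq0 => /eqP E.
by rewrite -[LHS]mulmx1 -(VG x) mulmxA E mulNmx.
Qed.

Lemma symV3' a b c x : mxpd a V x b c = mxpd a V x c b.
Proof. by rewrite !mxpdE; apply: eq_Cpd => y; rewrite -{1}symV mxE. Qed.

Lemma gmxE z : gmx H z = block_mx 0 (V z.1) (V z.1) 0.
Proof. by rewrite /gmx /H symV. Qed.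

Lemma ginvE z : ginv H z = block_mx 0 (G z.1) (G z.1) 0.
Proof.
rewrite /ginv gmxE; apply: mulmx1_inv.
by rewrite mulmx_block !mul0mx !mulmx0 !addr0 !add0r VG -scalar_mx_block.
Qed.

Lemma ginv_ll z a b : ginv H z (L a) (L b) = 0.
Proof. by rewrite ginvE block_mxEul mxE. Qed.
Lemma ginv_lr z a b : ginv H z (L a) (Rs b) = G z.1 a b.
Proof. by rewrite ginvE block_mxEur. Qed.
Lemma ginv_rl z a b : ginv H z (Rs a) (L b) = G z.1 a b.
Proof. by rewrite ginvE block_mxEdl. Qed.
Lemma ginv_rr z a b : ginv H z (Rs a) (Rs b) = 0.
Proof. by rewrite ginvE block_mxEdr mxE. Qed.

Lemma dgmx_ll k a b z : pdframe k (fun z => gmx H z (L a) (L b)) z = 0.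
Proof.
under eq_fun do rewrite gmxE block_mxEul mxE.
by rewrite (pdframe_inv k (fun=> 0)) Cpd_cst mulr0.
Qed.
Lemma dgmx_rr k a b z : pdframe k (fun z => gmx H z (Rs a) (Rs b)) z = 0.
Proof.
under eq_fun do rewrite gmxE block_mxEdr mxE.
by rewrite (pdframe_inv k (fun=> 0)) Cpd_cst mulr0.
Qed.
Lemma dgmx_lr k a b z :
  pdframe k (fun z => gmx H z (L a) (Rs b)) z = 2^-1 * mxpd (base k) V z.1 a b.
Proof.
under eq_fun do rewrite gmxE block_mxEur.
by rewrite (pdframe_inv k (fun x => V x a b)) mxpdE.
Qed.
Lemma dgmx_rl k a b z :
  pdframe k (fun z => gmx H z (Rs a) (L b)) z = 2^-1 * mxpd (base k) V z.1 a b.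
Proof.
under eq_fun do rewrite gmxE block_mxEdl.
by rewrite (pdframe_inv k (fun x => V x a b)) mxpdE.
Qed.

Definition chris a x : 'M[R[i]]_n := 2^-1 *: (G x *m mxpd a V x).

Definition chrismx (i : 'I_(n + n)) (x : 'rV[R]_n) : 'M[R[i]]_(n + n) :=
  match fintype.split i with
  | inl a => block_mx (chris a x) 0 0 0
  | inr a => block_mx 0 0 0 (chris a x)
  end.

Opaque pdframe gmx ginv.

Lemma GammaE k i j z : Gamma H k i j z = chrismx i z.1 k j.
Proof.
have half (x : R[i]) : 2^-1 * x + 2^-1 * x = x by field.
have perm a b d : mxpd b V z.1 a d = mxpd a V z.1 b d by rewrite symV3.
have rot a b d : mxpd d V z.1 a b = mxpd a V z.1 b d by rewrite (symV3 d) symV3'.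
rewrite /Gamma big_split_ord /= /chrismx.
case: (split_ordP k) => c ->; case: (split_ordP i) => a ->; case: (split_ordP j) => b ->;
  rewrite ?split_l ?split_r ?block_mxEul ?block_mxEur ?block_mxEdl ?block_mxEdr [RHS]mxE.
- rewrite big1 ?add0r => [|d _]; last by rewrite ginv_ll mul0r.
  congr (_ * _); rewrite mxE; apply: eq_bigr => d _.
  by rewrite ginv_lr !dgmx_lr dgmx_ll subr0 !base_l (perm a b d) half symV3'.
- rewrite big1 ?add0r => [|d _]; last by rewrite ginv_ll mul0r.
  rewrite big1 ?mulr0// => d _.
  by rewrite dgmx_rr !dgmx_lr !base_r (rot a b d) (perm a b d) add0r subrr mulr0.
- rewrite big1 ?add0r => [|d _]; last by rewrite ginv_ll mul0r.
  rewrite big1 ?mulr0// => d _.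
  by rewrite dgmx_rr dgmx_lr dgmx_rl !base_r (rot a b d) addr0 subrr mulr0.
- rewrite big1 ?add0r => [|d _]; last by rewrite ginv_ll mul0r.
  rewrite big1 ?mulr0// => d _.
  by rewrite !dgmx_rr subr0 addr0 mulr0.
- rewrite [X in _ + X]big1 ?addr0 => [|d _]; last by rewrite ginv_rr mul0r.
  rewrite big1 ?mulr0// => d _.
  by rewrite !dgmx_ll subr0 addr0 mulr0.
- rewrite [X in _ + X]big1 ?addr0 => [|d _]; last by rewrite ginv_rr mul0r.
  rewrite big1 ?mulr0// => d _.
  by rewrite dgmx_ll dgmx_lr dgmx_rl !base_l (rot a b d) addr0 subrr mulr0.
- rewrite [X in _ + X]big1 ?addr0 => [|d _]; last by rewrite ginv_rr mul0r.
  rewrite big1 ?mulr0// => d _.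
  by rewrite dgmx_ll !dgmx_rl !base_l (rot a b d) (perm a b d) add0r subrr mulr0.
- rewrite [X in _ + X]big1 ?addr0 => [|d _]; last by rewrite ginv_rr mul0r.
  congr (_ * _); rewrite mxE; apply: eq_bigr => d _.
  by rewrite ginv_rl !dgmx_rl dgmx_rr subr0 !base_r (perm a b d) half symV3'.
Qed.

Lemma nablaE i (Q : 'rV[R]_n -> 'M[R[i]]_(n + n)) z :
  nabla H i (fun z => Q z.1) z =
  2^-1 *: mxpd (base i) Q z.1 + chrismx i z.1 *m Q z.1 - Q z.1 *m chrismx i z.1.
Proof.
apply/matrixP => k j; rewrite !mxE (pdframe_inv i (fun x => Q x k j)).
congr (_ + _ - _).
- by apply: eq_bigr => l _; rewrite GammaE.
- by apply: eq_bigr => l _; rewrite GammaE mulrC.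
Qed.

Lemma mxpd_block (m1 m2 p1 p2 : nat) a (A : 'rV[R]_n -> 'M[R[i]]_(m1, p1))
    (B : 'rV[R]_n -> 'M[R[i]]_(m1, p2)) (C : 'rV[R]_n -> 'M[R[i]]_(m2, p1))
    (D : 'rV[R]_n -> 'M[R[i]]_(m2, p2)) x :
  mxpd a (fun x => block_mx (A x) (B x) (C x) (D x)) x =
  block_mx (mxpd a A x) (mxpd a B x) (mxpd a C x) (mxpd a D x).
Proof.
apply/matrixP => k j; rewrite mxpdE.
case: (split_ordP k) => k' ->; case: (split_ordP j) => j' ->.
- by rewrite block_mxEul mxpdE; apply: eq_Cpd => y; rewrite block_mxEul.
- by rewrite block_mxEur mxpdE; apply: eq_Cpd => y; rewrite block_mxEur.
- by rewrite block_mxEdl mxpdE; apply: eq_Cpd => y; rewrite block_mxEdl.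
- by rewrite block_mxEdr mxpdE; apply: eq_Cpd => y; rewrite block_mxEdr.
Qed.

Lemma mxpd0 (m p : nat) a x : mxpd a (fun _ : 'rV[R]_n => 0 : 'M[R[i]]_(m, p)) x = 0.
Proof. exact: mxpd_cst. Qed.

Lemma chrismx_l a x : chrismx (L a) x = block_mx (chris a x) 0 0 0.
Proof. by rewrite /chrismx split_l. Qed.
Lemma chrismx_r a x : chrismx (Rs a) x = block_mx 0 0 0 (chris a x).
Proof. by rewrite /chrismx split_r. Qed.

Lemma nabla_10_01_l c (A : 'rV[R]_n -> 'M[R[i]]_n) z :
  nabla H (L c) (ext10_01 (fun z => A z.1)) z =
  block_mx 0 0 (2^-1 *: mxpd c A z.1 - A z.1 *m chris c z.1) 0.
Proof.
rewrite /ext10_01 (nablaE _ (fun x => block_mx 0 0 (A x) 0)) mxpd_block !mxpd0.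
rewrite chrismx_l base_l scale_block_mx !mulmx_block !mul0mx !mulmx0 !addr0 !scaler0.
by rewrite opp_block_mx !add_block_mx !oppr0 !addr0.
Qed.

Lemma nabla_10_01_r c (A : 'rV[R]_n -> 'M[R[i]]_n) z :
  nabla H (Rs c) (ext10_01 (fun z => A z.1)) z =
  block_mx 0 0 (2^-1 *: mxpd c A z.1 + chris c z.1 *m A z.1) 0.
Proof.
rewrite /ext10_01 (nablaE _ (fun x => block_mx 0 0 (A x) 0)) mxpd_block !mxpd0.
rewrite chrismx_r base_r scale_block_mx !mulmx_block !mul0mx !mulmx0 !add0r ?addr0.
by rewrite !scaler0 opp_block_mx !add_block_mx !oppr0 !addr0.
Qed.

Lemma nabla_01_01_l c (A : 'rV[R]_n -> 'M[R[i]]_n) z :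
  nabla H (L c) (ext01_01 (fun z => A z.1)) z = block_mx 0 0 0 (2^-1 *: mxpd c A z.1).
Proof.
rewrite /ext01_01 (nablaE _ (fun x => block_mx 0 0 0 (A x))) mxpd_block !mxpd0.
rewrite chrismx_l base_l scale_block_mx !mulmx_block !mul0mx !mulmx0 !addr0.
by rewrite !scaler0 opp_block_mx !add_block_mx !oppr0 !addr0.
Qed.

Lemma nabla_01_01_r c (A : 'rV[R]_n -> 'M[R[i]]_n) z :
  nabla H (Rs c) (ext01_01 (fun z => A z.1)) z =
  block_mx 0 0 0 (2^-1 *: mxpd c A z.1 + chris c z.1 *m A z.1 - A z.1 *m chris c z.1).
Proof.
rewrite /ext01_01 (nablaE _ (fun x => block_mx 0 0 0 (A x))) mxpd_block !mxpd0.
rewrite chrismx_r base_r scale_block_mx !mulmx_block !mul0mx !mulmx0 !add0r.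
by rewrite !scaler0 opp_block_mx !add_block_mx !oppr0 !addr0.
Qed.

Definition dV (X : 'rV[R]_n -> 'cV[R[i]]_n) (x : 'rV[R]_n) : R[i] :=
  \sum_a (Cpd a (fun x => X x a 0) x + (G x *m mxpd a V x *m X x) a 0).

Lemma div_inv (X Y : 'rV[R]_n -> 'cV[R[i]]_n) z :
  div H (fun z => col_mx (X z.1) (Y z.1)) z = 2^-1 * (dV X z.1 + dV Y z.1).
Proof.
rewrite /div big_split_ord /= mulrDr; congr (_ + _).
  rewrite mulr_sumr; apply: eq_bigr => a _; rewrite mulrDr; congr (_ + _).
    under eq_fun do rewrite col_mxEu.
    by rewrite (pdframe_inv _ (fun x => X x a 0)) base_l.
  rewrite big_split_ord /= [X in _ + X]big1 => [|b _]; last first.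
    by rewrite GammaE chrismx_l block_mxEur mxE mul0r.
  rewrite addr0 mxE mulr_sumr; apply: eq_bigr => b _.
  by rewrite GammaE chrismx_l block_mxEul col_mxEu !mxE mulrA.
rewrite mulr_sumr; apply: eq_bigr => a _; rewrite mulrDr; congr (_ + _).
  under eq_fun do rewrite col_mxEd.
  by rewrite (pdframe_inv _ (fun x => Y x a 0)) base_r.
rewrite big_split_ord /= big1 => [|b _]; last first.
  by rewrite GammaE chrismx_r block_mxEdl mxE mul0r.
rewrite add0r mxE mulr_sumr; apply: eq_bigr => b _.
by rewrite GammaE chrismx_r block_mxEdr col_mxEd !mxE mulrA.
Qed.

Implicit Types (F : 'rV[R]_n -> R[i]) (Z : 'rV[R]_n -> 'M[R[i]]_n) (X Y : 'rV[R]_n -> 'cV[R[i]]_n).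

Definition Dy a (F : 'rV[R]_n -> R[i]) (x : 'rV[R]_n) : R[i] :=
  \sum_c G x a c * Cpd c F x.

Definition mxDy {m p} a (Z : 'rV[R]_n -> 'M[R[i]]_(m, p)) (x : 'rV[R]_n) :=
  \sum_c G x a c *: mxpd c Z x.

Definition xdiv (Z : 'rV[R]_n -> 'M[R[i]]_n) (x : 'rV[R]_n) : R[i] :=
  \sum_a \sum_b Dy b (Dy a (fun x => Z x a b)) x.

Definition rowdiv (Z : 'rV[R]_n -> 'M[R[i]]_n) (x : 'rV[R]_n) : 'cV[R[i]]_n :=
  \col_b \sum_a Dy a (fun x => Z x a b) x.

Lemma eq_Dy a F F' x : F =1 F' -> Dy a F x = Dy a F' x.
Proof. by move=> /funext ->. Qed.

Lemma csmoothn_Dy k a F : csmoothn k.+1 F -> csmoothn k (Dy a F).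
Proof.
move=> sF; apply: csmoothn_sum => c; apply: csmoothnM; first exact: sG.
exact: csmoothn_Cpd.
Qed.

Lemma mxsmoothn_rowdiv k Z : mxsmoothn k.+1 Z -> mxsmoothn k (rowdiv Z).
Proof.
move=> sZ b j; under eq_fun do rewrite mxE.
by apply: csmoothn_sum => a; apply: csmoothn_Dy; exact: sZ.
Qed.

Lemma CpdZ a c F x : csmoothn 1 F -> Cpd a (fun x => c * F x) x = c * Cpd a F x.
Proof.
move=> sF; rewrite CpdM; [|exact: csmoothn_diff (csmoothn_cst 1 c)|exact: csmoothn_diff sF].
by rewrite Cpd_cst mul0r add0r.
Qed.

Lemma Dy_sum b (I : Type) (r : seq I) (F : I -> 'rV[R]_n -> R[i]) x :
  (forall i, csmoothn 1 (F i)) ->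
  Dy b (fun x => \sum_(i <- r) F i x) x = \sum_(i <- r) Dy b (F i) x.
Proof.
move=> sF; rewrite /Dy exchange_big /=; apply: eq_bigr => c _.
by rewrite Cpd_sum ?mulr_sumr// => i; exact: csmoothn_diff (sF i).
Qed.

Lemma eq_dV X Y x : X =1 Y -> dV X x = dV Y x.
Proof. by move=> /funext ->. Qed.

Lemma dV0 x : dV (fun=> 0) x = 0.
Proof.
apply: big1 => a _; rewrite mulmx0 mxE addr0.
by rewrite -[RHS](congr1 (fun f => f x) (Cpd_cst a 0)); exact: eq_Cpd.
Qed.

Lemma dVD X Y x : mxsmoothn 1 X -> mxsmoothn 1 Y ->
  dV (fun x => X x + Y x) x = dV X x + dV Y x.
Proof.
move=> sX sY; rewrite -big_split /=; apply: eq_bigr => a _.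
have := mxpdD a x (mxsmoothn_diff sX) (mxsmoothn_diff sY) => /matrixP/(_ a 0).
rewrite mxpdE [RHS]mxE !mxpdE => ->.
by rewrite mulmxDr [X in _ + X]mxE addrACA.
Qed.

Lemma dVZ c X x : mxsmoothn 1 X -> dV (fun x => c *: X x) x = c * dV X x.
Proof.
move=> sX; rewrite mulr_sumr; apply: eq_bigr => a _.
rewrite mulrDr -scalemxAr [X in _ + X]mxE; congr (_ + _).
by rewrite -(CpdZ a c x (sX a 0)); apply: eq_Cpd => y; rewrite mxE.
Qed.

Lemma dV_G Y x : mxsmoothn 1 Y ->
  dV (fun x => G x *m Y x) x = \sum_a (G x *m mxpd a Y x) a 0.
Proof.
move=> sY; apply: eq_bigr => a _.
rewrite -mxpdE mxpdM; [|exact: mxsmoothn_diff (sG 1)|exact: mxsmoothn_diff sY].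
rewrite mxpd_G mulNmx !mulmxA [X in X + _]mxE [X in X + _ + _]mxE.
by rewrite addrAC addNr add0r.
Qed.

Lemma dV_rowdiv Z x : mxsmoothn 2 Z -> dV (fun x => G x *m rowdiv Z x) x = xdiv Z x.
Proof.
move=> sZ; rewrite dV_G; last exact: mxsmoothn_rowdiv.
under eq_bigr => a _ do rewrite mxE.
rewrite exchange_big /xdiv [RHS]exchange_big /=; apply: eq_bigr => b _.
rewrite -Dy_sum; last by move=> a; apply: csmoothn_Dy; exact: sZ.
apply: eq_bigr => c _; rewrite -[G x in LHS]symG mxE; congr (_ * _); rewrite mxpdE.
by apply: eq_Cpd => y; rewrite mxE.
Qed.

Hypothesis detV : forall x, 0 < \det (V x).

Let logdet x : R[i] := (ln (complex.Re (\det (V x))))%:C.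

Lemma detV_real x : (complex.Re (\det (V x)))%:C = \det (V x).
Proof. by have := detV x; rewrite ltcE /= => /andP[/eqP im0 _]; apply/eqP; rewrite eq_complex /= im0 !eqxx. Qed.

Lemma Re_detV_gt0 x : 0 < complex.Re (\det (V x)).
Proof. by have := detV x; rewrite ltcE /= => /andP[]. Qed.

Lemma adjV x : \adj (V x) = \det (V x) *: G x.
Proof.
by rewrite -[LHS]mulmx1 -(VG x) mulmxA mul_adj_mx mul_scalar_mx.
Qed.

Lemma csmoothn_logdet k : csmoothn k logdet.
Proof.
apply: csmoothn_real; apply: smoothn_ln; first exact: Re_detV_gt0.
by have [] := csmoothn_det (sV k).
Qed.

Lemma Cpd_logdet b x : Cpd b logdet x = \tr (G x *m mxpd b V x).
Proof.
have sdet : csmoothn 1 (fun x => \det (V x)) by apply: csmoothn_det; exact: sV.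
rewrite /logdet Cpd_real pd_ln ?Re_detV_gt0//; last by have [] := csmoothn_diff sdet.
rewrite rmorphM fmorphV /= detV_real -Cpd_real.
have -> : Cpd b (fun x => (complex.Re (\det (V x)))%:C) x = Cpd b (fun x => \det (V x)) x.
  by apply: eq_Cpd => y; exact: detV_real.
rewrite Cpd_det; last exact: sV.
have d0 : \det (V x) != 0 by rewrite gt_eqF.
by rewrite adjV -scalemxAr mxtraceZ mulrA mulVf// mul1r mxtrace_mulC.
Qed.

Lemma rowdiv_V x : rowdiv V x = \col_b Cpd b logdet x.
Proof.
apply/matrixP => b j; rewrite [LHS]mxE [RHS]mxE.
apply: etrans (esym (Cpd_logdet b x)); rewrite /mxtrace; apply: eq_bigr => a _.
rewrite mxE; apply: eq_bigr => c _; congr (_ * _); rewrite -mxpdE.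
by rewrite symV3 -symV3' symV3 symV3'.
Qed.

Lemma xdiv_V x : xdiv V x = \sum_a \sum_b G x a b * Cpd a (Cpd b logdet) x.
Proof.
rewrite -dV_rowdiv ?dV_G; [|exact: mxsmoothn_rowdiv|exact: sV].
apply: eq_bigr => a _; rewrite mxE; apply: eq_bigr => b _; congr (_ * _); rewrite mxpdE.
by apply: eq_Cpd => y; rewrite rowdiv_V mxE.
Qed.

Lemma RicciE z : Ricci H z = - 4^-1 *: \matrix_(a, b) Cpd a (Cpd b logdet) z.1.
Proof.
apply/matrixP => a b; rewrite mxE [RHS]mxE [X in _ * X]mxE mulNr; congr (- _).
have -> : dzbar b (fun z => (ln (complex.Re (\det (H z))))%:C) = fun z => 2^-1 * Cpd b logdet z.1.
  by apply/funext => w; exact: (dzbar_inv b logdet).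
rewrite (dz_inv a (fun x => 2^-1 * Cpd b logdet x)) CpdZ; last first.
  by apply: csmoothn_Cpd; exact: csmoothn_logdet.
by rewrite mulrA; congr (_ * _); field.
Qed.

Lemma omega_topE z : omega_top H z = n`!%:R * \det (V z.1).
Proof. exact: mixed_det_cst. Qed.

Lemma omega_top_neq0 z : omega_top H z != 0.
Proof.
by rewrite omega_topE mulf_neq0 ?pnatr_eq0 -?lt0n ?fact_gt0// gt_eqF.
Qed.

Lemma scalE z : scal H z = - 4^-1 * xdiv V z.1.
Proof.
have -> : scal H z = \tr (Ricci H z *m G z.1).
  have -> : scal H z = n`!%:R * \tr (Ricci H z *m \adj (V z.1)) / omega_top H z.
    by congr (_ / _); exact: mixed_det_first.
  rewrite adjV -scalemxAr mxtraceZ mulrA -omega_topE mulrAC divff ?mul1r//.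
  exact: omega_top_neq0.
have MC a b : (\matrix_(c, d) Cpd c (Cpd d logdet) z.1 : 'M[R[i]]_n) b a = Cpd a (Cpd b logdet) z.1.
  by apply: etrans (mxE _ _ _ _) _; apply: CpdC; exact: csmoothn_logdet.
rewrite RicciE xdiv_V; move: (\matrix_(c, d) _) MC => M MC.
rewrite -scalemxAl mxtraceZ mxtrace_mulC; congr (_ * _).
apply: eq_bigr => a _; rewrite mxE.
by apply: eq_bigr => b _; rewrite MC.
Qed.

Hypothesis perV : Zperiodic V.

Lemma perG : Zperiodic G.
Proof.
move=> x k; have := VG (x + map_mx intr k); rewrite perV => E.
by rewrite -[LHS]mul1mx -(GV x) -mulmxA E mulmx1.
Qed.

Lemma Zperiodic_Cpd a F : Zperiodic F -> Zperiodic (Cpd a F).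
Proof.
move=> pF x k; apply/eqP; rewrite eq_complex; apply/andP; split; apply/eqP.
  exact: (Zperiodic_pd a (f := fun x => complex.Re (F x)) (fun x k => congr1 _ (pF x k)) x k).
exact: (Zperiodic_pd a (f := fun x => complex.Im (F x)) (fun x k => congr1 _ (pF x k)) x k).
Qed.

Lemma det_dV X x : mxsmoothn 1 X ->
  \det (V x) * dV X x = \sum_a Cpd a (fun x => \det (V x) * X x a 0) x.
Proof.
move=> sX.
have sdet : csmoothn 1 (fun x => \det (V x)) by apply: csmoothn_det; exact: sV.
have CpdDet a : Cpd a (fun x => \det (V x)) x = \det (V x) * Cpd a logdet x.
  rewrite Cpd_det; last exact: sV.
  by rewrite Cpd_logdet adjV -scalemxAr mxtraceZ mxtrace_mulC.
have -> : dV X x = \sum_a (Cpd a (fun x => X x a 0) x + Cpd a logdet x * X x a 0).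
  rewrite /dV !big_split; congr (_ + _).
  transitivity (\sum_b \sum_a (G x *m mxpd a V x) a b * X x b 0).
    by rewrite exchange_big; apply: eq_bigr => a _; rewrite mxE.
  apply: eq_bigr => b _; rewrite -mulr_suml; congr (_ * _).
  apply: etrans (esym (Cpd_logdet b x)); rewrite /mxtrace; apply: eq_bigr => a _.
  rewrite mxE [RHS]mxE; apply: eq_bigr => c _; congr (_ * _).
  by rewrite symV3' symV3 symV3'.
rewrite mulr_sumr; apply: eq_bigr => a _.
rewrite CpdM; [|exact: csmoothn_diff sdet|exact: csmoothn_diff (sX a 0)].
by rewrite CpdDet mulrDr mulrA addrC.
Qed.

Lemma torus_int_div (Y : 'I_n -> 'rV[R]_n -> R[i]) :
  (forall a, csmoothn 3 (Y a)) -> (forall a, Zperiodic (Y a)) ->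
  torus_int (fun z : Cspace R n => \sum_a Cpd a (Y a) z.1) = 0.
Proof.
move=> sY pY.
have int0 (y : 'I_n -> 'rV[R]_n -> R) : (forall a, smoothn 3 (y a)) ->
    (forall a, Zperiodic (y a)) ->
    cube_int (fun x => cube_int (fun _ : 'rV[R]_n => \sum_a pd a (y a) x)) = 0.
  move=> sy py; under eq_fun do rewrite cube_int_cst.
  rewrite (cube_int_sum _ (F := fun a => pd a (y a))); last first.
    move=> a; apply: smooth_lip; first exact: smoothn_pd.
    exact: Zperiodic_pd.
  by apply: big1 => a _; apply: cube_int_pd; exact: smooth_lip1.
have ReS (I : Type) (r : seq I) (f : I -> R[i]) :
    complex.Re (\sum_(i <- r) f i) = \sum_(i <- r) complex.Re (f i).
  by apply: (big_morph _ cReD).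
have ImS (I : Type) (r : seq I) (f : I -> R[i]) :
    complex.Im (\sum_(i <- r) f i) = \sum_(i <- r) complex.Im (f i).
  by apply: (big_morph _ cImD).
rewrite /torus_int; apply/eqP; rewrite eq_complex /=; apply/andP; split; apply/eqP.
  rewrite -(int0 (fun a x => complex.Re (Y a x))).
  - by under eq_fun do under eq_fun do rewrite ReS.
  - by move=> a; have [] := sY a.
  - by move=> a x k; rewrite pY.
rewrite -(int0 (fun a x => complex.Im (Y a x))).
- by under eq_fun do under eq_fun do rewrite ImS.
- by move=> a; have [] := sY a.
- by move=> a x k; rewrite pY.
Qed.

Lemma Zperiodic2 (T1 T2 T3 : Type) (f : T1 -> T2 -> T3) (F1 : 'rV[R]_n -> T1) (F2 : 'rV[R]_n -> T2) :
  Zperiodic F1 -> Zperiodic F2 -> Zperiodic (fun x => f (F1 x) (F2 x)).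
Proof. by move=> p1 p2 x k; rewrite p1 p2. Qed.

Lemma scal_avgE : scal_avg H = 0.
Proof.
pose X x := G x *m \col_b Cpd b logdet x.
have sgl k : mxsmoothn k (fun x => \col_b Cpd b logdet x : 'cV[R[i]]_n).
  move=> b j; under eq_fun do rewrite mxE.
  by apply: csmoothn_Cpd; exact: csmoothn_logdet.
have sX k : mxsmoothn k X by apply: mxsmoothnM; [exact: sG|exact: sgl].
pose c : R[i] := - 4^-1 * n`!%:R.
have intE z : scal H z * omega_top H z =
    \sum_a Cpd a (fun x => c * (\det (V x) * X x a 0)) z.1.
  rewrite scalE omega_topE.
  have -> : xdiv V z.1 = dV X z.1.
    rewrite -dV_rowdiv; last exact: sV.
    by apply: eq_dV => y; rewrite rowdiv_V.
  rewrite mulrACA [X in _ * X]mulrC (det_dV _ (sX 1)) mulr_sumr; apply: eq_bigr => a _.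
  rewrite CpdZ//; apply: csmoothnM; last exact: sX.
  by apply: csmoothn_det; exact: sV.
pose Y a x := c * (\det (V x) * X x a 0).
have sY a : csmoothn 3 (Y a).
  apply: csmoothnM; first exact: csmoothn_cst.
  by apply: csmoothnM; [apply: csmoothn_det; exact: sV|exact: sX].
have pY a : Zperiodic (Y a).
  have plogdet : Zperiodic logdet by move=> x k; rewrite /logdet perV.
  have pgl : Zperiodic (fun x => \col_b Cpd b logdet x : 'cV[R[i]]_n).
    move=> x k; apply/matrixP => b j; rewrite [LHS]mxE [RHS]mxE.
    exact: Zperiodic_Cpd.
  have pX : Zperiodic X := Zperiodic2 mulmx perG pgl.
  exact (Zperiodic2 (fun (A : 'M[R[i]]_n) (v : 'cV[R[i]]_n) => c * (\det A * v a 0)) perV pX).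
have T0 : torus_int (fun z => scal H z * omega_top H z) = 0.
  apply: etrans (torus_int_div sY pY); congr torus_int; apply/funext => z; exact: intE.
by rewrite /scal_avg T0 mul0r.
Qed.

Variable q : 'rV[R]_n -> 'M[R[i]]_n.
Hypothesis sq : forall k, mxsmoothn k q.
Hypothesis symq : forall x, (q x)^T = q x.

Let A x := G x *m q x.
Let alpha (z : Cspace R n) := A z.1.

Lemma symq1 a x : (mxpd a q x)^T = mxpd a q x.
Proof.
by apply/matrixP => i j; rewrite mxE !mxpdE; apply: eq_Cpd => y; rewrite -{1}symq mxE.
Qed.

Lemma nabla_bar_alpha c z :
  nabla H (Rs c) (ext10_01 alpha) z = block_mx 0 0 (2^-1 *: (G z.1 *m mxpd c q z.1)) 0.
Proof.
rewrite (nabla_10_01_r c A); congr block_mx; rewrite /A /chris.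
rewrite mxpdM; [|exact: mxsmoothn_diff (sG 1)|exact: mxsmoothn_diff (sq 1)].
rewrite -scalemxAl -scalerDr; congr (_ *: _).
by rewrite mxpd_G mulNmx !mulmxA addrC addrA subrr add0r.
Qed.

Lemma dstarE z : dstar H alpha z = col_mx 0 (- 2^-1 *: (G z.1 *m rowdiv q z.1)).
Proof.
rewrite /dstar; congr col_mx; apply/matrixP => b j; rewrite !mxE (ord1 j) mulNr.
congr (- _); rewrite mulr_sumr.
under [RHS]eq_bigr => e _ do rewrite mxE mulr_sumr mulr_sumr.
rewrite [RHS]exchange_big /=; apply: eq_bigr => a _.
under [RHS]eq_bigr => e _ do rewrite /Dy mulr_sumr mulr_sumr.
rewrite [RHS]exchange_big /=; apply: eq_bigr => c _.
rewrite ginv_lr nabla_bar_alpha block_mxEdl !mxE mulr_sumr mulr_sumr.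
apply: eq_bigr => e _; rewrite -[mxpd c q _]symq1 mxE mxpdE; ring.
Qed.

Lemma div_dstar z : div H (dstar H alpha) z = - 4^-1 * xdiv q z.1.
Proof.
rewrite (_ : dstar H alpha = fun z =>
  col_mx 0 (- 2^-1 *: (G z.1 *m rowdiv q z.1))); last first.
  by apply/funext => w; exact: dstarE.
rewrite (div_inv (fun=> 0) (fun x => - 2^-1 *: (G x *m rowdiv q x))) dVZ; last first.
  by apply: mxsmoothnM => //; exact: mxsmoothn_rowdiv.
by rewrite dV_rowdiv// dV0; field.
Qed.

Let E a x := mxDy a V x.

(* The third derivatives of the symplectic potential are totally symmetric. *)
Lemma GEG a c e x : (G x *m E c x *m G x) a e = (G x *m E a x *m G x) c e.
Proof.
have expand a' c' : (G x *m E c' x *m G x) a' e =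
    \sum_g (\sum_f \sum_d G x a' f * G x c' d * mxpd d V x f g) * G x g e.
  rewrite mxE; apply: eq_bigr => g _; congr (_ * _); rewrite mxE.
  apply: eq_bigr => f _; rewrite /E /mxDy summxE mulr_sumr.
  by apply: eq_bigr => d _; rewrite mxE mulrA.
rewrite !expand; apply: eq_bigr => g _; congr (_ * _).
rewrite exchange_big /=; apply: eq_bigr => f _; apply: eq_bigr => d _.
by rewrite (symV3 f) (mulrC (G x a d)).
Qed.

Lemma symE a x : (E a x)^T = E a x.
Proof.
apply/matrixP => i j; rewrite mxE /E /mxDy !summxE.
by apply: eq_bigr => c _; rewrite mxE [RHS]mxE symV3'.
Qed.

Lemma symGEG a x : (G x *m E a x *m G x)^T = G x *m E a x *m G x.
Proof. by rewrite !trmx_mul symE symG mulmxA. Qed.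

Lemma mxDyE m p a (Z : 'rV[R]_n -> 'M[R[i]]_(m, p)) x i j :
  mxDy a Z x i j = Dy a (fun x => Z x i j) x.
Proof. by rewrite /mxDy summxE; apply: eq_bigr => c _; rewrite mxE mxpdE. Qed.

Lemma mxDy_G a x : mxDy a G x = - (G x *m E a x *m G x).
Proof.
rewrite /mxDy /E /mxDy mulmx_sumr mulmx_suml -sumrN; apply: eq_bigr => c _.
by rewrite mxpd_G scalerN -scalemxAr -scalemxAl.
Qed.

Lemma mxDyM (m p r : nat) a (Z : 'rV[R]_n -> 'M[R[i]]_(m, p))
    (W : 'rV[R]_n -> 'M[R[i]]_(p, r)) x : mxsmoothn 1 Z -> mxsmoothn 1 W ->
  mxDy a (fun x => Z x *m W x) x = mxDy a Z x *m W x + Z x *m mxDy a W x.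
Proof.
move=> sZ sW; rewrite /mxDy mulmx_suml mulmx_sumr -big_split /=.
apply: eq_bigr => c _; rewrite mxpdM; [|exact: mxsmoothn_diff sZ|exact: mxsmoothn_diff sW].
by rewrite scalerDr scalemxAl scalemxAr.
Qed.

Lemma Dy_comm a b F x : csmoothn 2 F -> Dy a (Dy b F) x = Dy b (Dy a F) x.
Proof.
move=> sF.
have expand a' b' : Dy a' (Dy b' F) x = \sum_d mxDy a' G x b' d * Cpd d F x
    + \sum_c \sum_d G x a' c * G x b' d * Cpd c (Cpd d F) x.
  have -> : \sum_d mxDy a' G x b' d * Cpd d F x =
      \sum_c \sum_d G x a' c * mxpd c G x b' d * Cpd d F x.
    rewrite exchange_big /=; apply: eq_bigr => d _; rewrite mxDyE /Dy mulr_suml.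
    by apply: eq_bigr => c _; rewrite mxpdE.
  rewrite -big_split; apply: eq_bigr => c _.
  rewrite Cpd_sum; last first.
    move=> d; apply: (csmoothn_diff (k := 0)); apply: csmoothnM; first exact: sG.
    exact: csmoothn_Cpd.
  rewrite mulr_sumr -big_split; apply: eq_bigr => d _.
  rewrite CpdM; [|exact: csmoothn_diff (sG 1 _ _)|exact: csmoothn_diff (csmoothn_Cpd d sF)].
  by rewrite mulrDr !mulrA mxpdE.
rewrite !expand; congr (_ + _).
  by apply: eq_bigr => d _; rewrite !mxDy_G [in LHS]mxE [in RHS]mxE GEG.
rewrite [RHS]exchange_big /=; apply: eq_bigr => c _; apply: eq_bigr => d _.
by rewrite CpdC// (mulrC (G x b d)).
Qed.

Lemma xdiv_tr Z x : mxsmoothn 2 Z -> xdiv (fun x => (Z x)^T) x = xdiv Z x.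
Proof.
move=> sZ.
have Zba a b (y : 'rV[R]_n) : (Z y)^T b a = Z y a b by rewrite mxE.
have DZ a b : Dy b (fun x => (Z x)^T b a) = Dy b (fun x => Z x a b).
  by apply/funext => y; apply: eq_Dy => z; exact: Zba.
have step a b : Dy a (Dy b (fun x => (Z x)^T b a)) x = Dy b (Dy a (fun x => Z x a b)) x.
  by rewrite DZ; apply: Dy_comm; exact: sZ.
have exch (F : 'I_n -> 'I_n -> R[i]) : \sum_a \sum_b F a b = \sum_b \sum_a F a b.
  exact: exchange_big.
apply: etrans (exch (fun a b => Dy b (Dy a (fun x => (Z x)^T a b)) x)) _.
exact: (eq_bigr _ (fun a _ => eq_bigr _ (fun b _ => step a b))).
Qed.

Lemma gpair_10_01 (P Q : @endfield R n) z (A1 B1 : 'M[R[i]]_n) :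
  P z = block_mx 0 0 A1 0 -> Q z = block_mx 0 B1 0 0 ->
  gpair H P Q z = \tr (V z.1 *m B1 *m G z.1 *m A1^T).
Proof.
move=> PE QE.
have Pr k i : P z k (Rs i) = 0.
  by rewrite PE; case: (split_ordP k) => k' ->; rewrite ?block_mxEur ?block_mxEdr mxE.
have Pll k i : P z (L k) (L i) = 0 by rewrite PE block_mxEul mxE.
have Pdl k i : P z (Rs k) (L i) = A1 k i by rewrite PE block_mxEdl.
have Qdr k i : Q z (Rs k) (Rs i) = 0 by rewrite QE block_mxEdr mxE.
have Qur k i : Q z (L k) (Rs i) = B1 k i by rewrite QE block_mxEur.
have gdl k l : gmx H z (Rs k) (L l) = V z.1 k l by rewrite gmxE block_mxEdl.
transitivity (\sum_i \sum_j \sum_k \sum_l G z.1 i j * V z.1 k l * A1 k i * B1 l j).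
  rewrite /gpair big_split_ord /= [X in _ + X]big1 ?addr0; last first.
    move=> i _; apply: big1 => j _; apply: big1 => k _; apply: big1 => l _.
    by rewrite Pr mulr0 mul0r.
  apply: eq_bigr => i _; rewrite big_split_ord /= big1 ?add0r; last first.
    move=> j _; apply: big1 => k _; apply: big1 => l _.
    by rewrite ginv_ll !mul0r.
  apply: eq_bigr => j _; rewrite big_split_ord /= big1 ?add0r; last first.
    by move=> k _; apply: big1 => l _; rewrite Pll mulr0 mul0r.
  apply: eq_bigr => k _; rewrite big_split_ord /= [X in _ + X]big1 ?addr0; last first.
    by move=> l _; rewrite Qdr mulr0.
  by apply: eq_bigr => l _; rewrite ginv_lr gdl Pdl Qur.
rewrite /mxtrace exchange_big /=.
have -> : \sum_i (V z.1 *m B1 *m G z.1 *m A1^T) i i =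
    \sum_k \sum_i \sum_j \sum_l V z.1 k l * B1 l j * G z.1 j i * A1 k i.
  apply: eq_bigr => k _; rewrite mxE; apply: eq_bigr => i _.
  rewrite mxE [X in _ * X]mxE mulr_suml; apply: eq_bigr => j _.
  by rewrite mxE !mulr_suml.
under eq_bigr => j _ do rewrite exchange_big.
rewrite exchange_big /=; apply: eq_bigr => k _; rewrite exchange_big /=.
apply: eq_bigr => i _; apply: eq_bigr => j _; apply: eq_bigr => l _.
have -> : G z.1 j i = G z.1 i j by rewrite -{1}symG mxE.
ring.
Qed.

Lemma sum_block_dl (F : 'I_n -> 'M[R[i]]_n) :
  \sum_c block_mx 0 0 (F c) 0 = block_mx 0 0 (\sum_c F c) 0 :> 'M[R[i]]_(n + n).
Proof.
elim/big_ind2: _ => [|X1 X2 Y1 Y2 -> ->|//]; first by rewrite block_mx0.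
by rewrite add_block_mx !addr0.
Qed.

Lemma nabla_up_l a z :
  nabla_up H (L a) (ext10_01 alpha) z = block_mx 0 0 (2^-1 *: (G z.1 *m mxDy a q z.1)) 0.
Proof.
rewrite /nabla_up big_split_ord /= big1 ?add0r; last first.
  by move=> c _; rewrite ginv_ll scale0r.
have -> : block_mx 0 0 (2^-1 *: (G z.1 *m mxDy a q z.1)) 0 =
    \sum_c G z.1 a c *: block_mx 0 0 (2^-1 *: (G z.1 *m mxpd c q z.1)) 0 :> 'M[R[i]]_(n + n).
  rewrite /mxDy mulmx_sumr scaler_sumr.
  rewrite -sum_block_dl; apply: eq_bigr => c _.
  by rewrite scale_block_mx !scaler0 -scalemxAr !scalerA mulrC.
by apply: eq_bigr => c _; rewrite ginv_lr nabla_bar_alpha.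
Qed.

Lemma nabla_up_r a z :
  nabla_up H (Rs a) (ext10_01 alpha) z =
  block_mx 0 0 (2^-1 *: (G z.1 *m mxDy a q z.1 - G z.1 *m E a z.1 *m G z.1 *m q z.1
    - G z.1 *m q z.1 *m G z.1 *m E a z.1)) 0.
Proof.
rewrite /nabla_up big_split_ord /= [X in _ + X]big1 ?addr0; last first.
  by move=> c _; rewrite ginv_rr scale0r.
transitivity (\sum_c block_mx 0 0 (G z.1 a c *: (2^-1 *: mxpd c A z.1 - A z.1 *m chris c z.1)) 0
    : 'M[R[i]]_(n + n)).
  by apply: eq_bigr => c _; rewrite ginv_rl (nabla_10_01_l c A) scale_block_mx !scaler0.
rewrite sum_block_dl; congr block_mx.
have -> : G z.1 *m mxDy a q z.1 - G z.1 *m E a z.1 *m G z.1 *m q z.1 = mxDy a A z.1.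
  by rewrite mxDyM; [rewrite mxDy_G mulNmx addrC|exact: sG|exact: sq].
rewrite /mxDy /E /mxDy mulmx_sumr -sumrB scaler_sumr; apply: eq_bigr => c _.
by rewrite /chris /A -!scalemxAr !scalerBr !scalerA !mulmxA (mulrC 2^-1).
Qed.

Variables B N : 'rV[R]_n -> 'M[R[i]]_n.
Hypothesis sB : forall k, mxsmoothn k B.
Hypothesis sN : forall k, mxsmoothn k N.
Hypothesis ahatE : forall z, ahat alpha z = B z.1.
Hypothesis NE : forall x, q x *m G x *m mxconj (q x) *m B x = N x.
Hypothesis hermN : forall x, (N x)^T = mxconj (N x).
Hypothesis conjNE : forall x, mxconj (q x) *m B x *m G x *m q x = mxconj (N x).

Let p a x := 2^-1 * \tr (mxconj (q x) *m B x *m G x *m mxDy a q x *m G x).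
Let s a x := \tr (G x *m E a x *m G x *m N x).

Lemma symqDy a x : (mxDy a q x)^T = mxDy a q x.
Proof.
by rewrite /mxDy linear_sum /=; apply: eq_bigr => c _; rewrite linearZ /= symq1.
Qed.

Let Bext := @ext01_10 R n (fun z => mxconj (alpha z) *m ahat alpha z).

Lemma BextE z : Bext z = block_mx 0 (G z.1 *m mxconj (q z.1) *m B z.1) 0 0.
Proof. by rewrite /Bext /ext01_10 ahatE /alpha /A mxconjM realG. Qed.

Lemma VBE x : V x *m (G x *m mxconj (q x) *m B x) = mxconj (q x) *m B x.
Proof. by rewrite !mulmxA VG mul1mx. Qed.

Lemma gpair_l a z :
  gpair H (nabla_up H (L a) (ext10_01 alpha)) Bext z = p a z.1.
Proof.
rewrite (gpair_10_01 (nabla_up_l a z) (BextE z)) VBE linearZ /= trmx_mul symG symqDy.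
by rewrite -scalemxAr mxtraceZ !mulmxA.
Qed.

Lemma s_conj a x : \tr (mxconj (N x) *m (G x *m E a x *m G x)) = s a x.
Proof. by rewrite -mxtrace_tr trmx_mul symGEG -hermN trmxK. Qed.

Lemma gpair_r a z :
  gpair H (nabla_up H (Rs a) (ext10_01 alpha)) Bext z = p a z.1 - s a z.1.
Proof.
rewrite (gpair_10_01 (nabla_up_r a z) (BextE z)) VBE.
have -> : (2^-1 *: (G z.1 *m mxDy a q z.1 - G z.1 *m E a z.1 *m G z.1 *m q z.1
      - G z.1 *m q z.1 *m G z.1 *m E a z.1))^T =
    2^-1 *: (mxDy a q z.1 *m G z.1 - q z.1 *m G z.1 *m E a z.1 *m G z.1
      - E a z.1 *m G z.1 *m q z.1 *m G z.1).
  have trZ c (X : 'M[R[i]]_n) : (c *: X)^T = c *: X^T by apply/matrixP => k l; rewrite !mxE.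
  rewrite trZ; congr (_ *: _).
  have trB (X Y : 'M[R[i]]_n) : (X - Y)^T = X^T - Y^T by rewrite linearB.
  by rewrite !trB !trmx_mul symG symqDy symE symq !mulmxA.
rewrite -scalemxAr mxtraceZ !mulmxBr.
have trB (X Y : 'M[R[i]]_n) : \tr (X - Y) = \tr X - \tr Y by rewrite linearB.
have E1 : \tr (mxconj (q z.1) *m B z.1 *m G z.1 *m (q z.1 *m G z.1 *m E a z.1 *m G z.1))
    = s a z.1.
  by rewrite !mulmxA conjNE -!mulmxA (mulmxA (G z.1)) s_conj.
have E2 : \tr (mxconj (q z.1) *m B z.1 *m G z.1 *m (E a z.1 *m G z.1 *m q z.1 *m G z.1))
    = s a z.1.
  by rewrite -(mulmxA _ (G z.1)) mxtrace_mulC /s -NE !mulmxA.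
have E3 : 2^-1 * \tr (mxconj (q z.1) *m B z.1 *m G z.1 *m (mxDy a q z.1 *m G z.1)) = p a z.1.
  by rewrite mulmxA.
have gen (X Y Z : 'M[R[i]]_n) : 2^-1 * \tr X = p a z.1 -> \tr Y = s a z.1 ->
    \tr Z = s a z.1 -> 2^-1 * \tr (X - Y - Z) = p a z.1 - s a z.1.
  by move=> EX EY EZ; rewrite !trB !mulrBr EX EY EZ; field.
exact: gen E3 E1 E2.
Qed.

Let T x := G x *m N x.

Lemma mxsmoothn_mxDy m r k a (Z : 'rV[R]_n -> 'M[R[i]]_(m, r)) :
  mxsmoothn k.+1 Z -> mxsmoothn k (mxDy a Z).
Proof.
move=> sZ i j; rewrite (_ : (fun x => _) = Dy a (fun x => Z x i j)); last first.
  by apply/funext => x; rewrite mxDyE.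
by apply: csmoothn_Dy; exact: sZ.
Qed.

Lemma conj_Dy a F x : csmoothn 1 F -> conjc (Dy a F x) = Dy a (fun x => conjc (F x)) x.
Proof.
move=> sF; rewrite /Dy rmorph_sum; apply: eq_bigr => c _.
rewrite rmorphM (Cpd_conj c x (csmoothn_diff sF)).
have hG : conjc (G x a c) = G x a c by have := realG x => /matrixP/(_ a c); rewrite mxE.
by rewrite [X in X * _]hG.
Qed.

Lemma conj_rowdiv Z x : mxsmoothn 1 Z -> mxconj (rowdiv Z x) = rowdiv (fun x => mxconj (Z x)) x.
Proof.
move=> sZ; apply/matrixP => b j; rewrite mxE mxE [RHS]mxE rmorph_sum.
apply: eq_bigr => a _; apply: etrans (conj_Dy a x (sZ a b)) _.
by apply: eq_Dy => y; rewrite mxE.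
Qed.

Let sv x : 'cV[R[i]]_n := \col_a s a x.
Let pv x : 'cV[R[i]]_n := \col_a p a x.

Lemma nabla_starE z :
  nabla_star H (ext01_01 (fun z => T z.1)) z =
  col_mx 0 (- 2^-1 *: (G z.1 *m rowdiv (fun x => (N x)^T) z.1 - sv z.1)).
Proof.
have -> : G z.1 *m rowdiv (fun x => (N x)^T) z.1 - sv z.1 = \col_b \sum_c mxDy c T z.1 b c.
  apply/matrixP => b j; rewrite [RHS]mxE.
  have TE c : mxDy c T z.1 = G z.1 *m mxDy c N z.1 - G z.1 *m E c z.1 *m G z.1 *m N z.1.
    by rewrite mxDyM; [rewrite mxDy_G mulNmx addrC|exact: sG|exact: sN].
  have TEb c : mxDy c T z.1 b c = (G z.1 *m mxDy c N z.1) b c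
      - (G z.1 *m E c z.1 *m G z.1 *m N z.1) b c.
    by rewrite TE mxE [X in _ + X]mxE.
  under eq_bigr => c _ do rewrite TEb.
  rewrite sumrB mxE [X in _ + X]mxE mxE; congr (_ - _).
    under [RHS]eq_bigr => c _ do rewrite mxE.
    rewrite [RHS]exchange_big; apply: eq_bigr => d _ /=.
    rewrite mxE mulr_sumr; apply: eq_bigr => c _; congr (_ * _).
    by rewrite mxDyE; apply: eq_Dy => y; rewrite mxE.
  rewrite mxE /s /mxtrace; apply: eq_bigr => c _; rewrite [in LHS]mxE [in RHS]mxE.
  by apply: eq_bigr => e _; rewrite GEG.
have sumE (k : 'I_(n + n)) :
    \sum_i \sum_j ginv H z i j * nabla H i (ext01_01 (fun z => T z.1)) z k j =
    2^-1 * \sum_a \sum_b G z.1 a b * block_mx 0 0 0 (mxpd a T z.1) k (Rs b).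
  have zr (M : 'M[R[i]]_n) a : block_mx 0 0 0 M k (L a) = 0 :> R[i].
    by case: (split_ordP k) => k' ->; rewrite ?block_mxEul ?block_mxEdl mxE.
  rewrite big_split_ord /= [X in _ + X]big1 ?addr0; last first.
    move=> i _; rewrite big_split_ord /= !big1 ?addr0// => c _; first by rewrite ginv_rr mul0r.
    by rewrite (nabla_01_01_r i T) zr mulr0.
  rewrite mulr_sumr; apply: eq_bigr => a _; rewrite big_split_ord /= big1 ?add0r; last first.
    by move=> c _; rewrite ginv_ll mul0r.
  rewrite mulr_sumr; apply: eq_bigr => b _; rewrite ginv_lr (nabla_01_01_l a T).
  have -> : block_mx 0 0 0 (2^-1 *: mxpd a T z.1) =
      2^-1 *: block_mx 0 0 0 (mxpd a T z.1) :> 'M[R[i]]_(n + n).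
    by rewrite scale_block_mx !scaler0.
  by rewrite [X in _ * X]mxE mulrCA.
apply/matrixP => k j; rewrite mxE sumE.
case: (split_ordP k) => k' ->; rewrite ?col_mxEu ?col_mxEd [RHS]mxE.
  rewrite big1 ?mulr0 ?oppr0// => a _; apply: big1 => b _.
  by rewrite block_mxEur mxE mulr0.
rewrite mxE -mulNr; congr (_ * _); rewrite exchange_big; apply: eq_bigr => b _ /=.
rewrite mxDyE /Dy; apply: eq_bigr => a _; rewrite block_mxEdr mxpdE.
by rewrite -{1}symG mxE.
Qed.

Lemma bar_l (a : 'I_n) : bar (L a) = Rs a. Proof. by rewrite /bar split_l. Qed.
Lemma bar_r (a : 'I_n) : bar (Rs a) = L a. Proof. by rewrite /bar split_r. Qed.

Let rho x : 'cV[R[i]]_n := pv x - mxconj (pv x).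

Lemma XfieldE z : Xfield H alpha z =
  col_mx (rho z.1 + G z.1 *m rowdiv N z.1) (- rho z.1 + G z.1 *m rowdiv (fun x => (N x)^T) z.1).
Proof.
have QE : ext01_01 (fun z => aabar alpha z *m ahat alpha z) = ext01_01 (fun z => T z.1).
  apply/funext => w; rewrite /ext01_01; congr block_mx.
  by rewrite ahatE /aabar /alpha /A mxconjM realG /T -NE !mulmxA.
have WE w : col_mx (\col_(a < n) gpair H (nabla_up H (L a) (ext10_01 alpha)) Bext w)
      (\col_(b < n) - gpair H (nabla_up H (Rs b) (ext10_01 alpha)) Bext w)
    - 2 *: nabla_star H (ext01_01 (fun z => aabar alpha z *m ahat alpha z)) w =
    col_mx (pv w.1) (- pv w.1 + G w.1 *m rowdiv (fun x => (N x)^T) w.1).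
  have E1 : \col_(a < n) gpair H (nabla_up H (L a) (ext10_01 alpha)) Bext w = pv w.1.
    by apply/matrixP => a j; rewrite mxE [RHS]mxE; exact: gpair_l.
  have E2 : \col_(b < n) - gpair H (nabla_up H (Rs b) (ext10_01 alpha)) Bext w
      = - pv w.1 + sv w.1.
    by apply/matrixP => a j; rewrite mxE gpair_r !mxE opprB addrC.
  rewrite E1 E2 QE nabla_starE; move: (G w.1 *m _) (pv w.1) (sv w.1) => Y P S.
  rewrite scale_col_mx opp_col_mx add_col_mx scaler0 oppr0 addr0; congr col_mx.
  rewrite scalerA mulrN divff ?pnatr_eq0// scaleNr scale1r opprK.
  by rewrite -addrA (addrC Y) addNKr.
have XE w : Xfield H alpha w = twoRe (fun w =>
    col_mx (pv w.1) (- pv w.1 + G w.1 *m rowdiv (fun x => (N x)^T) w.1)) w.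
  by rewrite -(funext WE).
have conjR : mxconj (G z.1 *m rowdiv (fun x => (N x)^T) z.1) = G z.1 *m rowdiv N z.1.
  rewrite mxconjM realG conj_rowdiv; last exact: mxsmoothn_tr (sN 1).
  congr (_ *m _); apply/matrixP => b j; rewrite mxE [RHS]mxE; apply: eq_bigr => a _.
  by apply: eq_Dy => y; rewrite hermN mxconjK.
rewrite XE; apply/matrixP => k j; rewrite (ord1 j) mxE.
case: (split_ordP k) => c ->.
  rewrite bar_l !col_mxEu !col_mxEd -conjR /rho.
  move: (pv z.1) (G z.1 *m _) => P Y; rewrite !mxE rmorphD rmorphN.
  by rewrite ?addrA.
rewrite bar_r !col_mxEu !col_mxEd /rho.
move: (pv z.1) (G z.1 *m _) => P Y; rewrite !mxE opprB.
by rewrite -[RHS]addrA [RHS]addrC.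
Qed.

Lemma mxsmoothn_pv : mxsmoothn 1 pv.
Proof.
move=> a j; under eq_fun do rewrite mxE; rewrite /p.
apply: csmoothnM; first exact: csmoothn_cst.
apply: csmoothn_trace; apply: mxsmoothnM; last exact: sG.
apply: mxsmoothnM; last by apply: mxsmoothn_mxDy; exact: sq.
apply: mxsmoothnM; last exact: sG.
by apply: mxsmoothnM; [apply: mxsmoothn_conj; exact: sq|exact: sB].
Qed.

Lemma div_Xfield z : div H (Xfield H alpha) z = xdiv N z.1.
Proof.
have srho : mxsmoothn 1 rho.
  apply: mxsmoothnD; first exact: mxsmoothn_pv.
  by apply: mxsmoothnN; apply: mxsmoothn_conj; exact: mxsmoothn_pv.
have sNt : mxsmoothn 2 (fun x => (N x)^T) by exact: mxsmoothn_tr.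
have sGN Z : mxsmoothn 2 Z -> mxsmoothn 1 (fun x => G x *m rowdiv Z x).
  by move=> sZ; apply: mxsmoothnM; [exact: sG|exact: mxsmoothn_rowdiv].
have -> : Xfield H alpha = fun z => col_mx (rho z.1 + G z.1 *m rowdiv N z.1)
    (- rho z.1 + G z.1 *m rowdiv (fun x => (N x)^T) z.1).
  by apply/funext => w; exact: XfieldE.
rewrite (div_inv (fun x => rho x + G x *m rowdiv N x)
  (fun x => - rho x + G x *m rowdiv (fun x => (N x)^T) x)).
rewrite (dVD _ srho (sGN _ (sN 2))) (dVD _ (mxsmoothnN srho) (sGN _ sNt)).
have -> : dV (fun x => - rho x) z.1 = - dV rho z.1.
  rewrite -mulN1r -(dVZ _ _ srho); apply: eq_dV => y; by rewrite scaleN1r.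
rewrite (dV_rowdiv _ (sN 2)) (dV_rowdiv _ sNt) (xdiv_tr _ (sN 2)).
by field.
Qed.

End InvariantCalculus.

Transparent pd Cpd pdframe gmx ginv.

(** * The moment map equations *)

Section MomentMaps.
Context {R : realType} {n : nat}.
Variables h u : 'rV[R]_n -> R.
Variable q : 'rV[R]_n -> 'M[R[i]]_n.
Hypothesis hk : invariant_kahler h.
Let v := vpot h.
Hypothesis uv : symplectic_potential v u.
Hypothesis qc : invariant_compatible q.

Lemma kahler_smooth : smooth h. Proof. by have [] := hk. Qed.
Lemma kahler_periodic : Zperiodic h. Proof. by have [] := hk. Qed.

Lemma kmetricE z : kmetric h z = complexmx (Hess v z.1).
Proof.
have /smoothP sh' := kahler_smooth.
pose c (w : 'rV[R]_n) : R := \sum_a w 0 a ^+ 2.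
have kE x w : kpot h (x, w) = 1 * \sum_b x 0 b ^+ 2 + (4 * h x + c w).
  by rewrite /kpot /= big_split /= /c mul1r; ring.
have px b x w : pd b (fun x => kpot h (x, w)) x = 2 * x 0 b + 4 * pd b h x.
  rewrite (_ : (fun x => _) = fun x : 'rV[R]_n => 1 * \sum_b x 0 b ^+ 2 + (4 * h x + c w)); last first.
    by apply/funext => y; exact: kE.
  have s4 : smoothn 1 (fun x : 'rV[R]_n => 4 * h x) by apply: smoothnM; [exact: smoothn_cst|].
  have scw : smoothn 1 (fun _ : 'rV[R]_n => c w) by exact: smoothn_cst.
  rewrite pdD; [|exact: (smoothn_sqr_norm 1 _).1|exact: (smoothnD s4 scw).1].
  rewrite pdD; [|exact: s4.1|exact: scw.1].
  rewrite pd_sqr_norm pdM; [|exact: differentiable_cst|exact: (sh' 1%N).1].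
  by rewrite !pd_cst mul0r add0r addr0 mulr1.
have pw b x w : pd b (fun w => kpot h (x, w)) w = 2 * w 0 b.
  rewrite (_ : (fun w => _) = fun w : 'rV[R]_n => 1 * \sum_b w 0 b ^+ 2 + (\sum_b x 0 b ^+ 2 + 4 * h x)); last first.
    by apply/funext => y; rewrite kE /c; ring.
  rewrite pdD; [|exact: (smoothn_sqr_norm 1 _).1|exact: differentiable_cst].
  by rewrite pd_sqr_norm pd_cst addr0 mulr1.
have dzb b : dzbar b (fun z => (kpot h z)%:C) = fun z => (z.1 0 b + 2 * pd b h z.1) +i* z.2 0 b.
  apply/funext => -[x w]; rewrite /dzbar dx_fst dw_snd /= !Cpd_real px pw.
  by apply/eqP; rewrite eq_complex /=; apply/andP; split; apply/eqP; field.
apply/matrixP => a b; rewrite [LHS]mxE [RHS]mxE [X in _ = X%:C]mxE dzb.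
have sb : smoothn 1 (fun x : 'rV[R]_n => 2 * pd b h x).
  by apply: smoothnM; [exact: smoothn_cst|exact: smoothn_pd].
have CpdE c' (f g : 'rV[R]_n -> R) x : Cpd c' (fun x => f x +i* g x) x = pd c' f x +i* pd c' g x.
  by [].
have dxE : Cpd a (fun x => (x 0 b + 2 * pd b h x) +i* z.2 0 b) z.1
    = ((b == a)%:R + 2 * pd a (pd b h) z.1)%:C.
  rewrite (CpdE a (fun x => x 0 b + 2 * pd b h x)) pd_cst; congr (_ +i* _).
  rewrite pdD; [|exact: (smoothn_coord 1 b).1|exact: sb.1].
  rewrite pd_coord pdM; [|exact: differentiable_cst|exact: (smoothn_pd b (sh' 2%N)).1].
  by rewrite pd_cst mul0r add0r.
have dwE : Cpd a (fun w : 'rV[R]_n => (z.1 0 b + 2 * pd b h z.1) +i* w 0 b) z.2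
    = 0 +i* (b == a)%:R.
  by rewrite (CpdE a _ (fun w : 'rV[R]_n => w 0 b)) pd_cst pd_coord.
rewrite /dz dx_fst dw_snd /= dxE dwE /v (pd_vpot b kahler_smooth).
rewrite pdD; [|exact: (smoothn_coord 1 b).1|exact: (smoothn_pd b (sh' 2%N)).1].
rewrite pd_coord.
by apply/eqP; rewrite eq_complex /=; apply/andP; split; apply/eqP; field.
Qed.

Let V x : 'M[R[i]]_n := complexmx (Hess v x).
Let G x : 'M[R[i]]_n := complexmx (Hess u (grad v x)).

Lemma smoothn_v k : smoothn k v.
Proof. exact: smoothn_vpot kahler_smooth. Qed.

Lemma Hess_vpotE x a b : V x a b = (pd a (pd b v) x)%:C.
Proof. by rewrite !mxE. Qed.

Lemma smooth_V k : mxsmoothn k V.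
Proof.
move=> a b; rewrite (_ : (fun x => _) = fun x => (pd a (pd b v) x)%:C); last first.
  by apply/funext => x; exact: Hess_vpotE.
by apply: csmoothn_real; do 2! apply: smoothn_pd; exact: smoothn_v.
Qed.

Lemma symV x : (V x)^T = V x.
Proof. by apply/matrixP => a b; rewrite mxE !Hess_vpotE (pdC _ _ _ (smoothn_v 2)). Qed.

Lemma symV3 a b c x : mxpd a V x b c = mxpd b V x a c.
Proof.
have E d e : mxpd d V x e c = (pd d (pd e (pd c v)) x)%:C.
  by rewrite mxpdE -Cpd_real; apply: eq_Cpd => y; exact: Hess_vpotE.
apply: etrans (E a b) _; apply: etrans (esym (E b a)).
exact: (congr1 (fun r : R => r%:C) (pdC a b x (smoothn_pd c (smoothn_v 3)))).
Qed.

Lemma realV x : mxconj (V x) = V x.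
Proof. exact: mxconj_complex. Qed.

Lemma VG x : V x *m G x = 1%:M.
Proof.
by rewrite /V /G /complexmx -map_mxM (Hess_legendre kahler_smooth uv) map_mx1.
Qed.

Lemma perV : Zperiodic V.
Proof.
have E a b : pd a (pd b v) = fun x => (b == a)%:R + pd a (pd b h) x.
  have /smoothP sh' := kahler_smooth.
  apply/funext => x; rewrite /v (pd_vpot b kahler_smooth).
  rewrite pdD; [|exact: (smoothn_coord 1 b).1|exact: (smoothn_pd b (sh' 2%N)).1].
  by rewrite pd_coord.
have P2 a b : Zperiodic (pd a (pd b v)).
  rewrite E => x k.
  exact: (congr1 (fun r : R => (b == a)%:R + r) (Zperiodic_pd a (Zperiodic_pd b kahler_periodic) x k)).
move=> x k; apply/matrixP => a b; apply: etrans (Hess_vpotE _ a b) (etrans _ (esym (Hess_vpotE x a b))).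
exact: (congr1 (fun r : R => r%:C) (P2 a b x k)).
Qed.

Lemma posV x : posdefmx (V x).
Proof. by have [_ _ /(_ (x, 0))] := hk; rewrite kmetricE. Qed.

Lemma ctrV x : ctr (V x) = V x.
Proof. by rewrite /ctr realV symV. Qed.

Lemma detV x : 0 < \det (V x).
Proof.
have [P [W [PW _ ->]]] := posdef_gram (ctrV x) (posV x).
have P0 : \det P != 0.
  have := congr1 determinant PW; rewrite det_mulmx det1 => E.
  by apply: contra_eq_neq E => ->; rewrite mul0r eq_sym oner_eq0.
have cP : \det (ctr P) = conjc (\det P) by rewrite /ctr det_tr det_map_mx.
rewrite det_mulmx cP mulrC.
by rewrite -normCK exprn_gt0// normr_gt0.
Qed.

Lemma smooth_G k : mxsmoothn k G.
Proof.
rewrite (_ : G = fun x => invmx (V x)); last first.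
  by apply/funext => x; rewrite (mulmx1_inv (VG x)).
apply: mxsmoothn_inv => [x|]; last exact: smooth_V.
by rewrite unitmxE unitfE gt_eqF// detV.
Qed.

Lemma smooth_q k : mxsmoothn k q.
Proof. by move=> a b; have [/(_ a b)/CsmoothP] := qc. Qed.

Lemma symq x : (q x)^T = q x. Proof. by have [_ _] := qc. Qed.

Let A x := G x *m q x.
Let M x := A x *m G x *m mxconj (q x).

Lemma deformationE z : deformation v q z = A z.1.
Proof.
have GE : complexmx (invmx (Hess v z.1)) = G z.1.
  by rewrite (mulmx1_inv (Hess_legendre kahler_smooth uv z.1)).
have AT : (q z.1 *m G z.1)^T = A z.1.
  by rewrite trmx_mul symq; congr (_ *m _); exact: (symG VG symV).
by apply/matrixP => b a; rewrite mxE GE -AT [RHS]mxE.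
Qed.

Hypothesis ev : forall z lam, eigenvalue (aabar (deformation v q) z) lam -> lam < 1.

Lemma aabarE z : aabar (deformation v q) z = M z.1.
Proof.
rewrite /aabar deformationE /M /A mxconjM (realG VG realV z.1).
by rewrite !mulmxA.
Qed.

Let B x := funcalc psi (M x).
Let N x := funcalc psi (q x *m G x *m mxconj (q x) *m G x) *m (q x *m G x *m mxconj (q x)).
Let K x := V x - (N x + N x).

Lemma evM x lam : eigenvalue (M x) lam -> lam < 1.
Proof. by have := ev (z := (x, 0)) (lam := lam); rewrite aabarE. Qed.

Lemma half_double (X : 'M[R[i]]_n) : 2^-1 *: X + 2^-1 *: X = X.
Proof. by apply/matrixP => a b; rewrite !mxE; field. Qed.

Lemma geometric_mean_spec x : (exists P W r, frame (V x) (G x) (K x) P W r) /\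
  [/\ K x *m G x *m K x = V x - q x *m G x *m mxconj (q x),
      (V x + K x) *m B x = 2^-1 *: V x & M x *m B x = G x *m N x].
Proof.
have [P [W [r [[PW WP EV EG r1]]]]] :=
  psi_diag (ctrV x) (posV x) (VG x) (symq x) (@evM x).
have [K0 EK] : exists K0, K0 = ctr P *m diag_mx (complexmx r) *m P by eexists.
rewrite /= -EK => -[KGK VKB MB NE].
have N2 : N x + N x = V x - K0.
  by rewrite /N NE half_double.
have KE : K x = K0 by rewrite /K N2 opprB addrC subrK.
split; first by exists P, W, r; split=> //; split=> //; rewrite KE.
by rewrite KE; split=> //; rewrite /N NE.
Qed.

Lemma mxsmoothn_conj_q k : mxsmoothn k (fun x => mxconj (q x)).
Proof. by apply: mxsmoothn_conj; exact: smooth_q. Qed.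

Lemma smooth_K k : mxsmoothn k K.
Proof.
pose S x := V x - q x *m G x *m mxconj (q x).
have sS k' : mxsmoothn k' S.
  apply: mxsmoothnD; first exact: smooth_V.
  apply: mxsmoothnN; apply: mxsmoothnM; last exact: mxsmoothn_conj_q.
  by apply: mxsmoothnM; [exact: smooth_q|exact: smooth_G].
apply: (geometric_mean_smooth smooth_V smooth_G sS (K := K)) => x; first exact: (geometric_mean_spec x).1.
by have [_ []] := geometric_mean_spec x.
Qed.

Lemma NK x : N x = 2^-1 *: (V x - K x).
Proof.
by rewrite /K opprB addrC subrK -[LHS]half_double scalerDr.
Qed.

Lemma smooth_N k : mxsmoothn k N.
Proof.
rewrite (_ : N = fun x => 2^-1 *: (V x - K x)); last by apply/funext => x; exact: NK.
apply: (mxsmoothnZ (F := fun=> 2^-1)); first exact: csmoothn_cst.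
by apply: mxsmoothnD; [exact: smooth_V|apply: mxsmoothnN; exact: smooth_K].
Qed.

Lemma smooth_B k : mxsmoothn k B.
Proof.
have VKu x : V x + K x \in unitmx.
  have [_ [_ /(congr1 determinant)]] := geometric_mean_spec x; rewrite det_mulmx detZ => E _.
  rewrite unitmxE unitfE; apply: contra_eq_neq E => ->; rewrite mul0r eq_sym.
  by rewrite mulf_neq0 ?gt_eqF ?detV// expf_neq0// invr_neq0// pnatr_eq0.
rewrite (_ : B = fun x => invmx (V x + K x) *m (2^-1 *: V x)); last first.
  by apply/funext => x; have [_ [_ <- _]] := geometric_mean_spec x; rewrite mulKmx.
apply: mxsmoothnM.
  by apply: mxsmoothn_inv => //; apply: mxsmoothnD; [exact: smooth_V|exact: smooth_K].
by apply: (mxsmoothnZ (F := fun=> 2^-1)); [exact: csmoothn_cst|exact: smooth_V].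
Qed.

Lemma NE x : q x *m G x *m mxconj (q x) *m B x = N x.
Proof.
have VGK (X : 'M[R[i]]_n) : V x *m (G x *m X) = X by rewrite mulmxA VG mul1mx.
have MBE : M x *m B x = G x *m (q x *m G x *m mxconj (q x) *m B x).
  by rewrite /M /A !mulmxA.
have [_ [_ _ MB]] := geometric_mean_spec x.
exact: etrans (esym (VGK _)) (etrans (congr1 (mulmx (V x)) (etrans (esym MBE) MB)) (VGK _)).
Qed.

Lemma hermN x : (N x)^T = mxconj (N x).
Proof.
have ctrK' : ctr (K x) = K x.
  have [[P [W [r [_ _ _ _ [_ ->]]]]] _] := geometric_mean_spec x.
  by rewrite !ctrM ctrK ctr_diag mulmxA.
have ctrN : ctr (N x) = N x.
  rewrite NK; move: (V x) (K x) (ctrV x) ctrK' => X Y /matrixP EX /matrixP EY.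
  apply/matrixP => a b; have := EX a b; have := EY a b.
  have cj (s t : R[i]) : conjc (2^-1 * (s - t)) = 2^-1 * (conjc s - conjc t).
    by rewrite rmorphM rmorphB fmorphV rmorph_nat.
  by rewrite !mxE => EYab EXab; rewrite cj EXab EYab.
by rewrite -[in LHS]ctrN /ctr trmxK.
Qed.

Lemma conjNE x : mxconj (q x) *m B x *m G x *m q x = mxconj (N x).
Proof.
have [P [W [r [[PW WP _ GE _] _]]]] :=
  psi_diag (ctrV x) (posV x) (VG x) (symq x) (@evM x).
have [P' [W' [d [P'W' W'P' _ _ [ME _]]]]] := simult_diag (ctrV x) (posV x) (VG x) (symq x).
have BE := funcalcI psi P'W' ME.
have cd (e : 'rV[R]_n) : mxconj (diag_mx (complexmx e)) = diag_mx (complexmx e).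
  by rewrite /mxconj map_diag_mx -/(mxconj _) mxconj_complex.
have c1 (X Y : 'M[R[i]]_n) : X *m Y = 1%:M -> mxconj X *m mxconj Y = 1%:M.
  by move=> XY; rewrite -mxconjM XY /mxconj map_mx1.
have cME : mxconj (M x) = mxconj W' *m diag_mx (complexmx d) *m mxconj P'.
  by rewrite /M /A ME !mxconjM cd.
have cBE : mxconj (B x) = mxconj W' *m diag_mx (complexmx (map_mx psi d)) *m mxconj P'.
  by rewrite /B /M /A BE !mxconjM cd.
have MA : M x *m A x = A x *m mxconj (M x).
  by rewrite /M /A !mxconjM mxconjK (realG VG realV) !mulmxA.
have BA := diag_intertwine P'W' W'P' (c1 _ _ P'W') (c1 _ _ W'P') ME cME BE cBE MA.
rewrite -[RHS](congr1 (@mxconj R n n) (NE x)) !mxconjM mxconjK (realG VG realV).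
by rewrite -!mulmxA; congr (_ *m _); rewrite !mulmxA -[RHS]BA /A !mulmxA.
Qed.

Lemma ddiv_legendre (Z Zx : 'rV[R]_n -> 'M[R[i]]_n) x :
  (forall x, Z (grad v x) = Zx x) -> mxsmoothn 2 Zx -> ddiv Z (grad v x) = xdiv G Zx x.
Proof.
move=> ZE sZ; apply: eq_bigr => a _; apply: eq_bigr => b _.
have step c (F Fx : 'rV[R]_n -> R[i]) : (forall x, F (grad v x) = Fx x) ->
    cdifferentiable Fx -> forall x, Cpd c F (grad v x) = Dy G c Fx x.
  move=> FE dF y; rewrite (Cpd_legendre kahler_smooth kahler_periodic uv c y FE dF).
  have GE d : (Hess u (grad v y) c d)%:C = G y c d by rewrite [RHS]mxE.
  exact: (eq_bigr _ (fun d _ => congr1 (fun s => s * Cpd d Fx y) (GE d))).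
have dZ : cdifferentiable (fun x => Zx x a b) := csmoothn_diff (sZ a b).
have sDy : csmoothn 1 (Dy G a (fun x => Zx x a b)).
  by apply: csmoothn_Dy; [exact: smooth_G|exact: sZ].
apply: (step b _ _ _ (csmoothn_diff sDy)) => y; apply: (step a _ _ _ dZ) => w.
by rewrite ZE.
Qed.

Lemma Dy_lin a (c : R[i]) (F F' : 'rV[R]_n -> R[i]) x : csmoothn 1 F -> csmoothn 1 F' ->
  Dy G a (fun x => c * F x + F' x) x = c * Dy G a F x + Dy G a F' x.
Proof.
move=> sF sF'; rewrite /Dy mulr_sumr -big_split; apply: eq_bigr => d _.
have scF : csmoothn 1 (fun x => c * F x) by apply: csmoothnM => //; exact: csmoothn_cst.
rewrite (CpdD d x (csmoothn_diff scF) (csmoothn_diff sF')) (CpdZ d c x sF).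
by rewrite mulrDr mulrCA.
Qed.

Lemma xdiv_lin (c : R[i]) (Z W : 'rV[R]_n -> 'M[R[i]]_n) x : mxsmoothn 2 Z -> mxsmoothn 2 W ->
  xdiv G (fun x => c *: Z x + W x) x = c * xdiv G Z x + xdiv G W x.
Proof.
move=> sZ sW; rewrite /xdiv mulr_sumr -big_split; apply: eq_bigr => a _.
rewrite mulr_sumr -big_split; apply: eq_bigr => b _.
have sDy k F : csmoothn k.+1 F -> csmoothn k (Dy G a F) by apply: csmoothn_Dy; exact: smooth_G.
apply: etrans (Dy_lin b c x (sDy 1%N _ (sZ a b)) (sDy 1%N _ (sW a b))).
apply: eq_Dy => y.
apply: etrans (Dy_lin a c y (mxsmoothnW sZ a b) (mxsmoothnW sW a b)).
by apply: eq_Dy => w; rewrite !mxE.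
Qed.

Lemma moment_maps (xi : 'rV[R]_n -> 'M[R[i]]_n) : (forall x, xi (grad v x) = q x) ->
  let g := kmetric h in
  let alpha := deformation v q in
  let G y := complexmx (Hess u y) in
  let xiGxibar y := xi y *m G y *m mxconj (xi y) in
  let acheck y := funcalc psi (xiGxibar y *m G y) in
  (forall z, div g (dstar g alpha) z = - 4^-1 * ddiv xi (grad v z.1)) /\
  (forall z, 2 * scal g z - 2 * scal_avg g + div g (Xfield g alpha) z =
     ddiv (fun y => - 2^-1 *: invmx (G y) + acheck y *m xiGxibar y) (grad v z.1)).
Proof.
move=> xiq g alpha Gy xiGxibar acheck.
have gE : g = fun z => V z.1 by apply/funext => z; exact: kmetricE.
have aE : alpha = fun z => (fun x => G x *m q x) z.1.
  by apply/funext => z; exact: deformationE.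
have ahatE z : ahat (fun z0 : Cspace R n => (fun x : 'rV_n => G x *m q x) z0.1) z = B z.1.
  by rewrite -aE /ahat aabarE.
rewrite gE aE; split=> z.
  rewrite (div_dstar smooth_V smooth_G VG symV symV3 smooth_q symq).
  by rewrite (ddiv_legendre z.1 xiq (smooth_q 2)).
rewrite (scal_avgE smooth_V smooth_G VG symV symV3 detV perV) mulr0 subr0.
rewrite (scalE smooth_V smooth_G VG symV symV3 detV).
rewrite (div_Xfield smooth_V smooth_G VG symV symV3 realV smooth_q symq smooth_B smooth_N ahatE NE hermN conjNE).
rewrite (ddiv_legendre (Zx := fun x => - 2^-1 *: V x + N x)) => [|x|]; last 2 first.
- rewrite /acheck /xiGxibar /Gy xiq -/(G x); congr (_ *: _ + _).
  by apply: mulmx1_inv; exact: (GV VG).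
- apply: mxsmoothnD; last exact: smooth_N.
  by apply: (mxsmoothnZ (F := fun=> - 2^-1)); [exact: csmoothn_cst|exact: smooth_V].
rewrite (xdiv_lin _ _ (smooth_V 2) (smooth_N 2)) mulrA; congr (_ * _ + _).
by field.
Qed.

End MomentMaps.

Theorem theorem4p0p1 (R : realType) (n : nat)
    (h : 'rV[R]_n -> R) (u : 'rV[R]_n -> R)
    (q xi : 'rV[R]_n -> 'M[R[i]]_n) :
  let v := vpot h in
  let g := kmetric h in
  let alpha := deformation v q in
  let G y := complexmx (Hess u y) in
  let xiGxibar y := xi y *m G y *m mxconj (xi y) in
  let acheck y := funcalc psi (xiGxibar y *m G y) in
  invariant_kahler h ->
  symplectic_potential v u ->
  invariant_compatible q ->
  (forall (z : Cspace R n) (lam : R[i]),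
     eigenvalue (aabar alpha z) lam -> lam < 1) ->
  (forall x, xi (grad v x) = q x) ->
  ((forall z, div g (dstar g alpha) z = 0) <->
   (forall y, ddiv xi y = 0))
  /\
  ((forall z, 2 * scal g z - 2 * scal_avg g + div g (Xfield g alpha) z = 0) <->
   (forall y, ddiv (fun y => - 2^-1 *: invmx (G y)
                             + acheck y *m xiGxibar y) y = 0)).
Proof.
move=> v g alpha G xiGxibar acheck hk uv qc ev xiq.
have [cplx real] := moment_maps hk uv qc ev xiq.
have surj y : exists x, grad v x = y by apply: grad_surjective; [exact: kahler_smooth hk|exact: kahler_periodic hk].
split; split=> eq0.
- move=> y; have [x <-] := surj y.
  have /eqP := eq0 (x, 0); rewrite cplx mulf_eq0 oppr_eq0 invr_eq0 pnatr_eq0 /=.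
  by move=> /eqP.
- by move=> z; rewrite cplx eq0 mulr0.
- by move=> y; have [x <-] := surj y; apply: etrans (eq0 (x, 0)); rewrite real.
- by move=> z; rewrite real eq0.
Qed.
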